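(* Let $\epsilon>0$, $g>0$ and real-valued initial data $(h_{\rm init},\dot h_{\rm init})$ on $\mathbb{S}^1$ be given. Assume that there exists $1<D<\infty$ such that $$h_{\rm init}(x_1)=\sum_{|\ell|\le D}\widehat{h}_{\rm init}(\ell)e^{i\ell x_1},\qquad \dot h_{\rm init}(x_1)=\sum_{|\ell|\le D,\ \ell\ne 0}\widehat{\dot h}_{\rm init}(\ell)e^{i\ell x_1}.$$ Then there exists a unique analytic solution $h(x_1,t)\in C([0,T];X_{0.5})$ to the quadratic $h$-model $$\partial_t^2 h+g\Lambda h=-\Lambda\big(|H\partial_t h|^2\big)+g\Lambda(h\Lambda h)+g\,\partial_1(h\,\partial_1 h)$$ with initial conditions $h(x_1,0)=h_{\rm init}(x_1)$, $\partial_t h(x_1,0)=\dot h_{\rm init}(x_1)$, for $t$ in the time interval $[0,T]$ with $$T=\frac{1}{e\,\epsilon\,4\,C\big(\|\Lambda^{0.5}h_{\rm init}\|_{X_0},\|\dot h_{\rm init}\|_{X_0}\big)},$$ where $C(\|\Lambda^{0.5}h_{\rm init}\|_{X_0},\|\dot h_{\rm init}\|_{X_0})$ is a positive constant which, for the given $\epsilon$ and $g$, depends on the data only through the two indicated norms. Equivalently, the Stokes expansion for the quadratic $h$-model converges for arbitrary $\epsilon>0$ and $T>0$ taken sufficiently small.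
   Context: $\mathbb{S}^1$ is identified with $[-\pi,\pi]$ (functions are $2\pi$-periodic in $x_1$), $\partial_1=\partial/\partial x_1$. Fourier coefficients are $\hat f(k)=\frac1{2\pi}\int_{\mathbb{S}^1}f(x_1)e^{-ikx_1}\,dx_1$. The operators $H$ (Hilbert transform), $\Lambda$ and $\Lambda^{0.5}$ are defined by $\widehat{Hf}(k)=-i\,\mathrm{sgn}(k)\hat f(k)$, $\widehat{\Lambda f}(k)=|k|\hat f(k)$, $\widehat{\Lambda^{0.5}f}(k)=|k|^{1/2}\hat f(k)$. For $\tau\ge 0$, $X_\tau=\{u:\mathbb{S}^1\to\mathbb{R}\ :\ \|u\|_{X_\tau}=\sum_{m\in\mathbb{Z}}e^{\tau|m|}|\hat u(m)|<\infty\}$. Stokes expansion of the quadratic $h$-model: $h(x_1,t)=\sum_{k=0}^\infty \epsilon^{k+1}h_k(x_1,t)$ and $\partial_t h(x_1,t)=\sum_{k=0}^\infty\epsilon^{k+1}\partial_t h_k(x_1,t)$, where the functions $h_k$ are defined recursively as the solutions of the linear problems $$\partial_t^2h_k=-g\Lambda h_k+\sum_{j=0}^{k-1}\Big[\Lambda\big(g h_j\Lambda h_{k-1-j}-H\partial_t h_j\,H\partial_t h_{k-1-j}\big)+g\,\partial_1\big(h_j\,\partial_1h_{k-1-j}\big)\Big]$$ (the sum being zero for $k=0$), with initial conditions $h_0(x_1,0)=h_{\rm init}(x_1)/\epsilon$, $\partial_t h_0(x_1,0)=\dot h_{\rm init}(x_1)/\epsilon$, and $h_k(x_1,0)=\partial_t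 h_k(x_1,0)=0$ for $k\ge1$.
   Formalization: The constant C is also allowed to depend on the bandwidth D; one depending only on ε, g and the two norms is impossible, since for h_init=0, ḣ_init=A cos(Nx) the norms stay fixed while the time of convergence in X_{0.5} tends to 0 as N grows. *)

(* Defs.v *)
From HB Require Import structures.
From mathcomp Require Import all_boot all_order all_algebra.
From mathcomp Require Import all_classical all_reals all_analysis.
From mathcomp Require Import complex.
Set Implicit Arguments.
Unset Strict Implicit.
Unset Printing Implicit Defensive.
Import Order.TTheory GRing.Theory Num.Theory.
Import numFieldNormedType.Exports.

Local Open Scope classical_set_scope.
Local Open Scope ring_scope.

Section Fourier.
Variable R : realType.
Implicit Types (f : R -> R) (k : int) (x tau : R).

Definition cis x : R[i] := (cos x +i* sin x)%C.

Definition complex_integral (A : set R) (F : R -> R[i]) : R[i] :=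
  (Rintegral lebesgue_measure A (fun x => complex.Re (F x)) +i*
   Rintegral lebesgue_measure A (fun x => complex.Im (F x)))%C.

Definition fourier_coef f k : R[i] :=
  ((2 * pi)^-1)%:C%C *
  complex_integral `[- pi, pi] (fun x => (f x)%:C%C * cis (- (k%:~R * x))).

(* The function with Fourier coefficients [sym k * fourier_coef f k], given as
   the limit of its symmetric partial Fourier sums.  All symbols below satisfy
   [sym (- k) = conj (sym k)], so these sums are real and taking the real part
   only casts them from R[i] to R. *)
Definition fourier_multiplier (sym : int -> R[i]) f : R -> R := fun x =>
  limn (fun N : nat => complex.Re
    (\sum_(k \in [set k : int | `|k| <= N%:Z])
       sym k * fourier_coef f k * cis (k%:~R * x))).

Definition hilbert f : R -> R :=
  fourier_multiplier (fun k => - 'i%C * (sgz k)%:~R) f.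

Definition Lambda f : R -> R := fourier_multiplier (fun k => `|k|%:~R) f.

Definition sqrtLambda f : R -> R :=
  fourier_multiplier (fun k => (Num.sqrt (`|k|%:~R : R))%:C%C) f.

Definition normX tau f : \bar R :=
  \esum_(m in [set: int])
    (expR (tau * `|m|%:~R) * ComplexField.Normc.normc (fourier_coef f m))%:E.

(* Functions on the circle are 2pi-periodic functions on R.  The finiteness of
   the norm only determines [f] almost everywhere; continuity selects the
   representative for which pointwise identities make sense. *)
Definition inX tau f : Prop :=
  [/\ forall x, f (x + 2 * pi) = f x, continuous f & (normX tau f < +oo)%E].

End Fourier.

Section Evolution.
Variable R : realType.
(* Space-time functions take the time first: [u t x]. *)
Implicit Types (I : set R) (u v h ht : R -> R -> R).

(* u \in C(I; X_tau) *)
Definition continuous_in_X I (tau : R) u : Prop :=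
  (forall t, I t -> inX tau (u t)) /\
  (forall t, I t ->
    normX tau (fun x => u s x - u t x) @[s --> within I (nbhs t)] --> 0%E).

(* v is the time derivative of u on I, one-sided at the endpoints of I. *)
Definition is_time_derivative I u v : Prop :=
  forall t x, I t ->
    (u s x - u t x) / (s - t) @[s --> within I t^'] --> v t x.

Definition real_analytic (f : R -> R) : Prop :=
  forall x0 : R, exists2 r : R, 0 < r &
    exists a : nat -> R, forall x, `|x - x0| < r ->
      series (fun n => a n * (x - x0) ^+ n) @ \oo --> f x.

(* ht is the time derivative of h.  Its membership in some X_sigma, sigma > 0,
   is the analyticity of the velocity, with an unspecified strip width. *)
Definition analytic_solution (g T : R) (hinit hdinit : R -> R) h ht : Prop :=
  let I := `[0, T]%classic in
  [/\ continuous_in_X I 2^-1 h,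
      exists2 sigma : R, 0 < sigma & continuous_in_X I sigma ht,
      forall t, I t -> real_analytic (h t) /\ real_analytic (ht t),
      is_time_derivative I h ht
    & [/\ exists2 htt : R -> R -> R, is_time_derivative I ht htt &
          forall t x, I t ->
            htt t x + g * Lambda (h t) x =
            - Lambda (fun y => `|hilbert (ht t) y| ^+ 2) x
            + g * Lambda (fun y => h t y * Lambda (h t) y) x
            + g * derive1 (fun y => h t y * derive1 (h t) y) x,
          forall x, h 0 x = hinit x
        & forall x, ht 0 x = hdinit x]].

(* hk k and hkt k are the k-th coefficient of the Stokes expansion and its time
   derivative; the linear problems are posed for all t >= 0. *)
Definition stokes_coefficients (eps g : R) (hinit hdinit : R -> R)
    (hk hkt : nat -> R -> R -> R) : Prop :=
  let I := `[0, +oo[%classic in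
  forall k : nat,
  [/\ exists2 sigma : R, 0 < sigma &
        continuous_in_X I sigma (hk k) /\ continuous_in_X I sigma (hkt k),
      is_time_derivative I (hk k) (hkt k),
      is_time_derivative I (hkt k) (fun t x =>
        - g * Lambda (hk k t) x +
        \sum_(j < k)
          (Lambda (fun y =>
               g * hk j t y * Lambda (hk (k.-1 - j)%N t) y
               - hilbert (hkt j t) y * hilbert (hkt (k.-1 - j)%N t) y) x
           + g * derive1 (fun y => hk j t y * derive1 (hk (k.-1 - j)%N t) y) x)),
      forall x, hk k 0 x = if k is 0%N then hinit x / eps else 0
    & forall x, hkt k 0 x = if k is 0%N then hdinit x / eps else 0].

(* \sum_k eps^(k+1) uk k = u in C(I; X_tau), i.e. in the norm
   sup_(t in I) || . ||_(X_tau) *)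
Definition expansion_converges (eps : R) I (tau : R)
    (uk : nat -> R -> R -> R) u : Prop :=
  forall delta : R, 0 < delta ->
    \forall n \near \oo, forall t, I t ->
      (normX tau (fun x =>
         ((\sum_(k < n) eps ^+ k.+1 * uk k t x) - u t x)%R) <= delta%:E)%E.

End Evolution.

(* Main.v *)
Require Import Defs.
From HB Require Import structures.
From mathcomp Require Import all_boot all_order all_algebra.
From mathcomp Require Import all_classical all_reals all_analysis.
From mathcomp Require Import complex.
From mathcomp Require Import ring lra zify.
(** The model reads h'' = - g Lambda h + N(h, h'), where N is the quadratic form
    of a bilinear map [nlin] that loses one derivative.  Everything is measured
    by the weighted sums of Fourier coefficients that define the spaces X_tau,
    which are algebras under multiplication ([normXM]).

    Existence.  The loss of a derivative is harmless on trigonometric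
    polynomials: the derivative costs at most a factor of the largest frequency, and the
    k-th Stokes coefficient has frequencies at most (k + 1) D.  That coefficient
    is sought as a power series in time, whose coefficients obey an explicit
    recursion ([taylor]).  They are bounded by q_k (alpha (k + 1)) ^ n / n!
    ([taylor_controlled]), where q_k solves the recursion of the Catalan numbers
    q_k = kappa * \sum_(j < k) q_j q_(k - 1 - j): the binomial theorem adds the
    rates alpha (j + 1) and alpha (k - j) of two factors to alpha (k + 1)
    ([exp_coeffD]), and the factor n + 1 gained by integrating in time pays for
    the frequency (k + 1) D as soon as alpha is large against g and D.  Hence on
    [0, 1 / alpha] the k-th coefficient is of size q_k e ^ (k + 1), in X_(1/2) at
    most e ^ (D (k + 1)) times that, and the expansion in powers of eps converges
    normally as soon as 4 kappa q_0 eps e ^ (D + 2) <= 1 ([catalan_series_le],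
    [expansion_summable]).  Since kappa decays like 1 / alpha, this is one more
    lower bound on alpha.  The sum solves the equation because the bilinear map
    commutes with Cauchy products of normally convergent series ([nlin_ssum]).

    Dependence of the time on the data.  q_0 has to bound Lambda h_0 and its
    velocity only: since Lambda ^ 2 + d ^ 2 / dx ^ 2 = 0, the two quadratic terms
    of the potential energy cancel when their first factor is constant
    ([nlin_cst]), so the mean of h never enters.  On frequencies at most D,
    Lambda h is controlled by sqrt D times Lambda ^ 0.5 h ([normX_lam_sqrt]).

    Uniqueness.  The difference of two solutions solves a linear equation with
    bounded coefficients and a loss of one derivative.  A Cauchy-Kovalevskaya
    argument on Fourier coefficients shows that it vanishes ([ck_unique]): in a
    weight exp (rho(t) |l|) whose width shrinks linearly in time, the lost factor
    |l| is recovered by integrating in time, so that every bound on a short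
    interval of fixed length improves to half of itself.  The same
    argument shows that the Stokes coefficients are unique, so the convergence
    proved for the constructed ones holds for any. *)

Set Implicit Arguments.
Unset Strict Implicit.
Unset Printing Implicit Defensive.
Import Order.TTheory GRing.Theory Num.Theory.
Import numFieldNormedType.Exports.
Local Open Scope classical_set_scope.
Local Open Scope ring_scope.

Notation normc := ComplexField.Normc.normc.
Notation Re := complex.Re.
Notation Im := complex.Im.

(** * Moduli of complex numbers *)

Section ComplexPreliminaries.
Variable R : realType.
Implicit Types (z w : R[i]) (x y : R) (k m : int).

Lemma ReD z w : Re (z + w) = Re z + Re w. Proof. by case: z; case: w. Qed.
Lemma ImD z w : Im (z + w) = Im z + Im w. Proof. by case: z; case: w. Qed.
Lemma ReN z : Re (- z) = - Re z. Proof. by case: z. Qed.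
Lemma ImN z : Im (- z) = - Im z. Proof. by case: z. Qed.
Lemma ReB z w : Re (z - w) = Re z - Re w. Proof. by rewrite ReD ReN. Qed.
Lemma ImB z w : Im (z - w) = Im z - Im w. Proof. by rewrite ImD ImN. Qed.
Lemma ReM z w : Re (z * w) = Re z * Re w - Im z * Im w.
Proof. by case: z; case: w. Qed.
Lemma ImM z w : Im (z * w) = Re z * Im w + Im z * Re w.
Proof. by case: z; case: w. Qed.
Lemma Re_sum I (r : seq I) (P : pred I) (F : I -> R[i]) :
  Re (\sum_(i <- r | P i) F i) = \sum_(i <- r | P i) Re (F i).
Proof. exact: (big_morph _ ReD). Qed.
Lemma Im_sum I (r : seq I) (P : pred I) (F : I -> R[i]) :
  Im (\sum_(i <- r | P i) F i) = \sum_(i <- r | P i) Im (F i).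
Proof. exact: (big_morph _ ImD). Qed.
Lemma complex_ext z w : Re z = Re w -> Im z = Im w -> z = w.
Proof. by case: z => a b; case: w => c d /= -> ->. Qed.

Lemma normc_ge0 z : 0 <= normc z. Proof. by case: z => a b; rewrite sqrtr_ge0. Qed.
Lemma normcD z w : normc (z + w) <= normc z + normc w.
Proof. exact: le_normcD. Qed.
Lemma normcB z w : normc (z - w) <= normc z + normc w.
Proof. by rewrite -(normcN w); exact: normcD. Qed.
Lemma normc_sum I (r : seq I) (P : pred I) (F : I -> R[i]) :
  normc (\sum_(i <- r | P i) F i) <= \sum_(i <- r | P i) normc (F i).
Proof.
elim/big_rec2: _ => [|i x y _ h]; first by rewrite ComplexField.Normc.normc0.
by rewrite (le_trans (normcD _ _))// lerD2l.
Qed.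
Lemma normcR x : normc x%:C%C = `|x|.
Proof. by rewrite /= expr0n /= addr0 sqrtr_sqr. Qed.
Lemma normc_conj z : normc z^*%C = normc z.
Proof. by case: z => a b /=; rewrite sqrrN. Qed.
Lemma normc_Re z : `|Re z| <= normc z.
Proof. by case: z => a b /=; rewrite -sqrtr_sqr ler_wsqrtr// lerDl sqr_ge0. Qed.
Lemma normc_Im z : `|Im z| <= normc z.
Proof. by case: z => a b /=; rewrite -sqrtr_sqr ler_wsqrtr// lerDr sqr_ge0. Qed.
Lemma normc_le_ReIm z : normc z <= `|Re z| + `|Im z|.
Proof.
case: z => a b /=; rewrite -[leRHS]ger0_norm ?addr_ge0// -sqrtr_sqr ler_wsqrtr//.
rewrite sqrrD !real_normK ?num_real// lerD2r lerDl mulrn_wge0// mulr_ge0//.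
Qed.
Lemma normc_eq0 z : normc z = 0 -> z = 0.
Proof. exact: ComplexField.Normc.eq0_normc. Qed.
Lemma normcM z w : normc (z * w) = normc z * normc w.
Proof. exact: ComplexField.Normc.normcM. Qed.
Lemma normc0 : normc (0 : R[i]) = 0. Proof. exact: ComplexField.Normc.normc0. Qed.
Lemma normc_i : normc ('i%C : R[i]) = 1.
Proof. by rewrite /= expr0n expr1n add0r sqrtr1. Qed.
Lemma normc_int k : normc (k%:~R : R[i]) = `|k%:~R|.
Proof. by rewrite -normcR rmorph_int. Qed.

Lemma normc_cis x : normc (cis x) = 1.
Proof. by rewrite /= cos2Dsin2 sqrtr1. Qed.
Lemma cisD x y : cis (x + y) = cis x * cis y.
Proof.
by rewrite /cis cosD sinD; apply: complex_ext; rewrite ?ReM ?ImM //= addrC.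
Qed.
Lemma cisN x : cis (- x) = (cis x)^*%C.
Proof. by rewrite /cis cosN sinN. Qed.
Lemma cis0 : cis (0 : R) = 1.
Proof. by rewrite /cis cos0 sin0. Qed.
Lemma cis_int2pi k : cis (k%:~R * (2 * pi)) = 1 :> R[i].
Proof.
have h n : cis (n%:R * (2 * pi)) = 1 :> R[i].
  elim: n => [|n ih]; first by rewrite mul0r cis0.
  rewrite -natr1 mulrDl mul1r cisD ih mul1r /cis mulr_natl cos2pi sin2pi//.
case: k => n; first exact: h.
by rewrite NegzE rmorphN/= mulNr cisN h conjc1.
Qed.
End ComplexPreliminaries.

(** * Dominated series *)

Section MTest.
Variable R : realType.
Implicit Types (u M : nat -> R).

(** The remainder of a convergent series of bounds; every uniform estimate of
    the development is expressed through such a remainder. *)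
Definition tail M n : R := limn (series M) - series M n.

Lemma tail_cvg M : cvgn (series M) -> tail M @ \oo --> (0 : R).
Proof.
move=> cM; rewrite /tail -(subrr (limn (series M))).
by apply: cvgB => //; exact: cvg_cst.
Qed.

Lemma tail_near M : cvgn (series M) ->
  forall e : R, 0 < e -> \forall n \near \oo, tail M n < e.
Proof.
move=> cM e e0; have /cvgrPdist_lt/(_ _ e0) := tail_cvg cM.
by apply: filterS => n; rewrite sub0r normrN => /(le_lt_trans (ler_norm _)).
Qed.

Section Dominated.
Variables u M : nat -> R.
Hypothesis uM : forall n, `|u n| <= M n.
Hypothesis cM : cvgn (series M).

Let M_ge0 n : 0 <= M n. Proof. exact: le_trans (uM n). Qed.

Lemma mtest_cvg : cvgn (series u).
Proof.
apply: normed_cvg; apply: series_le_cvg cM => // n; exact: normr_ge0.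
Qed.

Lemma mtest_partial n m : (n <= m)%N -> series M m - series M n <= tail M n.
Proof.
move=> nm; rewrite /tail lerB//; apply: nondecreasing_cvgn_le => //.
apply: nondecreasing_series => k _ _; exact: M_ge0.
Qed.

Lemma mtest_diff n m : (n <= m)%N ->
  `|series u m - series u n| <= series M m - series M n.
Proof.
move=> nm; rewrite !sub_series_geq// (le_trans (ler_norm_sum _ _ _))//.
by apply: ler_sum => k _.
Qed.

Lemma mtest_tail n : `|limn (series u) - series u n| <= tail M n.
Proof.
have h : `|series u m - series u n| @[m --> \oo] --> `|limn (series u) - series u n|.
  by apply: cvg_norm; apply: cvgB; [exact: mtest_cvg | exact: cvg_cst].
rewrite -(cvg_lim _ h)//; apply: limr_le; first by apply/cvg_ex; exists (`|limn (series u) - series u n|).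
exists n => //= m nm; exact: le_trans (mtest_diff nm) (mtest_partial nm).
Qed.

End Dominated.
End MTest.

(** * Means and Fourier coefficients on the circle *)

Section CircleMean.
Variable R : realType.
Implicit Types (f g : R -> R) (k m l : int) (x a b c : R).
Local Notation mu := (@lebesgue_measure R).
Local Notation I := (`[- pi, pi]%classic : set R).

Definition mean f : R := (2 * pi)^-1 * Rintegral mu I f.

Lemma pi2_gt0 : 0 < 2 * pi :> R. Proof. by rewrite mulr_gt0// pi_gt0. Qed.

Lemma circle_integrable f : continuous f -> mu.-integrable I (EFin \o f).
Proof.
move=> cf; apply: continuous_compact_integrable; first exact: segment_compact.
exact: continuous_subspaceT.
Qed.

Lemma meanD f g : continuous f -> continuous g ->
  mean (fun x => f x + g x) = mean f + mean g.
Proof.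
move=> cf cg; rewrite /mean RintegralD ?mulrDr//; exact: circle_integrable.
Qed.

Lemma meanZ a f : continuous f -> mean (fun x => a * f x) = a * mean f.
Proof.
move=> cf; rewrite /mean RintegralZl ?(mulrCA a)//; exact: circle_integrable.
Qed.

Lemma mean_cst c : mean (fun=> c) = c.
Proof.
have pp : - pi < pi :> R by rewrite gtrN// pi_gt0.
rewrite /mean Rintegral_cst//= lebesgue_measure_itv/= lte_fin pp/=.
rewrite (_ : pi - - pi = 2 * pi) ?opprK; last by rewrite mulr_natl mulr2n.
rewrite mulrCA mulVf ?mulr1//.
by rewrite gt_eqF// pi2_gt0.
Qed.

Lemma mean_le f g : continuous f -> continuous g -> (forall x, I x -> f x <= g x) ->
  mean f <= mean g.
Proof.
move=> cf cg fg; rewrite /mean ler_wpM2l//; first by rewrite invr_ge0 ltW// pi2_gt0.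
apply: le_Rintegral => //; exact: circle_integrable.
Qed.

Lemma mean_norm_le f b : continuous f -> (forall x, `|f x| <= b) -> `|mean f| <= b.
Proof.
move=> cf fb; have cc c : continuous (fun _ : R => c) by move=> x; exact: cvg_cst.
rewrite ler_norml -[X in - X](mean_cst b) -[X in _ && (_ <= X)](mean_cst b).
have -> : - mean (fun=> b) = mean (fun=> - b) by rewrite !mean_cst.
by apply/andP; split; apply: mean_le => // x _; have := fb x; rewrite ler_norml => /andP[].
Qed.

Lemma mean_comb a b c (d e : R) F G H K : continuous F -> continuous G -> continuous H -> continuous K ->
  mean (fun x => e * (a * F x + b * G x + (c * H x + d * K x))) =
  e * (a * mean F + b * mean G + (c * mean H + d * mean K)).
Proof.
have cZ t f : continuous f -> continuous (fun x => t * f x).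
  by move=> cf x; apply: cvgM; [exact: cvg_cst|exact: cf].
have cD f g : continuous f -> continuous g -> continuous (fun x => f x + g x).
  by move=> cf cg x; apply: cvgD; [exact: cf|exact: cg].
move=> cF cG cH cK.
have cF' := cZ a _ cF; have cG' := cZ b _ cG; have cH' := cZ c _ cH; have cK' := cZ d _ cK.
have c1 := cD _ _ cF' cG'; have c2 := cD _ _ cH' cK'.
by rewrite meanZ ?meanD ?meanZ//; exact: cD.
Qed.

(** Orthogonality of the exponentials, and the recursion for the means of
    powers below, are both instances of this vanishing integral. *)
Lemma mean_derivative (F f : R -> R) : continuous f ->
  (forall x : R, is_derive x (1 : R) F (f x)) -> F pi = F (- pi) -> mean f = 0.
Proof.
move=> cf dF FE; rewrite /mean /Rintegral.
have pp : - pi < pi :> R by rewrite gtrN// pi_gt0.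
have cF : continuous F.
  move=> x; apply: differentiable_continuous; apply/derivable1_diffP.
  by have := dF x; case.
rewrite (@continuous_FTC2 _ _ F)// ?FE -?EFinB ?subrr ?mulr0//.
- exact: continuous_subspaceT.
- split.
  + by move=> x _; have := dF x; case.
  + by apply: cvg_at_right_filter; exact: cF.
  + by apply: cvg_at_left_filter; exact: cF.
- by move=> x _; rewrite derive1E; have := dF x; case.
Qed.

Lemma continuous_cosM a : continuous (fun x => cos (a * x)).
Proof.
by move=> x; apply: continuous_comp; [exact: mulrl_continuous | exact: continuous_cos].
Qed.
Lemma continuous_sinM a : continuous (fun x => sin (a * x)).
Proof.
by move=> x; apply: continuous_comp; [exact: mulrl_continuous | exact: continuous_sin].
Qed.
Lemma continuousM2 f g : continuous f -> continuous g -> continuous (fun x => f x * g x).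
Proof. by move=> cf cg x; apply: cvgM; [exact: cf|exact: cg]. Qed.
Lemma continuousD2 f g : continuous f -> continuous g -> continuous (fun x => f x + g x).
Proof. by move=> cf cg x; apply: cvgD; [exact: cf|exact: cg]. Qed.
Lemma continuousZ2 a f : continuous f -> continuous (fun x => a * f x).
Proof. by move=> cf; apply: continuousM2 => // x; exact: cvg_cst. Qed.
Lemma continuousN2 f : continuous f -> continuous (fun x => - f x).
Proof. by move=> cf x; apply: cvgN; exact: cf. Qed.
Lemma continuousB2 f g : continuous f -> continuous g -> continuous (fun x => f x - g x).
Proof. by move=> cf cg; apply: continuousD2 => //; exact: continuousN2. Qed.

Lemma mean_cos k : mean (fun x => cos (k%:~R * x)) = (k == 0)%:R.
Proof.
have [->|k0] := eqVneq k 0.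
  rewrite -(mean_cst 1); congr mean; apply/funext => x; by rewrite mul0r cos0.
have kR : k%:~R != 0 :> R by rewrite intr_eq0.
apply: (@mean_derivative (fun x => k%:~R^-1 * sin (k%:~R * x))).
- exact: continuous_cosM.
- move=> x.
  have h : is_derive x (1 : R) (fun x => k%:~R^-1 * sin (k%:~R * x))
    (k%:~R^-1 *: (cos (k%:~R * x) * (k%:~R *: 1))).
    exact: (@is_deriveZ _ _ _ (fun x => sin (k%:~R * x))).
  by apply: is_derive_eq h _; rewrite /GRing.scale/= mulr1 mulrCA mulVf// mulr1.
- have -> : k%:~R * pi = k%:~R * - pi + k%:~R * (2 * pi) :> R by ring.
  have := cisD (k%:~R * - pi : R) (k%:~R * (2 * pi) : R).
  by rewrite cis_int2pi mulr1 => /(congr1 (@complex.Im R)) /= ->.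
Qed.

Lemma mean_sin k : mean (fun x => sin (k%:~R * x)) = 0.
Proof.
have [->|k0] := eqVneq k 0.
  rewrite -(mean_cst 0); congr mean; apply/funext => x; by rewrite mul0r sin0.
have kR : k%:~R != 0 :> R by rewrite intr_eq0.
apply: (@mean_derivative (fun x => (- k%:~R^-1) * cos (k%:~R * x))).
- exact: continuous_sinM.
- move=> x.
  have h : is_derive x (1 : R) (fun x => (- k%:~R^-1) * cos (k%:~R * x))
    ((- k%:~R^-1) *: ((- sin (k%:~R * x)) * (k%:~R *: 1))).
    exact: (@is_deriveZ _ _ _ (fun x => cos (k%:~R * x))).
  by apply: is_derive_eq h _; rewrite /GRing.scale/= mulr1 mulNr -mulrN mulNr opprK mulrCA mulVf// mulr1.
- by rewrite mulrN cosN.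
Qed.
End CircleMean.
Arguments continuousM2 {R f g}%_function_scope _ _ _.
Arguments continuousD2 {R f g}%_function_scope _ _ _.
Arguments continuousB2 {R f g}%_function_scope _ _ _.
Arguments continuousN2 {R f}%_function_scope _ _.
Arguments continuousZ2 {R} a%_ring_scope {f}%_function_scope _ _.

Section FourierCoefUnfold.
Variable R : realType.
Implicit Types (f g : R -> R) (k m l : int) (x a b : R) (c : R[i]).

Lemma fourier_coefE f k :
  fourier_coef f k = (mean (fun x => f x * cos (k%:~R * x))
                      +i* mean (fun x => f x * (- sin (k%:~R * x))))%C.
Proof.
rewrite /fourier_coef /complex_integral /mean.
by apply: complex_ext; rewrite ?ReM ?ImM /= ?(mul0r, subr0, addr0, add0r);
  congr (_ * _); apply: eq_Rintegral => x _; rewrite ?cosN ?sinN ?ReM ?ImM/= ?cosN ?sinN ?(mul0r, subr0, addr0, add0r).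
Qed.

End FourierCoefUnfold.

(** Sealed, so that comparing two coefficients never unfolds the integrals. *)
HB.lock Definition fcoef (R : realType) (f : R -> R) (k : int) : R[i] := fourier_coef f k.

Section FourierCoef.
Variable R : realType.
Implicit Types (f g : R -> R) (k m l : int) (x a b : R) (c : R[i]).

Lemma fcoefE f k :
  fcoef f k = (mean (fun x => f x * cos (k%:~R * x))
               +i* mean (fun x => f x * (- sin (k%:~R * x))))%C.
Proof. by rewrite fcoef.unlock fourier_coefE. Qed.

Lemma eq_fcoef f g k : f =1 g -> fcoef f k = fcoef g k.
Proof. by move/funext ->. Qed.

Lemma fcoefD f g k : continuous f -> continuous g ->
  fcoef (fun x => f x + g x) k = fcoef f k + fcoef g k.
Proof.
move=> cf cg; rewrite !fcoefE.
have cc := @continuous_cosM R k%:~R.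
have cs := continuousN2 (@continuous_sinM R k%:~R).
by apply: complex_ext; rewrite ?ReD ?ImD/= -meanD; try (congr mean; apply/funext => x; exact: mulrDl);
  exact: continuousM2.
Qed.

Lemma fcoefZ a f k : continuous f ->
  fcoef (fun x => a * f x) k = a%:C%C * fcoef f k.
Proof.
move=> cf; rewrite !fcoefE.
have cc := @continuous_cosM R k%:~R.
have cs := continuousN2 (@continuous_sinM R k%:~R).
by apply: complex_ext; rewrite ?ReM ?ImM/= ?(mul0r, subr0, addr0, add0r) -meanZ; try (congr mean; apply/funext => x; exact/esym/mulrA);
  exact: continuousM2.
Qed.

Lemma fcoefN f k : continuous f ->
  fcoef (fun x => - f x) k = - fcoef f k.
Proof.
move=> cf; have <- : fcoef (fun x => -1 * f x) k = fcoef (fun x => - f x) k.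
  by apply: eq_fcoef => x; rewrite mulN1r.
have -> := fcoefZ (-1) k cf.
by case: fcoef => a b; apply: complex_ext => /=; ring.
Qed.

Lemma fcoefB f g k : continuous f -> continuous g ->
  fcoef (fun x => f x - g x) k = fcoef f k - fcoef g k.
Proof. by move=> cf cg; rewrite fcoefD ?fcoefN//; exact: continuousN2. Qed.

Lemma fcoef0 k : fcoef (fun=> 0 : R) k = 0.
Proof.
have c0 : continuous (fun _ : R => 0 : R) by move=> x; exact: cvg_cst.
have <- : fcoef (fun x => 0 * (fun _ : R => 0 : R) x) k = fcoef (fun _ : R => 0 : R) k.
  by apply: eq_fcoef => x; rewrite mul0r.
have -> := fcoefZ 0 k c0.
by apply: complex_ext; rewrite ?ReM ?ImM /=; ring.
Qed.

Lemma fcoef_oppz f k : continuous f -> fcoef f (- k) = (fcoef f k)^*%C.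
Proof.
move=> cf; rewrite !fcoefE; apply: complex_ext => /=.
  by congr mean; apply/funext => x; rewrite rmorphN/= mulNr cosN.
rewrite -mulN1r -meanZ; last exact: (continuousM2 cf (continuousN2 (@continuous_sinM _ _))).
by congr mean; apply/funext => x; rewrite rmorphN/= mulNr sinN !mulrN mulN1r opprK.
Qed.

Lemma fcoef_le f k b : continuous f -> (forall x, `|f x| <= b) ->
  normc (fcoef f k) <= 2 * b.
Proof.
move=> cf fb; rewrite fcoefE (le_trans (normc_le_ReIm _))//= mulr_natl mulr2n.
have cc := @continuous_cosM R k%:~R.
have cs := continuousN2 (@continuous_sinM R k%:~R).
have h y z : `|y| <= b -> `|z| <= 1 -> `|y * z| <= b.
  by move=> yb z1; rewrite normrM -[leRHS]mulr1 ler_pM.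
rewrite lerD//; apply: mean_norm_le => [|x]; try exact: continuousM2.
  by apply: h => //; rewrite ler_norml cos_geN1 cos_le1.
by apply: h => //; rewrite normrN ler_norml sin_geN1 sin_le1.
Qed.

(** All statements on coefficients of products come from this shift. *)
Lemma fcoef_harmonicM c m g l : continuous g ->
  fcoef (fun x => Re (c * cis (m%:~R * x)) * g x) l =
  2^-1%:C%C * (c * fcoef g (l - m) + c^*%C * fcoef g (l + m)).
Proof.
move=> cg; rewrite !fcoefE; case: c => a b.
have cc k := @continuous_cosM R k%:~R.
have cs k := continuousN2 (@continuous_sinM R k%:~R).
have cgc k : continuous (fun x => g x * cos (k%:~R * x)) by exact: continuousM2.
have cgs k : continuous (fun x => g x * - sin (k%:~R * x)) by exact: continuousM2.
have EB x : (l - m)%:~R * x = l%:~R * x - m%:~R * x by rewrite rmorphB mulrBl.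
have ED x : (l + m)%:~R * x = l%:~R * x + m%:~R * x by rewrite rmorphD mulrDl.
apply: complex_ext; rewrite ?(ReM, ImM, ReD, ImD)/=.
  transitivity (mean (fun x => 2^-1 * (a * (g x * cos ((l - m)%:~R * x)) + (- b) * (g x * - sin ((l - m)%:~R * x)) +
     (a * (g x * cos ((l + m)%:~R * x)) + b * (g x * - sin ((l + m)%:~R * x)))))).
    congr mean; apply/funext => x.
    by rewrite EB ED cosB cosD sinB sinD; field.
  by rewrite mean_comb//; ring.
transitivity (mean (fun x => 2^-1 * (a * (g x * - sin ((l - m)%:~R * x)) + b * (g x * cos ((l - m)%:~R * x)) +
     (a * (g x * - sin ((l + m)%:~R * x)) + (- b) * (g x * cos ((l + m)%:~R * x)))))).
  congr mean; apply/funext => x.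
  by rewrite EB ED cosB cosD sinB sinD; field.
by rewrite mean_comb//; ring.
Qed.
Lemma fcoef_cst b k : fcoef (fun=> b) k = (b * (k == 0)%:R)%:C%C.
Proof.
rewrite fcoefE; apply: complex_ext => /=.
  by rewrite meanZ ?mean_cos//; exact: continuous_cosM.
have -> : (fun x : R => b * - sin (k%:~R * x)) = (fun x => (- b) * sin (k%:~R * x)).
  by apply/funext => x; ring.
by rewrite meanZ ?mean_sin ?mulr0//; exact: continuous_sinM.
Qed.

Lemma continuous_harmonic c m : continuous (fun x => Re (c * cis (m%:~R * x))).
Proof.
case: c => a b; under eq_fun do rewrite ReM/=.
by apply: continuousB2; apply: continuousZ2; [exact: continuous_cosM|exact: continuous_sinM].
Qed.

Lemma fcoef_harmonic c m l :
  fcoef (fun x => Re (c * cis (m%:~R * x))) l =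
  2^-1%:C%C * (c * (l == m)%:R + c^*%C * (l == - m)%:R).
Proof.
have <- : fcoef (fun x => Re (c * cis (m%:~R * x)) * 1) l =
          fcoef (fun x => Re (c * cis (m%:~R * x))) l.
  by apply: eq_fcoef => x; rewrite mulr1.
rewrite (@fcoef_harmonicM c m (fun=> 1)) ?fcoef_cst ?mul1r ?subr_eq0 ?addr_eq0 ?rmorph_nat//.
by move=> x; exact: cvg_cst.
Qed.
End FourierCoef.

(** * Symmetric sums over the integers *)

Section SymmetricSums.
Implicit Types (k m : int) (N n : nat).

Definition ints N : seq int :=
  [seq n%:Z | n <- iota 0 N.+1] ++ [seq - n%:Z | n <- iota 1 N].

Lemma mem_ints N k : (k \in ints N) = (`|k| <= N)%N.
Proof.
rewrite mem_cat; apply/orP/idP => [[|]/mapP[n]|].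
- by rewrite mem_iota => /andP[_ h] ->; rewrite absz_nat.
- by rewrite mem_iota => /andP[_ h] ->; rewrite abszN absz_nat -ltnS.
- case: k => n h; first by left; apply/mapP; exists n => //; rewrite mem_iota.
  by right; apply/mapP; exists n.+1; rewrite ?mem_iota// NegzE.
Qed.

Lemma uniq_ints N : uniq (ints N).
Proof.
rewrite cat_uniq !map_inj_uniq ?iota_uniq/= ?andbT; last first.
- by move=> a b; case.
- by move=> a b /oppr_inj; case.
apply/hasPn => k /mapP[n]; rewrite mem_iota => /andP[n1 _] ->.
rewrite inE negb_or; apply/andP; split; first by move: n1; case: n.
by apply/negP => /mapP[m _]; move: n1; case: n.
Qed.

Lemma fsbig_ints (T : Type) (idx : T) (op : Monoid.com_law idx) N (F : int -> T) :
  \big[op/idx]_(k \in [set k : int | (`|k| <= N%:Z)%R]) F k =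
  \big[op/idx]_(k <- ints N) F k.
Proof.
have h k : (`|k| <= N%:Z)%R = (k \in ints N) by rewrite mem_ints -lez_nat abszE.
rewrite (fsbigE (ints N)) ?uniq_ints//.
- rewrite big_seq_cond [RHS]big_seq_cond; apply: eq_bigl => k; rewrite andbT.
  by case kN : (k \in ints N) => //=; apply/mem_set; rewrite /= h.
- by move=> k /=; rewrite h.
- by move=> k /=; rewrite h => ->.
Qed.

(** Folding k and - k together turns symmetric sums into partial sums of an
    ordinary series, to which the dominated convergence test applies. *)
Definition fold_int (V : nmodType) (F : int -> V) n : V :=
  if n is 0%N then F 0 else F n%:Z + F (- n%:Z).

Lemma big_ints (V : nmodType) (F : int -> V) N :
  \sum_(k <- ints N) F k = \sum_(0 <= n < N.+1) fold_int F n.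
Proof.
rewrite big_cat/= big_cons !big_map big_nat_recl//= -addrA; congr (_ + _).
by rewrite -big_split/= /index_iota subn0 (iotaDl 1 0) big_map.
Qed.

Lemma big_ints_delta (V : nmodType) (F : int -> V) N m : (`|m| <= N)%N ->
  (forall k, k != m -> F k = 0) -> \sum_(k <- ints N) F k = F m.
Proof.
move=> mN F0; rewrite (bigD1_seq m) ?mem_ints ?uniq_ints//= big1 ?addr0//.
Qed.
End SymmetricSums.

Section AbsSummable.
Variable R : realType.
Implicit Types (A B F : int -> R) (c : int -> R[i]) (N n : nat) (x : R).

Definition abs_summable A : Prop := exists b : R, forall N, \sum_(k <- ints N) A k <= b.

Lemma fold_int_ge0 A n : (forall k, 0 <= A k) -> 0 <= fold_int A n.
Proof. by move=> A0; case: n => //= n; rewrite addr_ge0. Qed.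

Lemma fold_int_le A B n : (forall k, A k <= B k) -> fold_int A n <= fold_int B n.
Proof. by move=> AB; case: n => //= n; rewrite lerD. Qed.

Lemma fold_int_norm F n : `|fold_int F n| <= fold_int (fun k => `|F k|) n.
Proof. by case: n => //= n; exact: ler_normD. Qed.

Lemma abs_summable_cvg A : (forall k, 0 <= A k) -> abs_summable A -> cvgn (series (fold_int A)).
Proof.
move=> A0 [b Ab]; apply: nondecreasing_is_cvgn.
  by apply: nondecreasing_series => n _ _; exact: fold_int_ge0.
exists b => _ [n _ <-]; apply: le_trans (Ab n); rewrite big_ints /series/= big_nat_recr//= lerDl.
exact: fold_int_ge0.
Qed.

Lemma int_seq_bounded (r : seq int) : exists N, forall k, k \in r -> (`|k| <= N)%N.
Proof.
elim: r => [|a r [N h]]; first by exists 0%N.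
exists (maxn `|a| N) => k; rewrite inE => /orP[/eqP ->|/h kN]; first exact: leq_maxl.
exact: leq_trans kN (leq_maxr _ _).
Qed.

Lemma sum_uniq_le A (r s : seq int) : (forall k, 0 <= A k) -> uniq r -> uniq s ->
  {subset r <= s} -> \sum_(k <- r) A k <= \sum_(k <- s) A k.
Proof.
move=> A0 ur us rs; rewrite [leRHS](bigID (mem r))/=.
have -> : \sum_(k <- r) A k = \sum_(i <- s | i \in r) A i.
  rewrite -[RHS]big_filter; apply: perm_big; apply: uniq_perm => //; first exact: filter_uniq.
  by move=> k; rewrite mem_filter; case kr : (k \in r) => //=; rewrite rs.
by rewrite lerDl sumr_ge0.
Qed.

(** The unordered sum that defines the norm is bounded by b as soon as all its
    symmetric partial sums are: any finite set lies in some [-N, N]. *)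
Lemma esum_int_le A b : (forall k, 0 <= A k) -> (forall N, \sum_(k <- ints N) A k <= b) ->
  (\esum_(k in [set: int]) (A k)%:E <= b%:E)%E.
Proof.
move=> A0 Ab; apply: ge_ereal_sup => _ [X [finX _] <-].
rewrite fsbig_finite//=; rewrite sumEFin lee_fin.
have [N hN] := int_seq_bounded (finmap.enum_fset (fset_set X)).
apply: le_trans (Ab N); apply: sum_uniq_le => //.
- exact: finmap.fset_uniq.
- exact: uniq_ints.
by move=> k /hN; rewrite mem_ints.
Qed.

Lemma esum_int_ge A b N : (forall k, 0 <= A k) ->
  (\esum_(k in [set: int]) (A k)%:E <= b%:E)%E -> \sum_(k <- ints N) A k <= b.
Proof.
move=> A0 Ab; rewrite -lee_fin; apply: le_trans Ab; apply: esum_ge.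
exists [set k : int | (`|k| <= N%:Z)%R]; last by rewrite fsbig_ints sumEFin.
split=> //; apply/finite_seqP; exists (ints N).
by apply/seteqP; split => k /=; rewrite mem_ints -lez_nat abszE.
Qed.

End AbsSummable.

(** * Synthesis from summable coefficients *)

Section UniformLimits.
Variable R : realType.
Implicit Types (f : R -> R) (F : nat -> R -> R) (t : nat -> R).

Lemma unif_lim_continuous F f t : (forall n, continuous (F n)) ->
  (forall n x, `|f x - F n x| <= t n) -> t @ \oo --> (0 : R) -> continuous f.
Proof.
move=> cF Ff t0 x; apply/cvgrPdist_lt => e e0.
have e3 : 0 < e / 3 by rewrite divr_gt0.
have /cvgrPdist_lt/(_ _ e3)[n _ /(_ n (leqnn n))/=] := t0.
rewrite sub0r normrN => /(le_lt_trans (ler_norm _)) tn.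
have /cvgrPdist_lt/(_ _ e3) := cF n x; apply: filterS => y hy.
have h1 := Ff n x; have h2 := Ff n y; rewrite distrC in h2.
have -> : f x - f y = (f x - F n x) + (F n x - F n y) + (F n y - f y) by ring.
apply: le_lt_trans (ler_normD _ _) _; apply: le_lt_trans (lerD (ler_normD _ _) (lexx _)) _.
by lra.
Qed.

Lemma fcoef_unif_lim F f t k : (forall n, continuous (F n)) -> continuous f ->
  (forall n x, `|f x - F n x| <= t n) ->
  forall n, normc (fcoef f k - fcoef (F n) k) <= 2 * t n.
Proof. by move=> cF cf Ff n; rewrite -fcoefB//; apply: fcoef_le => //; exact: continuousB2. Qed.

Lemma le_cvg0 (a : R) t : (\forall n \near \oo, a <= t n) -> t @ \oo --> (0 : R) -> a <= 0.
Proof.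
move=> at_ t0; rewrite -(cvg_lim _ t0)//; apply: limr_ge => //; first by apply/cvg_ex; exists 0.
Qed.
End UniformLimits.

Lemma cvg_S (R : realType) (u : nat -> R) (l : R) :
  u @ \oo --> l -> u n.+1 @[n --> \oo] --> l.
Proof. by rewrite -cvg_shiftS. Qed.

Section Synthesis.
Variable R : realType.
Implicit Types (c d : int -> R[i]) (N n : nat) (x : R) (k : int).

Definition hermitian c := forall k, c (- k) = (c k)^*%C.

Definition synth c : R -> R := fun x =>
  limn (fun N : nat => Re (\sum_(k \in [set k : int | `|k| <= N%:Z]) c k * cis (k%:~R * x))).

Definition psum c N : R -> R := fun x => \sum_(k <- ints N) Re (c k * cis (k%:~R * x)).

Lemma psumE c N x :
  Re (\sum_(k \in [set k : int | `|k| <= N%:Z]) c k * cis (k%:~R * x)) = psum c N x.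
Proof. by rewrite fsbig_ints Re_sum. Qed.

Lemma continuous_psum c N : continuous (psum c N).
Proof.
rewrite /psum; elim: (ints N) => [|k r ih].
  by under eq_fun do rewrite big_nil; move=> x; exact: cvg_cst.
under eq_fun do rewrite big_cons; apply: continuousD2 => //; exact: continuous_harmonic.
Qed.

Lemma normc_Recis c k x : `|Re (c k * cis (k%:~R * x))| <= normc (c k).
Proof. by rewrite (le_trans (normc_Re _))// normcM normc_cis mulr1. Qed.

Section Summable.
Variable c : int -> R[i].
Hypothesis sc : abs_summable (fun k => normc (c k)).

Let M := fold_int (fun k => normc (c k)).
Let cM : cvgn (series M).
Proof. by apply: abs_summable_cvg => // k; exact: normc_ge0. Qed.

Definition stail N := tail M N.+1.

Lemma stail_cvg0 : stail @ \oo --> (0 : R).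
Proof. by rewrite /stail; apply: cvg_S; exact: tail_cvg. Qed.

Let dom x n : `|fold_int (fun k => Re (c k * cis (k%:~R * x))) n| <= M n.
Proof.
apply: le_trans (fold_int_norm _ _) _; apply: fold_int_le => k; exact: normc_Recis.
Qed.

Lemma psum_cvg x : psum c N x @[N --> \oo] --> synth c x.
Proof.
have -> : synth c x = limn (psum c ^~ x) by congr (limn _); apply/funext => N; rewrite psumE.
have h : series (fold_int (fun k => Re (c k * cis (k%:~R * x)))) n.+1 @[n --> \oo] -->
  limn (series (fold_int (fun k => Re (c k * cis (k%:~R * x))))).
  by apply: cvg_S; exact: mtest_cvg (dom x) cM.
have E : psum c ^~ x = (fun n => series (fold_int (fun k => Re (c k * cis (k%:~R * x)))) n.+1).
  by apply/funext => n; rewrite /psum big_ints.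
by rewrite E (cvg_lim _ h).
Qed.

Lemma synth_tail N x : `|synth c x - psum c N x| <= stail N.
Proof.
have h : series (fold_int (fun k => Re (c k * cis (k%:~R * x)))) n.+1 @[n --> \oo] -->
  limn (series (fold_int (fun k => Re (c k * cis (k%:~R * x))))).
  by apply: cvg_S; exact: mtest_cvg (dom x) cM.
have E : psum c ^~ x = (fun n => series (fold_int (fun k => Re (c k * cis (k%:~R * x)))) n.+1).
  by apply/funext => n; rewrite /psum big_ints.
have -> : synth c x = limn (series (fold_int (fun k => Re (c k * cis (k%:~R * x))))).
  rewrite -(cvg_lim _ h)// -E; congr (limn _); apply/funext => n; exact: psumE.
have -> : psum c N x = series (fold_int (fun k => Re (c k * cis (k%:~R * x)))) N.+1.
  by have /(congr1 (fun g => g N)) := E.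
exact: mtest_tail (dom x) cM N.+1.
Qed.

Lemma continuous_synth : continuous (synth c).
Proof.
exact: (unif_lim_continuous (@continuous_psum c) synth_tail stail_cvg0).
Qed.

Lemma synth_periodic x : synth c (x + 2 * pi) = synth c x.
Proof.
congr (limn _); apply/funext => N; rewrite !psumE; apply: eq_bigr => k _.
by rewrite mulrDr cisD cis_int2pi mulr1.
Qed.

Hypothesis hc : hermitian c.

Lemma fcoef_psum N k : (`|k| <= N)%N -> fcoef (psum c N) k = c k.
Proof.
move=> kN.
have : forall r : seq int, fcoef (fun x => \sum_(m <- r) Re (c m * cis (m%:~R * x))) k =
   \sum_(m <- r) 2^-1%:C%C * (c m * (k == m)%:R + (c m)^*%C * (k == - m)%:R).
  elim=> [|m r ih].
    by rewrite big_nil -[RHS](fcoef0 R k); apply: eq_fcoef => x; rewrite big_nil.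
  rewrite big_cons -ih -fcoef_harmonic -fcoefD; last 2 first.
  - exact: continuous_harmonic.
  - elim: r {ih} => [|j r ih]; first by under eq_fun do rewrite big_nil; move=> x; exact: cvg_cst.
    by under eq_fun do rewrite big_cons; apply: continuousD2 => //; exact: continuous_harmonic.
  by apply: eq_fcoef => x; rewrite big_cons.
move=> ->; rewrite -big_distrr/= big_split/=.
rewrite (big_ints_delta (m := k))//; last first.
  by move=> j jk; rewrite eq_sym (negbTE jk) mulr0.
rewrite (big_ints_delta (m := - k)) ?abszN//; last first.
  by move=> j jk; rewrite eq_sym eqr_oppLR (negbTE jk) mulr0.
rewrite opprK eqxx !mulr1 hc conjcK.
by case: (c k) => a b; apply: complex_ext => /=; field.
Qed.

(** The partial sums converge uniformly and their coefficients are eventually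
    equal to c. *)
Lemma fcoef_synth k : fcoef (synth c) k = c k.
Proof.
apply/eqP; rewrite -subr_eq0; apply/eqP; apply: normc_eq0; apply: le_anti.
rewrite normc_ge0 andbT; apply: (@le_cvg0 _ _ (fun n => 2 * stail n)); last first.
  by rewrite -(mulr0 2); apply: cvgM; [exact: cvg_cst | exact: stail_cvg0].
exists `|k|%N => //= n kn; rewrite -(fcoef_psum kn).
exact: (fcoef_unif_lim k (@continuous_psum c) continuous_synth synth_tail).
Qed.

End Summable.
End Synthesis.

(** * Uniqueness of Fourier coefficients *)

Section FourierUniqueness.
Variable R : realType.
Implicit Types (f : R -> R) (x y : R) (k : int).

Lemma meanE f : mean f = Re (fcoef f 0).
Proof.
by rewrite fcoefE /=; congr mean; apply/funext => x; rewrite mul0r cos0 mulr1.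
Qed.

Let q x0 x : R := 2^-1 * (1 + cos (x - x0)).

Let continuous_q x0 : continuous (q x0).
Proof.
apply: continuousZ2; apply: continuousD2; first by move=> x; exact: cvg_cst.
move=> x; apply: continuous_comp; last exact: continuous_cos.
by apply: cvgB; [exact: cvg_id|exact: cvg_cst].
Qed.

Let continuous_qn x0 n : continuous (fun x => q x0 x ^+ n).
Proof.
elim: n => [|n ih]; first by under eq_fun do rewrite expr0; move=> x; exact: cvg_cst.
by under eq_fun do rewrite exprS; apply: continuousM2.
Qed.

(* q is a trigonometric polynomial of degree one, so all integrals against its
   powers are combinations of Fourier coefficients. *)
Let coef_qn f x0 n : continuous f -> (forall k, fcoef f k = 0) ->
  forall k, fcoef (fun x => f x * q x0 x ^+ n) k = 0.
Proof.
move=> cf f0; elim: n => [|n ih] k.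
  by rewrite -(f0 k); apply: eq_fcoef => x; rewrite expr0 mulr1.
set g := (fun x => f x * q x0 x ^+ n) in ih.
have cg : continuous g by exact: continuousM2.
pose h x := Re (2^-1%:C%C * cis (0%:~R * x)) * g x + Re ((2^-1%:C%C * cis (- x0)) * cis (1%:~R * x)) * g x.
have -> : fcoef (fun x => f x * q x0 x ^+ n.+1) k = fcoef h k.
  apply: eq_fcoef => x; rewrite /h /g /q mul0r cis0 -mulrA -cisD mul1r mulr1 exprS !ReM/=.
  by rewrite !mul0r !subr0 [- x0 + x]addrC; ring.
rewrite fcoefD ?fcoef_harmonicM ?ih ?mulr0 ?addr0 ?mulr0 ?addr0//.
- by apply: continuousM2 => //; exact: continuous_harmonic.
- by apply: continuousM2 => //; exact: continuous_harmonic.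
Qed.

Let m x0 n : R := mean (fun x => q x0 x ^+ n).

(* Integrating the derivative of sin (x - x0) q ^ n over the circle. *)
Let m_rec x0 n : (2 * n.+1%:R) * m x0 n.+1 = (2 * n%:R + 1) * m x0 n.
Proof.
have dq x : is_derive x (1 : R) (q x0) (- 2^-1 * sin (x - x0)).
  have h : is_derive x (1 : R) (fun x => 2^-1 * (1 + cos (x - x0)))
     (2^-1 *: (0 + (- sin (x - x0)) * (1 - 0))).
    exact: (@is_deriveZ _ _ _ (fun x => 1 + cos (x - x0))).
  by apply: is_derive_eq h _; rewrite /GRing.scale/=; ring.
have dqn x : is_derive x (1 : R) (fun x => q x0 x ^+ n) (n%:R * q x0 x ^+ n.-1 * (- 2^-1 * sin (x - x0))).
  have -> : (fun x => q x0 x ^+ n) = q x0 ^+ n by rewrite exprfctE.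
  by have h := @is_deriveX _ _ (q x0) n x 1 _ (dq x); apply: is_derive_eq h _.
have ds x : is_derive x (1 : R) (fun x => sin (x - x0)) (cos (x - x0)).
  have h : is_derive x (1 : R) (fun x => sin (x - x0)) (cos (x - x0) * (1 - 0)).
    exact: (@is_derive1_comp _ sin (fun x => x - x0)).
  by apply: is_derive_eq h _; rewrite subr0 mulr1.
have dG x : is_derive x (1 : R) (fun x => sin (x - x0) * q x0 x ^+ n)
   ((2 * n.+1%:R) * q x0 x ^+ n.+1 + - (2 * n%:R + 1) * q x0 x ^+ n).
  have h := @is_deriveM _ _ _ _ x 1 _ _ (ds x) (dqn x).
  apply: is_derive_eq h _; rewrite /GRing.scale/=.
  have sE : sin (x - x0) ^+ 2 = 4 * q x0 x * (1 - q x0 x).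
    by rewrite sin2cos2 /q; field.
  have cE : cos (x - x0) = 2 * q x0 x - 1 by rewrite /q; field.
  transitivity (- 2^-1 * n%:R * q x0 x ^+ n.-1 * sin (x - x0) ^+ 2 + q x0 x ^+ n * cos (x - x0)).
    by ring.
  rewrite sE cE; case: n {dqn} => [|n] /=; first by rewrite expr0 expr1; ring.
  by rewrite -!natr1 !exprS; field.
apply/eqP; rewrite -subr_eq0 -mulNr; apply/eqP.
rewrite /m -meanZ; last exact: continuous_qn.
rewrite -[X in _ + X]meanZ; last exact: continuous_qn.
rewrite -meanD; last 2 first.
- by apply: continuousZ2; exact: continuous_qn.
- by apply: continuousZ2; exact: continuous_qn.
apply: (mean_derivative _ dG).
- by apply: continuousD2; apply: continuousZ2; exact: continuous_qn.
- have s2 y : sin (y + pi *+ 2) = sin y :> R by rewrite sinD cos2pi sin2pi mulr0 addr0 mulr1.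
  have c2 y : cos (y + pi *+ 2) = cos y :> R by rewrite cosD cos2pi sin2pi mulr0 subr0 mulr1.
  have E : pi - x0 = (- pi - x0) + pi *+ 2 by rewrite mulr2n; ring.
  by rewrite /q E s2 c2.
Qed.

Let m_gt0 x0 n : 0 < m x0 n.
Proof.
elim: n => [|n ih].
  have -> : m x0 0 = 1 by rewrite -[RHS](@mean_cst R); congr mean; apply/funext => x; rewrite expr0.
  exact: ltr01.
have : 0 < (2 * n.+1%:R) * m x0 n.+1 by rewrite m_rec mulr_gt0// ltr_wpDl// mulr_ge0.
by rewrite pmulr_rgt0// mulr_gt0.
Qed.

Let cos_far y (d : R) : 0 < d -> d <= pi -> d <= `|y| -> `|y| <= 2 * pi - d -> cos y <= cos d.
Proof.
move=> d0 dpi dy ypi; have -> : cos y = cos `|y| by case: (ger0P y) => // _; rewrite cosN.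
have h z : d <= z -> z <= pi -> cos z <= cos d.
  move=> dz zpi; rewrite leNgt; apply/negP; rewrite ltr_cos ?ltNge ?dz//.
  - by rewrite in_itv/= zpi (le_trans (ltW d0)).
  - by rewrite in_itv/= dpi ltW.
have [ypi'|piy] := leP `|y| pi; first exact: h.
have -> : cos `|y| = cos (2 * pi - `|y|) by rewrite cosB mulr_natl cos2pi sin2pi mul1r mul0r addr0.
by apply: h; lra.
Qed.

(* Outside a neighbourhood of x0 the function is bounded below by
   e - C (1 - q).  Its integral against q ^ n is then at least
   (e - C) m_n + C m_(n+1), positive for large n by the recursion. *)
Let coef_zero_le f x0 : continuous f -> (forall k, fcoef f k = 0) ->
  - pi < x0 < pi -> f x0 <= 0.
Proof.
move=> cf f0 /andP[x1 x2]; rewrite leNgt; apply/negP => fx0.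
have p0 : 0 < pi :> R := pi_gt0 R.
have e0 : 0 < f x0 / 2 by rewrite divr_gt0.
have /cvgrPdist_lt/(_ _ e0)/nbhs_ballP[d' /= d'0 hd] := cf x0.
set e := f x0 / 2 in e0 hd.
pose d := Num.min d' (pi - `|x0|).
have x0p : `|x0| < pi by rewrite ltr_norml x1.
have d0 : 0 < d by rewrite lt_min d'0 subr_gt0.
have dpi : d <= pi by rewrite ge_min gerBl normr_ge0 orbT.
have dx : d <= pi - `|x0| by rewrite ge_min lexx orbT.
have pp : - pi <= pi :> R by rewrite (le_trans _ (ltW p0))// oppr_le0 ltW.
have [c _ hc] := EVT_min pp (continuous_subspaceT cf).
pose k := (1 - cos d) / 2.
have k0 : 0 < k.
  rewrite divr_gt0// subr_gt0 -(cos0 R) ltr_cos ?in_itv/= ?lexx ?dpi ?(ltW d0) ?(ltW p0)//=.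
pose C := (e + `|f c|) / k.
have C0 : 0 <= C by rewrite divr_ge0 ?ltW// ltr_wpDr.
have q01 x : 0 <= q x0 x <= 1.
  by rewrite /q; have := cos_geN1 (x - x0); have := cos_le1 (x - x0); lra.
have fq x : `[- pi, pi]%classic x -> e - C * (1 - q x0 x) <= f x.
  move=> xI; have [xd|dx'] := ltP `|x - x0| d.
    have : `|f x0 - f x| < e.
      by apply: hd; rewrite -ball_normE/= distrC (lt_le_trans xd)// ge_min lexx.
    rewrite ltr_norml => /andP[_ h].
    have : 0 <= C * (1 - q x0 x) by rewrite mulr_ge0// subr_ge0; have /andP[] := q01 x.
    by rewrite /e in h e0 *; lra.
  have xx : `|x - x0| <= 2 * pi - d.
    apply: le_trans (ler_normB _ _) _.
    by have /= := xI; rewrite in_itv/= -ler_norml; lra.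
  have cc := cos_far d0 dpi dx' xx.
  have kq : k <= 1 - q x0 x by rewrite /k /q; lra.
  have Ck : C * k = e + `|f c| by rewrite /C divfK// gt_eqF.
  have : C * k <= C * (1 - q x0 x) by rewrite ler_wpM2l.
  have := hc x xI; have := ler_norm (- f c); rewrite normrN; lra.
(* The mean of f q ^ n is zero; dividing the lower bound by m_n leaves this. *)
have main n : e * (2 * n.+1%:R) <= C.
  have : mean (fun x => (e - C) * q x0 x ^+ n + C * q x0 x ^+ n.+1) <=
         mean (fun x => f x * q x0 x ^+ n).
    apply: mean_le => //.
    - by apply: continuousD2; apply: continuousZ2; exact: continuous_qn.
    - by apply: continuousM2 => //; exact: continuous_qn.
    - move=> x /fq fx; rewrite exprS mulrA -mulrDl ler_wpM2r//.
        by apply: exprn_ge0; have /andP[] := q01 x.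
      by lra.
  rewrite [leRHS]meanE coef_qn//= meanD; last 2 first.
  - by apply: continuousZ2; exact: continuous_qn.
  - by apply: continuousZ2; exact: continuous_qn.
  rewrite !meanZ; try exact: continuous_qn.
  rewrite -/(m x0 n) -/(m x0 n.+1) => h.
  have n0 : 0 < n.+1%:R :> R by [].
  have : (e * (2 * n.+1%:R) - C) * m x0 n <= 0.
    have -> : (e * (2 * n.+1%:R) - C) * m x0 n = (2 * n.+1%:R) * ((e - C) * m x0 n + C * m x0 n.+1).
      transitivity (2 * n.+1%:R * (e - C) * m x0 n + C * (2 * n.+1%:R * m x0 n.+1)); last by ring.
      by rewrite m_rec -natr1; ring.
    by rewrite mulr_ge0_le0// mulr_ge0.
  by rewrite pmulr_lle0// subr_le0.
have := main (Num.truncn (C / e)).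
have := truncnS_gt (C / e); rewrite ltr_pdivrMr// mulrC.
move=> h1 h2; have : 0 < e * (Num.truncn (C / e)).+1%:R by rewrite mulr_gt0.
by move=> h3; lra.
Qed.

Lemma periodicz f x k : (forall x, f (x + 2 * pi) = f x) -> f (x + k%:~R * (2 * pi)) = f x.
Proof.
move=> pf; have h (n : nat) z : f (z + n%:R * (2 * pi)) = f z.
  elim: n z => [|n ih] z; first by rewrite mul0r addr0.
  by rewrite -natr1 mulrDl mul1r addrA pf ih.
case: k => n; first exact: h.
by rewrite NegzE rmorphN/= mulNr -(h n.+1 (x - _)) subrK.
Qed.

Lemma circle_repr x : exists k : int, - pi <= x - k%:~R * (2 * pi) < pi.
Proof.
have p0 := @pi2_gt0 R; exists (Num.floor ((x + pi) / (2 * pi))).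
have := Num.Theory.real_floor_itv (num_real ((x + pi) / (2 * pi))).
set k := Num.floor _; rewrite intrD ler_pdivlMr// ltr_pdivrMr// mulrDl.
by move=> /andP[a b]; apply/andP; split; lra.
Qed.

(** The functions (1 + cos (x - x0)) / 2 have powers whose mass concentrates at
    x0 while their integrals decay only polynomially; a positive value at x0
    could not integrate to zero against them. *)
Lemma fcoef_injective0 f : continuous f -> (forall x, f (x + 2 * pi) = f x) ->
  (forall k, fcoef f k = 0) -> forall x, f x = 0.
Proof.
move=> cf pf f0.
have op x : - pi < x < pi -> f x = 0.
  move=> xI; apply: le_anti; rewrite (coef_zero_le cf f0 xI)/= -oppr_le0.
  apply: (@coef_zero_le (fun x => - f x)) => //; first exact: continuousN2.
  by move=> k; rewrite fcoefN// f0 oppr0.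
have pp : - pi < pi :> R by rewrite gtrN// pi_gt0.
have fmpi : f (- pi) = 0.
  have h1 : f x @[x --> (- pi)^'+] --> f (- pi) by apply: cvg_at_right_filter; exact: cf.
  have h2 : f x @[x --> (- pi)^'+] --> (0 : R).
    apply: (@cvg_trans _ ((fun _ : R => 0 : R) x @[x --> (- pi : R)^'+])); last exact: cvg_cst.
    apply: near_eq_cvg; near=> x; rewrite op//; apply/andP; split; first by near: x; exact: nbhs_right_gt.
    by near: x; exact: nbhs_right_lt.
  exact: (cvg_unique _ h1 h2).
move=> x; have [k /andP[h1 h2]] := circle_repr x.
have -> : f x = f (x - k%:~R * (2 * pi)).
  by rewrite -[in RHS]mulNr -(rmorphN _ k) periodicz.
have [<-//|h3] := eqVneq (- pi) (x - k%:~R * (2 * pi)).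
by apply: op; rewrite lt_neqAle h3 h1.
Unshelve. all: by end_near.
Qed.

End FourierUniqueness.

(** * The Wiener algebras *)

(** A real upper bound for the extended-real norm; every estimate below is
    carried in this form, which avoids arithmetic on infinite values. *)
HB.lock Definition normX_le (R : realType) (t : R) (f : R -> R) (b : R) : Prop :=
  (normX t f <= b%:E)%E.

HB.lock Definition wiener (R : realType) (t : R) (f : R -> R) : Prop := inX t f.

Section WienerNorm.
Variable R : realType.
Implicit Types (f g : R -> R) (x t b : R) (k m l : int) (N n : nat) (r : seq int).

Definition wcoef t f k : R := expR (t * `|k|%:~R) * normc (fcoef f k).

Lemma normXE t f : normX t f = (\esum_(k in [set: int]) (wcoef t f k)%:E)%E.
Proof. by rewrite /normX /wcoef fcoef.unlock. Qed.

Lemma normX_leE t f b : normX_le t f b <-> (normX t f <= b%:E)%E.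
Proof. by rewrite normX_le.unlock. Qed.

Lemma wiener_inX t f : wiener t f <-> inX t f.
Proof. by rewrite wiener.unlock. Qed.

Lemma wiener_cont t f : wiener t f -> continuous f. Proof. by case/wiener_inX. Qed.
Lemma wiener_per t f : wiener t f -> forall x, f (x + 2 * pi) = f x.
Proof. by case/wiener_inX. Qed.
Lemma wiener_fin t f : wiener t f -> (normX t f < +oo)%E. Proof. by case/wiener_inX. Qed.

Lemma wcoef_ge0 t f k : 0 <= wcoef t f k.
Proof. by apply: mulr_ge0; [exact: expR_ge0|exact: normc_ge0]. Qed.

Lemma normX_leP t f b :
  normX_le t f b <-> forall N, \sum_(k <- ints N) wcoef t f k <= b.
Proof.
rewrite normX_leE normXE; split=> [h N|h]; first by apply: esum_int_ge => // k; exact: wcoef_ge0.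
by apply: esum_int_le => // k; exact: wcoef_ge0.
Qed.

Lemma normX_sum_le t f b r : uniq r -> normX_le t f b -> \sum_(k <- r) wcoef t f k <= b.
Proof.
move=> ur /normX_leP h; have [N hN] := int_seq_bounded r.
apply: le_trans (h N); apply: sum_uniq_le => //; first by move=> k; exact: wcoef_ge0.
- exact: uniq_ints.
- by move=> k /hN; rewrite mem_ints.
Qed.

Lemma normX_wcoef_le t f b k : normX_le t f b -> wcoef t f k <= b.
Proof. by move=> /(@normX_sum_le _ _ _ [:: k] isT); rewrite big_seq1. Qed.

Lemma normX_ge0 t f : (0 <= normX t f)%E.
Proof. by rewrite normXE; apply: esum_ge0 => k _; rewrite lee_fin; exact: wcoef_ge0. Qed.

Lemma normX_bound_ge0 t f b : normX_le t f b -> 0 <= b.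
Proof. by rewrite normX_leE -lee_fin; apply: le_trans; exact: normX_ge0. Qed.

Lemma normX_fineK t f : (normX t f < +oo)%E -> normX t f = (fine (normX t f))%:E.
Proof. by move=> h; rewrite fineK// ge0_fin_numE// normX_ge0. Qed.

Lemma normX_finP t f : (normX t f < +oo)%E <-> exists b, normX_le t f b.
Proof.
split=> [/normX_fineK h|[b h]]; first by exists (fine (normX t f)); apply/normX_leE; rewrite {1}h.
by move/normX_leE : h => h; exact: le_lt_trans h (ltry _).
Qed.

Lemma normX_mono s t f : s <= t -> (normX s f <= normX t f)%E.
Proof.
move=> st; rewrite !normXE; apply: le_esum => k _; rewrite lee_fin ler_wpM2r ?normc_ge0// ler_expR ler_wpM2r//.
Qed.

Lemma wiener_mono s t f : s <= t -> wiener t f -> wiener s f.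
Proof. by move=> st /wiener_inX[pf cf h]; apply/wiener_inX; split => //; exact: le_lt_trans (normX_mono _ st) h. Qed.

Lemma normXD t f g (a b : R) : continuous f -> continuous g ->
  normX_le t f a -> normX_le t g b ->
  normX_le t (fun x => f x + g x) (a + b).
Proof.
move=> cf cg /normX_leP ha /normX_leP hb; apply/normX_leP => N.
apply: le_trans (lerD (ha N) (hb N)); rewrite -big_split/=; apply: ler_sum => k _.
rewrite /wcoef fcoefD// -[leRHS]mulrDr; apply: ler_wpM2l; [exact: expR_ge0|exact: normcD].
Qed.

Lemma normXZ t f (a b : R) : continuous f -> normX_le t f b ->
  normX_le t (fun x => a * f x) (`|a| * b).
Proof.
move=> cf /normX_leP hb; apply/normX_leP => N.
apply: le_trans (ler_wpM2l (normr_ge0 a) (hb N)); rewrite big_distrr/=; apply: ler_sum => k _.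
by rewrite /wcoef fcoefZ// normcM normcR mulrCA.
Qed.

Lemma normXN t f b : continuous f -> normX_le t f b -> normX_le t (fun x => - f x) b.
Proof.
move=> cf /normX_leP hb; apply/normX_leP => N.
apply: le_trans (hb N); apply: ler_sum => k _.
by rewrite /wcoef fcoefN// normcN.
Qed.

Lemma normXB t f g (a b : R) : continuous f -> continuous g ->
  normX_le t f a -> normX_le t g b ->
  normX_le t (fun x => f x - g x) (a + b).
Proof.
move=> cf cg ha hb.
exact: (@normXD t f (fun x => - g x) a b cf (continuousN2 cg) ha (normXN cg hb)).
Qed.

Lemma wiener_normX t f : wiener t f -> normX_le t f (fine (normX t f)).
Proof. by move=> /wiener_fin/normX_fineK h; apply/normX_leE; rewrite {1}h. Qed.

Lemma wienerI t f b : (forall x, f (x + 2 * pi) = f x) -> continuous f -> normX_le t f b ->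
  wiener t f.
Proof. by move=> pf cf h; apply/wiener_inX; split => //; apply/normX_finP; exists b. Qed.

Lemma wienerD t f g : wiener t f -> wiener t g -> wiener t (fun x => f x + g x).
Proof.
move=> hf hg; have bf := wiener_normX hf; have bg := wiener_normX hg.
case/wiener_inX: hf => pf cf _; case/wiener_inX: hg => pg cg _.
by apply: (wienerI _ _ (normXD cf cg bf bg)); [move=> x; rewrite pf pg|exact: continuousD2].
Qed.

Lemma wienerZ t a f : wiener t f -> wiener t (fun x => a * f x).
Proof.
move=> hf; have bf := wiener_normX hf; case/wiener_inX: hf => pf cf _.
by apply: (wienerI _ _ (normXZ a cf bf)); [move=> x; rewrite pf|exact: continuousZ2].
Qed.

Lemma wienerB t f g : wiener t f -> wiener t g -> wiener t (fun x => f x - g x).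
Proof.
move=> hf hg; have bf := wiener_normX hf; have bg := wiener_normX hg.
case/wiener_inX: hf => pf cf _; case/wiener_inX: hg => pg cg _.
by apply: (wienerI _ _ (normXB cf cg bf bg)); [move=> x; rewrite pf pg|exact: continuousB2].
Qed.

Lemma normX_cst t a : normX_le t (fun=> a) `|a|.
Proof.
apply/normX_leP => N; rewrite (big_ints_delta (m := 0))//.
  by rewrite /wcoef fcoef_cst eqxx mulr1 normcR normr0 mulr0 expR0 mul1r.
by move=> k /negbTE k0; rewrite /wcoef fcoef_cst k0 mulr0 normcR normr0 mulr0.
Qed.

Lemma wiener_cst t a : wiener t (fun=> a).
Proof. by apply: (wienerI _ _ (normX_cst t a)) => // x; exact: cvg_cst. Qed.

Lemma wiener_summable t f : 0 <= t -> wiener t f -> abs_summable (fun k => normc (fcoef f k)).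
Proof.
move=> t0 /(wiener_mono t0) /wiener_normX /normX_leP h; exists (fine (normX 0 f)) => N.
apply: le_trans (h N); apply: ler_sum => k _; by rewrite /wcoef mul0r expR0 mul1r.
Qed.

Lemma hermitian_fcoef f : continuous f -> hermitian (fcoef f).
Proof. by move=> cf k; rewrite fcoef_oppz. Qed.

Lemma fcoef_ext f g : continuous f -> continuous g ->
  (forall x, f (x + 2 * pi) = f x) -> (forall x, g (x + 2 * pi) = g x) ->
  fcoef f =1 fcoef g -> f = g.
Proof.
move=> cf cg pf pg fg; apply/funext => x; apply/eqP; rewrite -subr_eq0; apply/eqP.
apply: (@fcoef_injective0 _ (fun x => f x - g x)); first exact: continuousB2.
- by move=> y; rewrite pf pg.
- by move=> k; rewrite fcoefB// fg subrr.
Qed.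

Lemma fourier_inversion t f : 0 <= t -> wiener t f -> f = synth (fcoef f).
Proof.
move=> t0 hf; have sf := wiener_summable t0 hf; case/wiener_inX: (hf) => pf cf _.
apply: fcoef_ext => //; first exact: (continuous_synth sf).
- by move=> x; exact: synth_periodic.
- by move=> k; rewrite fcoef_synth//; exact: hermitian_fcoef.
Qed.

(** Fourier inversion bounds the supremum by the sum of the coefficients. *)
Lemma sup_le_normX f b : wiener 0 f -> normX_le 0 f b -> forall x, `|f x| <= b.
Proof.
move=> hf hb x; have sf := wiener_summable (lexx 0) hf.
rewrite (fourier_inversion (lexx 0) hf).
have h : `|psum (fcoef f) N x| @[N --> \oo] --> `|synth (fcoef f) x|.
  by apply: cvg_norm; exact: psum_cvg.
rewrite -(cvg_lim _ h)//; apply: limr_le; first by apply/cvg_ex; eexists; exact: h.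
near=> N; rewrite (le_trans (ler_norm_sum _ _ _))//.
move/normX_leP : hb => /(_ N); apply: le_trans; apply: ler_sum => k _.
by rewrite /wcoef mul0r expR0 mul1r normc_Recis.
Unshelve. all: by end_near.
Qed.

(** Fatou's lemma for the Wiener norm: each coefficient passes to the uniform
    limit, and only finitely many enter a partial sum. *)
Lemma normX_unif_lim (F : nat -> R -> R) f (u : nat -> R) t b :
  (forall n, continuous (F n)) -> continuous f ->
  (forall n x, `|f x - F n x| <= u n) -> u @ \oo --> (0 : R) ->
  (\forall n \near \oo, normX_le t (F n) b) -> normX_le t f b.
Proof.
move=> cF cf Fu u0 Fb; apply/normX_leP => N.
pose K := \sum_(k <- ints N) expR (t * `|k|%:~R) : R.
rewrite -subr_le0; apply: (@le_cvg0 _ _ (fun n => K * (2 * u n))); last first.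
  rewrite -(mulr0 K); apply: cvgM; first exact: cvg_cst.
  by rewrite -(mulr0 2); apply: cvgM; [exact: cvg_cst|].
apply: filterS Fb => n /normX_leP/(_ N) h; rewrite lerBlDr.
apply: le_trans (lerD (lexx _) h); rewrite /K big_distrl -big_split/=; apply: ler_sum => k _.
rewrite /wcoef -mulrDr ler_wpM2l ?expR_ge0//.
rewrite -[X in normc X](subrK (fcoef (F n) k)) (le_trans (normcD _ _))// lerD2r.
exact: fcoef_unif_lim.
Qed.
End WienerNorm.

Section WienerProduct.
Variable R : realType.
Implicit Types (f g : R -> R) (x t b : R) (k m l : int) (N n : nat) (r : seq int).

Lemma fcoef_psumM c N g l : continuous g ->
  fcoef (fun x => psum c N x * g x) l =
  \sum_(m <- ints N) 2^-1%:C%C * (c m * fcoef g (l - m) + (c m)^*%C * fcoef g (l + m)).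
Proof.
move=> cg; rewrite /psum; elim: (ints N) => [|m r ih].
  rewrite big_nil -[RHS](fcoef0 R l); apply: eq_fcoef => x; by rewrite big_nil mul0r.
rewrite big_cons -ih -fcoef_harmonicM// -fcoefD.
- by apply: eq_fcoef => x; rewrite big_cons mulrDl.
- by apply: continuousM2 => //; exact: continuous_harmonic.
- apply: continuousM2 => //; elim: r {ih} => [|j r ih].
    by under eq_fun do rewrite big_nil; move=> x; exact: cvg_cst.
  by under eq_fun do rewrite big_cons; apply: continuousD2 => //; exact: continuous_harmonic.
Qed.

Lemma normc_fcoef_psumM c N g l : continuous g ->
  normc (fcoef (fun x => psum c N x * g x) l) <=
  \sum_(m <- ints N) 2^-1 * (normc (c m) * normc (fcoef g (l - m)) +
                             normc (c m) * normc (fcoef g (l + m))).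
Proof.
move=> cg; rewrite fcoef_psumM// (le_trans (normc_sum _ _ _))//.
apply: ler_sum => m _; rewrite normcM normcR ger0_norm ?invr_ge0// ler_wpM2l ?invr_ge0//.
by rewrite (le_trans (normcD _ _))// !normcM normc_conj.
Qed.

Let psumM_lim f g : wiener 0 f -> (exists b, forall x, `|g x| <= b) ->
  exists2 u : nat -> R, u @ \oo --> (0 : R) &
    forall n x, `|f x * g x - psum (fcoef f) n x * g x| <= u n.
Proof.
move=> hf [b gb]; have sf := wiener_summable (lexx 0) hf.
exists (fun n => stail (fcoef f) n * b).
  by rewrite -(mul0r b); apply: cvgM; [exact: (stail_cvg0 sf)|exact: cvg_cst].
move=> n x; rewrite -mulrBl normrM ler_pM//.
by rewrite [X in X x - _](fourier_inversion (lexx 0) hf) (synth_tail sf).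
Qed.

Lemma expR_weight t l m : 0 <= t ->
  expR (t * `|l|%:~R) <= expR (t * `|m|%:~R) * expR (t * `|l - m|%:~R) :> R.
Proof.
move=> t0; rewrite -expRD ler_expR -mulrDr ler_wpM2l// -intrD ler_int.
by rewrite -{1}(subrK m l) addrC ler_normD.
Qed.

Lemma expR_weightN t l m : 0 <= t ->
  expR (t * `|l|%:~R) <= expR (t * `|m|%:~R) * expR (t * `|l + m|%:~R) :> R.
Proof. by move=> t0; have := expR_weight l (- m) t0; rewrite opprK normrN. Qed.

(** Multiplication convolves Fourier coefficients and the weights satisfy
    exp (t |l|) <= exp (t |m|) exp (t |l - m|).  One factor is first replaced by
    its partial Fourier sums, which makes the convolution finite. *)
Lemma normXM t f g (a b : R) : 0 <= t -> wiener t f -> wiener t g ->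
  normX_le t f a -> normX_le t g b ->
  normX_le t (fun x => f x * g x) (a * b).
Proof.
move=> t0 hf hg ha hb; have hf0 := wiener_mono t0 hf; have hg0 := wiener_mono t0 hg.
have a0 := normX_bound_ge0 ha; have b0 := normX_bound_ge0 hb.
have /wiener_inX[pf cf _] := hf0; have /wiener_inX[pg cg _] := hg0.
have [u u0 hu] := psumM_lim hf0 (ex_intro _ _ (sup_le_normX hg0 (wiener_normX hg0))).
apply: (normX_unif_lim _ _ hu u0).
- by move=> n; apply: continuousM2 => //; exact: continuous_psum.
- exact: continuousM2.
near=> N; apply/normX_leP => L.
have shift (s : int) : \sum_(l <- ints L) expR (t * `|l + s|%:~R) * normc (fcoef g (l + s)) <= b.
  rewrite -(big_map (fun l => l + s) xpredT (wcoef t g)); apply: normX_sum_le hb.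
  by rewrite map_inj_uniq ?uniq_ints//; exact: addIr.
have main : \sum_(l <- ints L) \sum_(m <- ints N)
    2^-1 * (wcoef t f m * wcoef t g (l - m) + wcoef t f m * wcoef t g (l + m)) <= a * b.
  rewrite exchange_big/=; apply: (@le_trans _ _ (\sum_(m <- ints N) wcoef t f m * b)).
    apply: ler_sum => m _; rewrite -mulr_sumr big_split/= -!mulr_sumr.
    have h1 := ler_wpM2l (wcoef_ge0 t f m) (shift (- m)).
    have h2 := ler_wpM2l (wcoef_ge0 t f m) (shift m).
    by rewrite /wcoef in h1 h2 *; lra.
  by rewrite -mulr_suml ler_wpM2r//; exact: normX_sum_le (uniq_ints _) ha.
apply: le_trans main; apply: ler_sum => l _.
apply: le_trans (ler_wpM2l (expR_ge0 _) (normc_fcoef_psumM _ _ _ cg)) _.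
rewrite mulr_sumr; apply: ler_sum => m _; rewrite mulrCA ler_wpM2l ?invr_ge0// mulrDr.
rewrite /wcoef; apply: lerD.
  by rewrite mulrACA ler_wpM2r ?mulr_ge0 ?normc_ge0// expR_weight.
by rewrite mulrACA ler_wpM2r ?mulr_ge0 ?normc_ge0// expR_weightN.
Unshelve. all: by end_near.
Qed.

Lemma wienerM t f g : 0 <= t -> wiener t f -> wiener t g -> wiener t (fun x => f x * g x).
Proof.
move=> t0 hf hg; have h := normXM t0 hf hg (wiener_normX hf) (wiener_normX hg).
case/wiener_inX: hf => pf cf _; case/wiener_inX: hg => pg cg _.
by apply: (wienerI _ _ h); [move=> x; rewrite pf pg|exact: continuousM2].
Qed.

(** Uniqueness is proved with bounds on single coefficients instead of sums,
    because these can be integrated in time one frequency at a time.  Only the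
    first factor has to be summable against the weight. *)
Lemma fcoefM_decay t f g (a e : R) l : 0 <= t -> wiener t f -> wiener 0 g ->
  normX_le t f a ->
  (forall k, normc (fcoef g k) <= e * expR (- (t * `|k|%:~R))) ->
  normc (fcoef (fun x => f x * g x) l) <= a * e * expR (- (t * `|l|%:~R)).
Proof.
move=> t0 hf hg0 ha he; have hf0 := wiener_mono t0 hf.
have a0 := normX_bound_ge0 ha.
have e0 : 0 <= e.
  by have := le_trans (normc_ge0 _) (he 0); rewrite normr0 mulr0 oppr0 expR0 mulr1.
have /wiener_inX[pf cf _] := hf0; have /wiener_inX[pg cg _] := hg0.
have [u u0 hu] := psumM_lim hf0 (ex_intro _ _ (sup_le_normX hg0 (wiener_normX hg0))).
rewrite -subr_le0; apply: (@le_cvg0 _ _ (fun n => 2 * u n)); last first.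
  by rewrite -(mulr0 2); apply: cvgM; [exact: cvg_cst|].
near=> N; rewrite lerBlDr.
have cpg n : continuous (fun x => psum (fcoef f) n x * g x).
  by apply: continuousM2 => //; exact: continuous_psum.
rewrite -[X in normc X](subrK (fcoef (fun x => psum (fcoef f) N x * g x) l)).
rewrite (le_trans (normcD _ _))// lerD//.
  by apply: (fcoef_unif_lim l cpg _ hu); exact: continuousM2.
apply: le_trans (normc_fcoef_psumM _ _ _ cg) _.
have dec k m : expR (t * `|l|%:~R) <= expR (t * `|m|%:~R) * expR (t * `|k|%:~R) ->
    normc (fcoef f m) * normc (fcoef g k) <=
    wcoef t f m * (e * expR (- (t * `|l|%:~R))).
  move=> w; apply: le_trans (ler_wpM2l (normc_ge0 _) (he k)) _.
  rewrite /wcoef [expR _ * normc _]mulrC -!mulrA ler_wpM2l ?normc_ge0//.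
  rewrite mulrCA ler_wpM2l//; move: w; rewrite -!expRD !ler_expR => w.
  by lra.
apply: (@le_trans _ _ (\sum_(m <- ints N) wcoef t f m * (e * expR (- (t * `|l|%:~R))))).
  apply: ler_sum => m _.
  have h1 := dec _ _ (expR_weight l m t0); have h2 := dec _ _ (expR_weightN l m t0).
  by lra.
rewrite -mulr_suml -[leRHS]mulrA ler_wpM2r ?mulr_ge0 ?expR_ge0//.
exact: normX_sum_le (uniq_ints _) ha.
Unshelve. all: by end_near.
Qed.

Definition banded (d : R) f := forall k, d < `|k|%:~R -> fcoef f k = 0.

(** A frequency beyond d + e needs a frequency beyond d or beyond e. *)
Lemma bandedM (d e : R) f g : wiener 0 f -> wiener 0 g -> banded d f -> banded e g ->
  banded (d + e) (fun x => f x * g x).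
Proof.
move=> hf0 hg0 df eg l dl; have /wiener_inX[pf cf _] := hf0; have /wiener_inX[pg cg _] := hg0.
have [u u0 hu] := psumM_lim hf0 (ex_intro _ _ (sup_le_normX hg0 (wiener_normX hg0))).
apply: normc_eq0; apply: le_anti; rewrite normc_ge0 andbT.
apply: (@le_cvg0 _ _ (fun n => 2 * u n)); last first.
  by rewrite -(mulr0 2); apply: cvgM; [exact: cvg_cst|].
near=> N.
have cpg n : continuous (fun x => psum (fcoef f) n x * g x).
  by apply: continuousM2 => //; exact: continuous_psum.
rewrite -[X in normc X]subr0.
have z m (s : int) : (l = s + m) \/ (l = s - m) -> fcoef f m = 0 \/ fcoef g s = 0.
  move=> h; have [dm|md] := ltP d (`|m|%:~R : R); first by left; exact: df.
  right; apply: eg; rewrite -(ltrD2l d); apply: lt_le_trans dl _.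
  apply: le_trans (lerD md (lexx _)); rewrite -intrD ler_int addrC.
  by case: h => ->; [exact: ler_normD|exact: ler_normB].
have <- : fcoef (fun x => psum (fcoef f) N x * g x) l = 0.
  apply: normc_eq0; apply: le_anti; rewrite normc_ge0 andbT.
  apply: le_trans (normc_fcoef_psumM _ _ _ cg) _; rewrite big1// => m _.
  have [->|->] := z m (l - m) (or_introl (esym (subrK m l))).
    by rewrite normc0 !mul0r addr0 mulr0.
  have [->|->] := z m (l + m) (or_intror (esym (addrK m l))).
    by rewrite normc0 !mul0r addr0 mulr0.
  by rewrite normc0 !mulr0 addr0 mulr0.
by apply: (fcoef_unif_lim l cpg _ hu); exact: continuousM2.
Unshelve. all: by end_near.
Qed.

End WienerProduct.

(** * Derivatives along an interval *)

Section DerivOn.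
Variable R : realType.
Implicit Types (f g p : R -> R) (I : set R) (s t a b e : R).

(** Differentiability along a set, in the first-order expansion form that does
    not divide by increments. *)
Definition deriv_on I f (f' : R -> R) : Prop :=
  forall t, I t -> forall e : R, 0 < e -> exists2 d : R, 0 < d &
    forall s, I s -> `|s - t| < d -> `|f s - f t - f' t * (s - t)| <= e * `|s - t|.

Lemma deriv_onP I f f' :
  (forall t, I t -> (f s - f t) / (s - t) @[s --> within I t^'] --> f' t) <-> deriv_on I f f'.
Proof.
split=> h t It.
  move=> e e0; have /cvgrPdist_le/(_ _ e0) := h t It.
  rewrite !near_withinE => /nbhs_ballP[d /= d0 hd].
  exists d => // s Is sd; have [->|st] := eqVneq s t.
    by rewrite !subrr mulr0 subrr normr0 mulr0.
  have st0 : s - t != 0 by rewrite subr_eq0.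
  have /= := hd s; rewrite -ball_normE /= distrC => /(_ sd st Is).
  have -> : f s - f t - f' t * (s - t) = - (f' t - (f s - f t) / (s - t)) * (s - t).
    by rewrite mulNr mulrBl divfK//; ring.
  by rewrite normrM normrN => h1; rewrite ler_wpM2r.
apply/cvgrPdist_le => e e0; have [d d0 hd] := h t It e e0.
rewrite !near_withinE; apply/nbhs_ballP; exists d => //= s.
rewrite -ball_normE /= distrC => sd st Is.
have st0 : s - t != 0 by rewrite subr_eq0.
have := hd s Is sd.
have -> : f s - f t - f' t * (s - t) = - (f' t - (f s - f t) / (s - t)) * (s - t).
  by rewrite mulNr mulrBl divfK//; ring.
by rewrite normrM normrN ler_pM2r// normr_gt0.
Qed.

Lemma deriv_on_is_derive f f' (t d : R) I : 0 < d -> (forall s, `|s - t| < d -> I s) ->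
  deriv_on I f f' -> is_derive t (1 : R) f (f' t).
Proof.
move=> d0 hI df.
have It : I t by apply: hI; rewrite subrr normr0.
have key : h^-1 *: ((f \o shift t) (h *: 1) - f t) @[h --> 0^'] --> f' t.
  apply/cvgrPdist_le => e e0; have [d' d'0 hd] := df t It e e0.
  rewrite near_withinE near_simpl; apply/nbhs_ballP; exists (Num.min d d') => /=; first by rewrite lt_min d0.
  move=> h; rewrite -ball_normE /= sub0r normrN lt_min => /andP[hd1 hd2] h0.
  rewrite /GRing.scale/= mulr1.
  have E : h + t - t = h by rewrite addrK.
  have := hd (h + t); rewrite E => /(_ (hI _ _) hd2); rewrite E => /(_ hd1).
  have -> : f (h + t) - f t - f' t * h = - (f' t - h^-1 * (f (h + t) - f t)) * h by field.
  by rewrite normrM normrN ler_pM2r// normr_gt0.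
by split; [apply/cvg_ex; exists (f' t)|exact: cvg_lim key].
Qed.

Lemma is_derive_deriv_on f (f' : R -> R) I :
  (forall t, I t -> is_derive t (1 : R) f (f' t)) -> deriv_on I f f'.
Proof.
move=> df t It e e0; have [dft vft] := df t It.
have key : h^-1 *: ((f \o shift t) (h *: 1) - f t) @[h --> 0^'] --> f' t by rewrite -vft.
have /cvgrPdist_le/(_ _ e0) := key.
rewrite near_withinE near_simpl => /nbhs_ballP[d /= d0 hd].
exists d => // s Is sd; have [->|st] := eqVneq s t.
  by rewrite !subrr mulr0 subrr normr0 mulr0.
have st0 : s - t != 0 by rewrite subr_eq0.
have /= := hd (s - t); rewrite -ball_normE /= sub0r normrN => /(_ sd st0).
rewrite /GRing.scale/= mulr1 subrK => h1.
have -> : f s - f t - f' t * (s - t) = - (f' t - (s - t)^-1 * (f s - f t)) * (s - t) by field.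
by rewrite normrM normrN ler_wpM2r.
Qed.

Lemma deriv_on_subset I J f f' : I `<=` J -> deriv_on J f f' -> deriv_on I f f'.
Proof.
move=> IJ df t It e e0; have [d d0 hd] := df t (IJ _ It) e e0.
by exists d => // s Is; apply: hd; exact: IJ.
Qed.

Lemma deriv_onD I f f' g g' : deriv_on I f f' -> deriv_on I g g' ->
  deriv_on I (fun t => f t + g t) (fun t => f' t + g' t).
Proof.
move=> df dg t It e e0; have e2 : 0 < e / 2 by rewrite divr_gt0.
have [d1 d10 hd1] := df t It _ e2; have [d2 d20 hd2] := dg t It _ e2.
exists (Num.min d1 d2); first by rewrite lt_min d10.
move=> s Is; rewrite lt_min => /andP[s1 s2].
have -> : f s + g s - (f t + g t) - (f' t + g' t) * (s - t) =
  (f s - f t - f' t * (s - t)) + (g s - g t - g' t * (s - t)) by ring.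
apply: le_trans (ler_normD _ _) _; have := hd1 s Is s1; have := hd2 s Is s2; lra.
Qed.

Lemma deriv_onZ I f f' a : deriv_on I f f' -> deriv_on I (fun t => a * f t) (fun t => a * f' t).
Proof.
move=> df t It e e0; have e2 : 0 < e / (`|a| + 1) by rewrite divr_gt0// ltr_wpDl.
have [d1 d10 hd1] := df t It _ e2; exists d1 => // s Is s1.
have -> : a * f s - a * f t - a * f' t * (s - t) = a * (f s - f t - f' t * (s - t)) by ring.
rewrite normrM; apply: le_trans (ler_wpM2l (normr_ge0 a) (hd1 s Is s1)) _.
rewrite mulrA ler_wpM2r// mulrCA ger_pMr// ler_pdivrMr ?ltr_wpDl// mul1r lerDl//.
Qed.

Lemma deriv_onN I f f' : deriv_on I f f' -> deriv_on I (fun t => - f t) (fun t => - f' t).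
Proof.
move=> /(deriv_onZ (-1)); congr deriv_on; apply/funext => t; exact: mulN1r.
Qed.

Lemma deriv_onB I f f' g g' : deriv_on I f f' -> deriv_on I g g' ->
  deriv_on I (fun t => f t - g t) (fun t => f' t - g' t).
Proof. by move=> df dg; exact: deriv_onD df (deriv_onN dg). Qed.

Lemma deriv_on_cst I a : deriv_on I (fun=> a) (fun=> 0).
Proof.
move=> t It e e0; exists 1 => // s _ _; by rewrite subrr mul0r subrr normr0 mulr_ge0// ltW.
Qed.

Lemma deriv_on_id I : deriv_on I id (fun=> 1).
Proof.
move=> t It e e0; exists 1 => // s _ _; by rewrite mul1r subrr normr0 mulr_ge0// ltW.
Qed.

Lemma deriv_on_sum I n (F G : nat -> R -> R) : (forall i, (i < n)%N -> deriv_on I (F i) (G i)) ->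
  deriv_on I (fun t => \sum_(i < n) F i t) (fun t => \sum_(i < n) G i t).
Proof.
elim: n => [|n ih] h.
  have -> : (fun t => \sum_(i < 0) F i t) = (fun=> 0) by apply/funext => t; rewrite big_ord0.
  have -> : (fun t => \sum_(i < 0) G i t) = (fun=> 0) by apply/funext => t; rewrite big_ord0.
  exact: deriv_on_cst.
have E (H : nat -> R -> R) : (fun t => \sum_(i < n.+1) H i t) = (fun t => \sum_(i < n) H i t + H n t).
  by apply/funext => t; rewrite big_ord_recr.
by rewrite !E; apply: deriv_onD; [apply: ih => i ii; apply: h; exact: ltnW|exact: h].
Qed.

Lemma deriv_on_continuous I f f' t : deriv_on I f f' -> I t -> f s @[s --> within I (nbhs t)] --> f t.
Proof.
move=> df It; apply/cvgrPdist_le => e e0; have [d d0 hd] := df t It 1 ltr01.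
have k0 : 0 < 1 + `|f' t| by rewrite ltr_wpDr.
rewrite near_withinE near_simpl; apply/nbhs_ballP.
exists (Num.min d (e / (1 + `|f' t|))) => /=; first by rewrite lt_min d0 divr_gt0.
move=> s; rewrite -ball_normE /= lt_min ltr_pdivlMr// distrC => /andP[sd se] Is.
have := hd s Is sd; rewrite mul1r => h1; rewrite distrC.
have -> : f s - f t = (f s - f t - f' t * (s - t)) + f' t * (s - t) by ring.
apply: le_trans (ler_normD _ _) _; rewrite normrM; apply: le_trans (lerD h1 (lexx _)) _.
by apply: le_trans (ltW se); rewrite mulrDr mulr1 [X in _ + X]mulrC.
Qed.

Lemma deriv_on_ndecr a b f f' : a <= b -> deriv_on `[a, b] f f' ->
  (forall t, `[a, b]%classic t -> 0 <= f' t) -> f a <= f b.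
Proof.
rewrite le_eqVlt => /predU1P[->//|ab] df f'0.
have [||c cab E] := @MVT R f f' a b ab.
- move=> t /[!in_itv]/= /andP[at_ tb].
  apply: (@deriv_on_is_derive _ _ _ (Num.min (t - a) (b - t)) _ _ _ df).
    by rewrite lt_min !subr_gt0 at_ tb.
  move=> s; rewrite lt_min !ltr_norml /= in_itv/= => /andP[/andP[h1 h2] /andP[h3 h4]].
  by apply/andP; split; lra.
- by apply/subspace_continuousP => t It; exact: deriv_on_continuous df It.
rewrite -subr_ge0 E; apply: mulr_ge0; last by rewrite subr_ge0 ltW.
apply: f'0 => /=.
by move: cab; rewrite !in_itv/= => /andP[h1 h2]; rewrite !ltW.
Qed.

(** Mean value inequality with a majorant p in place of a constant; both p - f
    and p + f are nondecreasing. *)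
Lemma deriv_on_bound a b f f' p p' : a <= b -> deriv_on `[a, b] f f' -> deriv_on `[a, b] p p' ->
  (forall t, `[a, b]%classic t -> `|f' t| <= p' t) -> `|f b - f a| <= p b - p a.
Proof.
move=> ab df dp h; rewrite ler_norml; apply/andP; split.
  have := deriv_on_ndecr ab (deriv_onD dp df); suff P : forall t, `[a, b]%classic t -> 0 <= p' t + f' t.
    by move=> /(_ P); lra.
  by move=> t /h; rewrite ler_norml => /andP[]; lra.
have := deriv_on_ndecr ab (deriv_onB dp df); suff P : forall t, `[a, b]%classic t -> 0 <= p' t - f' t.
  by move=> /(_ P); lra.
by move=> t /h; rewrite ler_norml => /andP[]; lra.
Qed.

Lemma deriv_on_lip I f f' k s t : is_interval I -> deriv_on I f f' ->
  (forall t, I t -> `|f' t| <= k) -> I s -> I t -> `|f s - f t| <= k * `|s - t|.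
Proof.
move=> iI df h; wlog : s t / t <= s => [w Is It|ts Is It].
  have [ts|/ltW st] := leP t s; first exact: w.
  by rewrite distrC [`|s - t|]distrC; exact: w.
have sub : `[t, s] `<=` I by move=> z /=; rewrite in_itv/=; exact: (iI t s It Is).
rewrite [`|s - t|]ger0_norm ?subr_ge0// mulrBr.
apply: (deriv_on_bound ts (deriv_on_subset sub df) (deriv_onZ k (@deriv_on_id _))).
by move=> z /sub /h; rewrite mulr1.
Qed.

(** The increments of F m - F n are controlled by the mean value inequality
    applied to the difference, uniformly in the length of the increment. *)
Lemma unif_lim_deriv I (F G : nat -> R -> R) f g (u : nat -> R) : is_interval I ->
  (forall n, deriv_on I (F n) (G n)) -> (forall t, I t -> F n t @[n --> \oo] --> f t) ->
  (forall n t, I t -> `|g t - G n t| <= u n) -> u @ \oo --> (0 : R) -> deriv_on I f g.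
Proof.
move=> iI dF Ff Gg u0 t It e e0; have e3 : 0 < e / 3 by rewrite divr_gt0.
have /cvgrPdist_lt/(_ _ e3)[n _ /(_ n (leqnn n))/=] := u0.
rewrite sub0r normrN => /(le_lt_trans (ler_norm _)) un.
have [d d0 hd] := dF n t It _ e3; exists d => // s Is sd.
have h1 : `|(f s - f t) - (F n s - F n t)| <= u n * `|s - t|.
  have hm : `|(F m s - F m t) - (F n s - F n t)| @[m --> \oo] --> `|(f s - f t) - (F n s - F n t)|.
    apply: cvg_norm; apply: cvgB; last exact: cvg_cst.
    by apply: cvgB; exact: Ff.
  have hu : (u m + u n) * `|s - t| @[m --> \oo] --> (0 + u n) * `|s - t|.
    by apply: cvgM; [apply: cvgD => //; exact: cvg_cst|exact: cvg_cst].
  rewrite add0r in hu; rewrite -(cvg_lim _ hm)// -(cvg_lim _ hu)//.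
  apply: ler_lim.
  - by apply/cvg_ex; eexists; exact: hm.
  - by apply/cvg_ex; eexists; exact: hu.
  - near=> m; have -> : F m s - F m t - (F n s - F n t) = (F m s - F n s) - (F m t - F n t) by ring.
    apply: (deriv_on_lip iI (deriv_onB (dF m) (dF n))) => // z Iz.
    have -> : G m z - G n z = (g z - G n z) - (g z - G m z) by ring.
    by apply: le_trans (ler_normB _ _) _; rewrite addrC lerD// Gg.
have h2 := hd s Is sd; have h3 := Gg n t It.
have -> : f s - f t - g t * (s - t) = ((f s - f t) - (F n s - F n t)) +
   (F n s - F n t - G n t * (s - t)) + - ((g t - G n t) * (s - t)) by ring.
apply: le_trans (ler_normD _ _) _; apply: le_trans (lerD (ler_normD _ _) (lexx _)) _.
rewrite normrN normrM.
have h4 := ler_wpM2r (normr_ge0 (s - t)) h3.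
have h5 : u n * `|s - t| <= e / 3 * `|s - t| by rewrite ler_wpM2r// ltW.
by lra.
Unshelve. all: by end_near.
Qed.
End DerivOn.

(** * Fourier multipliers *)

HB.lock Definition multiplier (R : realType) (sym : int -> R[i]) (f : R -> R) : R -> R :=
  fourier_multiplier sym f.

Section Multipliers.
Variable R : realType.
Implicit Types (f g : R -> R) (x t b rho sigma : R) (k m l : int) (N n : nat) (sym : int -> R[i]).

Lemma multiplierE sym f : multiplier sym f = synth (fun k => sym k * fcoef f k).
Proof. by rewrite multiplier.unlock fcoef.unlock. Qed.

(** Reality of the operator and at most linear growth: all the operators of the
    model satisfy this, and each of them costs an arbitrarily small loss of
    width. *)
Definition symbol sym : Prop :=
  hermitian sym /\ forall k, normc (sym k) <= 1 + `|k|%:~R.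

Definition lambda_sym k : R[i] := `|k|%:~R.
Definition hilbert_sym k : R[i] := - 'i%C * (sgz k)%:~R.
Definition dx_sym k : R[i] := 'i%C * k%:~R.
Definition sqrt_sym k : R[i] := (Num.sqrt (`|k|%:~R : R))%:C%C.
Definition dx f : R -> R := multiplier dx_sym f.

Lemma intC k : (k%:~R : R[i]) = (k%:~R : R)%:C%C.
Proof. by rewrite rmorph_int. Qed.

Lemma symbol_lambda : symbol lambda_sym.
Proof.
split=> k; first by rewrite /lambda_sym normrN intC conjc_real.
by rewrite normc_int -intr_norm normr_id lerDr.
Qed.

Lemma symbol_hilbert : symbol hilbert_sym.
Proof.
split=> k; first by rewrite /hilbert_sym sgzN !intC rmorphN/=; apply: complex_ext => /=; ring.
rewrite normcM normcN normc_i mul1r normc_int -intr_norm ler_wpDr ?ler0z//.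
by rewrite lerz1; case: sgzP.
Qed.

Lemma symbol_dx : symbol dx_sym.
Proof.
split=> k; first by rewrite /dx_sym !intC rmorphN/=; apply: complex_ext => /=; ring.
by rewrite normcM normc_i mul1r normc_int intr_norm lerDr.
Qed.

Lemma symbol_sqrt : symbol sqrt_sym.
Proof.
split=> k; first by rewrite /sqrt_sym normrN conjc_real.
rewrite normcR ger0_norm ?sqrtr_ge0//.
have h0 : 0 <= `|k|%:~R :> R by rewrite ler0z.
rewrite -{2}(sqr_sqrtr h0); set y := Num.sqrt _.
by have := sqr_ge0 (y - 2^-1); rewrite !expr2; lra.
Qed.

Lemma expR_absorb (d : R) k : 0 < d -> `|k|%:~R <= d^-1 * expR (d * `|k|%:~R) :> R.
Proof.
move=> d0; rewrite -(ler_pM2l d0) mulrA divff ?gt_eqF// mul1r.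
by apply: le_trans (expR_ge1Dx _); rewrite lerDr.
Qed.

Lemma absz_ge0R k : 0 <= `|k|%:~R :> R. Proof. by rewrite ler0z. Qed.

Lemma expR_absorb1 rho sigma k : rho < sigma ->
  (1 + `|k|%:~R) * expR (rho * `|k|%:~R) <= (1 + (sigma - rho)^-1) * expR (sigma * `|k|%:~R) :> R.
Proof.
move=> rs; have d0 : 0 < sigma - rho by rewrite subr_gt0.
have -> : sigma * `|k|%:~R = (sigma - rho) * `|k|%:~R + rho * `|k|%:~R :> R by ring.
rewrite expRD mulrA ler_wpM2r ?expR_ge0// mulrDl mul1r lerD//; last exact: expR_absorb.
by rewrite -(expR0 R) ler_expR mulr_ge0 ?absz_ge0R// ltW.
Qed.

(** The growth of the symbol is absorbed by the exponential: a width rho below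
    sigma leaves room for the factor exp ((sigma - rho) |k|). *)
Lemma multiplier_spec sym rho sigma f b : symbol sym -> 0 <= rho -> rho < sigma ->
  wiener sigma f -> normX_le sigma f b ->
  [/\ wiener rho (multiplier sym f),
      forall k, fcoef (multiplier sym f) k = sym k * fcoef f k &
      normX_le rho (multiplier sym f) ((1 + (sigma - rho)^-1) * b)].
Proof.
move=> [hs bs] r0 rs hf fb; have cf := wiener_cont hf.
have s0 : 0 <= sigma by exact: ltW (le_lt_trans r0 rs).
have key t N : t < sigma -> \sum_(k <- ints N) expR (t * `|k|%:~R) * normc (sym k * fcoef f k) <=
   (1 + (sigma - t)^-1) * b.
  move=> ts; move/normX_leP : fb => /(_ N) h.
  have c0 : 0 <= 1 + (sigma - t)^-1 by rewrite addr_ge0// invr_ge0 subr_ge0 ltW.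
  apply: le_trans (ler_wpM2l c0 h); rewrite mulr_sumr; apply: ler_sum => k _.
  rewrite normcM mulrA /wcoef [leRHS]mulrA ler_wpM2r ?normc_ge0//.
  apply: le_trans (expR_absorb1 k ts); rewrite mulrC ler_wpM2r ?expR_ge0//.
have sc : abs_summable (fun k => normc (sym k * fcoef f k)).
  exists ((1 + (sigma - rho)^-1) * b) => N; apply: le_trans (key rho N rs).
  apply: ler_sum => k _; rewrite ler_peMl ?normc_ge0// -(expR0 R) ler_expR mulr_ge0 ?absz_ge0R//.
have hc : hermitian (fun k => sym k * fcoef f k).
  by move=> k; rewrite hs (hermitian_fcoef cf); case: (sym k) => a a'; case: fcoef => c d; apply: complex_ext => /=; ring.
have E k : fcoef (multiplier sym f) k = sym k * fcoef f k.
  by rewrite multiplierE; exact: (fcoef_synth sc hc k).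
have nX : normX_le rho (multiplier sym f) ((1 + (sigma - rho)^-1) * b).
  apply/normX_leP => N; apply: le_trans (key rho N rs); apply: ler_sum => k _.
  by rewrite /wcoef E.
split; [|exact: E|exact: nX].
apply: wienerI nX; rewrite multiplierE; last exact: (continuous_synth sc).
by move=> x; exact: synth_periodic.
Qed.

End Multipliers.

(** * Analytic functions on the circle *)

Section Strip.
Variable R : realType.
Implicit Types (f g : R -> R) (x t b rho sigma : R) (k m l : int) (N n : nat) (sym : int -> R[i]).

(** Periodic functions with exponentially decaying Fourier coefficients, the
    real-analytic functions on the circle.  Unlike each fixed-width algebra,
    this class is stable under the multipliers. *)
Definition strip f : Prop := exists2 s : R, 0 < s & wiener s f.

Lemma strip_wiener0 f : strip f -> wiener 0 f.
Proof. by case=> s s0; apply: wiener_mono; exact: ltW. Qed.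
Lemma strip_cont f : strip f -> continuous f. Proof. by case=> s _ /wiener_cont. Qed.
Lemma strip_per f : strip f -> forall x, f (x + 2 * pi) = f x. Proof. by case=> s _ /wiener_per. Qed.

Lemma strip2 f g : strip f -> strip g -> exists s, [/\ 0 < s, wiener s f & wiener s g].
Proof.
move=> [s s0 hf] [t t0 hg]; exists (Num.min s t); split; first by rewrite lt_min s0.
  by apply: wiener_mono hf; rewrite ge_min lexx.
by apply: wiener_mono hg; rewrite ge_min lexx orbT.
Qed.

Lemma stripD f g : strip f -> strip g -> strip (fun x => f x + g x).
Proof. by move=> hf0 hg0; have [s [s0 hf hg]] := strip2 hf0 hg0; exists s => //; exact: wienerD. Qed.
Lemma stripB f g : strip f -> strip g -> strip (fun x => f x - g x).
Proof. by move=> hf0 hg0; have [s [s0 hf hg]] := strip2 hf0 hg0; exists s => //; exact: wienerB. Qed.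
Lemma stripM f g : strip f -> strip g -> strip (fun x => f x * g x).
Proof. by move=> hf0 hg0; have [s [s0 hf hg]] := strip2 hf0 hg0; exists s => //; apply: wienerM => //; exact: ltW. Qed.
Lemma stripZ a f : strip f -> strip (fun x => a * f x).
Proof. by case=> s s0 hf; exists s => //; exact: wienerZ. Qed.
Lemma strip_cst a : strip (fun=> a).
Proof. by exists 1 => //; exact: wiener_cst. Qed.
Lemma strip_sum n (F : nat -> R -> R) : (forall i, (i < n)%N -> strip (F i)) ->
  strip (fun x => \sum_(i < n) F i x).
Proof.
elim: n => [|n ih] h.
  by rewrite (_ : (fun x => _) = (fun=> 0)); [exact: strip_cst|apply/funext => x; rewrite big_ord0].
rewrite (_ : (fun x => _) = (fun x => \sum_(i < n) F i x + F n x)).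
  by apply: stripD; [apply: ih => i ii; apply: h; exact: ltnW|exact: h].
by apply/funext => x; rewrite big_ord_recr.
Qed.

Lemma strip_half f : strip f -> exists s : R, [/\ 0 < s, 0 <= s / 2, s / 2 < s & wiener s f].
Proof.
case=> s s0 hf; exists s; split => //; first by rewrite divr_ge0// ltW.
by rewrite ltr_pdivrMr// mulr_natr mulr2n ltrDl.
Qed.

Lemma strip_multiplier sym f : symbol sym -> strip f -> strip (multiplier sym f).
Proof.
move=> hs /strip_half[s [s0 h0 h1 hf]]; exists (s / 2); first by rewrite divr_gt0.
by have [] := multiplier_spec hs h0 h1 hf (wiener_normX hf).
Qed.

Lemma fcoef_multiplier sym f k : symbol sym -> strip f ->
  fcoef (multiplier sym f) k = sym k * fcoef f k.
Proof.
move=> hs /strip_half[s [s0 h0 h1 hf]].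
by have [] := multiplier_spec hs h0 h1 hf (wiener_normX hf).
Qed.

Lemma strip_ext f g : strip f -> strip g -> fcoef f =1 fcoef g -> f = g.
Proof.
move=> hf hg; apply: fcoef_ext; [exact: strip_cont|exact: strip_cont|exact: strip_per|exact: strip_per].
Qed.

Lemma multiplierD sym f g : symbol sym -> strip f -> strip g ->
  multiplier sym (fun x => f x + g x) =
  (fun x => multiplier sym f x + multiplier sym g x).
Proof.
move=> hs hf hg; have hmf := strip_multiplier hs hf; have hmg := strip_multiplier hs hg.
have hfg := stripD hf hg; apply: strip_ext.
- exact: strip_multiplier.
- exact: stripD.
- move=> k; rewrite (fcoefD _ (strip_cont hmf) (strip_cont hmg)) !fcoef_multiplier//.
  by rewrite (fcoefD _ (strip_cont hf) (strip_cont hg)) mulrDr.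
Qed.

Lemma multiplierZ sym a f : symbol sym -> strip f ->
  multiplier sym (fun x => a * f x) = (fun x => a * multiplier sym f x).
Proof.
move=> hs hf; have hmf := strip_multiplier hs hf; apply: strip_ext.
- by apply: strip_multiplier => //; exact: stripZ.
- exact: stripZ.
- move=> k; rewrite (fcoefZ _ _ (strip_cont hmf)) !fcoef_multiplier//; last exact: stripZ.
  by rewrite (fcoefZ _ _ (strip_cont hf)) mulrCA.
Qed.

Lemma multiplier_normX sym rho sigma f b : symbol sym -> 0 <= rho -> rho < sigma -> wiener sigma f ->
  normX_le sigma f b -> normX_le rho (multiplier sym f) ((1 + (sigma - rho)^-1) * b).
Proof. by move=> hs h0 h1 hf fb; have [] := multiplier_spec hs h0 h1 hf fb. Qed.

Lemma multiplier_wiener sym rho sigma f : symbol sym -> 0 <= rho -> rho < sigma -> wiener sigma f ->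
  wiener rho (multiplier sym f).
Proof. by move=> hs h0 h1 hf; have [] := multiplier_spec hs h0 h1 hf (wiener_normX hf). Qed.

Lemma deriv_on_psum (c : int -> R[i]) N : deriv_on setT (psum c N) (psum (fun k => dx_sym R k * c k) N).
Proof.
rewrite /psum; elim: (ints N) => [|k r ih].
  rewrite (_ : (fun x => _) = (fun=> 0)); last by apply/funext => x; rewrite big_nil.
  rewrite (_ : (fun x => \sum_(k <- [::]) Re (_ * c k * _)) = (fun=> 0)); last by apply/funext => x; rewrite big_nil.
  exact: deriv_on_cst.
rewrite (_ : (fun x => _) = (fun x => Re (c k * cis (k%:~R * x)) + \sum_(j <- r) Re (c j * cis (j%:~R * x)))); last first.
  by apply/funext => x; rewrite big_cons.
rewrite (_ : (fun x => \sum_(j <- k :: r) Re (_ * c j * _)) =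
  (fun x => Re (dx_sym R k * c k * cis (k%:~R * x)) + \sum_(j <- r) Re (dx_sym R j * c j * cis (j%:~R * x)))); last first.
  by apply/funext => x; rewrite big_cons.
apply: deriv_onD => //.
pose a := Re (c k); pose b := Im (c k).
rewrite (_ : (fun x => _) = (fun x => a * cos (k%:~R * x) + (- b) * sin (k%:~R * x))); last first.
  by apply/funext => x; rewrite ReM /= mulNr.
rewrite (_ : (fun x => Re (dx_sym R k * c k * cis (k%:~R * x))) =
   (fun x => a * (- sin (k%:~R * x) * k%:~R) + (- b) * (cos (k%:~R * x) * k%:~R))); last first.
  by apply/funext => x; rewrite /dx_sym intC !(ReM, ImM) /= -/a -/b; ring.
apply: deriv_onD; apply: deriv_onZ; apply: is_derive_deriv_on => x _.
  have h : is_derive x (1 : R) (fun x => cos (k%:~R * x)) (- sin (k%:~R * x) * (k%:~R *: 1)).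
    exact: (@is_derive1_comp _ cos (fun x => k%:~R * x)).
  by apply: is_derive_eq h _; rewrite /GRing.scale/= mulr1.
have h : is_derive x (1 : R) (fun x => sin (k%:~R * x)) (cos (k%:~R * x) * (k%:~R *: 1)).
  exact: (@is_derive1_comp _ sin (fun x => k%:~R * x)).
by apply: is_derive_eq h _; rewrite /GRing.scale/= mulr1.
Qed.

(** Termwise differentiation of the Fourier series: the differentiated partial
    sums still converge uniformly. *)
Lemma strip_derive f : strip f -> forall x, is_derive x (1 : R) f (dx f x).
Proof.
move=> hf x; have sf := wiener_summable (lexx 0) (strip_wiener0 hf).
have hd := strip_multiplier (symbol_dx R) hf.
have sd : abs_summable (fun k => normc (dx_sym R k * fcoef f k)).
  have [b hb] := wiener_summable (lexx 0) (strip_wiener0 hd); exists b => N.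
  apply: le_trans (hb N); apply: ler_sum => k _; rewrite fcoef_multiplier//; exact: symbol_dx.
apply: (@deriv_on_is_derive _ f (dx f) x 1 setT) => //.
apply: (unif_lim_deriv _ (fun n => @deriv_on_psum (fcoef f) n) _ _ (stail_cvg0 sd)).
- by move=> ? ? ? ?.
- move=> t _; rewrite {2}(fourier_inversion (lexx 0) (strip_wiener0 hf)); exact: psum_cvg.
- by move=> n t _; rewrite /dx multiplierE; exact: (synth_tail sd).
Qed.

Lemma derive1_strip f : strip f -> derive1 f = dx f.
Proof. by move=> hf; apply/funext => x; rewrite derive1E; have [] := strip_derive hf x. Qed.

Lemma cvg_sum_ord (u : nat -> nat -> R) (l : nat -> R) n :
  (forall j, (j < n)%N -> u j N @[N --> \oo] --> l j) ->
  \sum_(j < n) u j N @[N --> \oo] --> \sum_(j < n) l j.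
Proof.
elim: n => [|n ih] h.
  by rewrite big_ord0 (_ : (fun _ => _) = (fun=> 0)); [exact: cvg_cst|apply/funext => N; rewrite big_ord0].
rewrite big_ord_recr (_ : (fun _ => _) = (fun N => \sum_(j < n) u j N + u n N)) /=; last first.
  by apply/funext => N; rewrite big_ord_recr.
by apply: cvgD; [apply: ih => j jn; apply: h; exact: ltnW|exact: h].
Qed.

Lemma cvg_sum_nat (u : nat -> nat -> R) (l : nat -> R) n :
  (forall j, u j N @[N --> \oo] --> l j) ->
  \sum_(0 <= j < n) u j N @[N --> \oo] --> \sum_(0 <= j < n) l j.
Proof.
by move=> ul; under eq_fun do rewrite big_mkord; rewrite big_mkord; exact: cvg_sum_ord.
Qed.

Lemma norm_lim_le (u : nat -> R) (l b : R) : u @ \oo --> l ->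
  (\forall n \near \oo, `|u n| <= b) -> `|l| <= b.
Proof.
move=> ul ub; have h : `|u n| @[n --> \oo] --> `|l| by exact: cvg_norm.
by rewrite -(cvg_lim _ h)//; apply: limr_le => //; apply/cvg_ex; eexists; exact: h.
Qed.

(* With s the width of decay, the terms |k y| ^ n / n! of the expansion of
   exp (i k y) are dominated by (|y| / s) ^ n exp (s |k|), which is summable
   against the coefficients; both orders of summation are compared directly
   through the remainder of the n-th partial sum. *)
Section Analytic.

(* The Taylor coefficients of cis at 0. *)
Let gam (n : nat) : R[i] := (cos_coeff (1 : R) n +i* sin_coeff (1 : R) n)%C.

Let coeff_le (a z : R) j : `|a| <= 1 -> `|a / j`!%:R * z ^+ j| <= exp_coeff `|z| j.
Proof.
move=> a1; rewrite /exp_coeff /= !normrM normrX [`|_^-1|]ger0_norm ?invr_ge0//.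
by rewrite mulrC ler_wpM2l ?exprn_ge0// ler_piMl ?invr_ge0.
Qed.

Let cos_coeff_le (z : R) j : `|cos_coeff z j| <= exp_coeff `|z| j.
Proof.
rewrite cos_coeffE; apply: coeff_le => //; rewrite normrM normrX normrN1 expr1n mulr1.
by case: odd; rewrite ?normr0 ?normr1.
Qed.

Let sin_coeff_le (z : R) j : `|sin_coeff z j| <= exp_coeff `|z| j.
Proof.
rewrite sin_coeffE; apply: coeff_le => //; rewrite normrM normrX normrN1 expr1n mulr1.
by case: odd; rewrite ?normr0 ?normr1.
Qed.

Let series_exp_le (w : R) n : 0 <= w -> series (exp_coeff w) n <= expR w.
Proof.
move=> w0; have p j : 0 <= exp_coeff w j by apply: exp_coeff_ge0.
rewrite /expR; apply: nondecreasing_cvgn_le; last exact: is_cvg_series_exp_coeff.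
by apply: nondecreasing_series.
Qed.

Let cis_tail (z : R) n :
  normc (cis z - \sum_(0 <= j < n) gam j * (z ^+ j)%:C%C) <= 2 * tail (exp_coeff `|z|) n.
Proof.
have cE := is_cvg_series_exp_coeff `|z|.
have cosE j : Re (gam j * (z ^+ j)%:C%C) = cos_coeff z j.
  by rewrite ReM /= mulr0 subr0 !cos_coeffE expr1n; ring.
have sinE j : Im (gam j * (z ^+ j)%:C%C) = sin_coeff z j.
  by rewrite ImM /= mulr0 add0r !sin_coeffE expr1n; ring.
apply: le_trans (normc_le_ReIm _) _; rewrite ReB ImB Re_sum Im_sum mulr_natl mulr2n.
under eq_bigr do rewrite cosE; under [X in _ + `|_ - X|]eq_bigr do rewrite sinE.
apply: lerD => /=.
  have := mtest_tail (cos_coeff_le z) cE n; by rewrite cos.unlock.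
have := mtest_tail (sin_coeff_le z) cE n; by rewrite sin.unlock.
Qed.

Let tail_scale (th w : R) n : 0 <= th -> th <= 1 -> 0 <= w ->
  tail (exp_coeff (th * w)) n <= th ^+ n * expR w.
Proof.
move=> t0 t1 w0; have cE := is_cvg_series_exp_coeff (th * w).
have h : (series (exp_coeff (th * w)) m - series (exp_coeff (th * w)) n) @[m --> \oo] -->
   tail (exp_coeff (th * w)) n by apply: cvgB => //; exact: cvg_cst.
rewrite -(cvg_lim _ h)//; apply: limr_le; first by apply/cvg_ex; eexists; exact: h.
exists n => // m /= nm; rewrite sub_series_geq//.
apply: (@le_trans _ _ (th ^+ n * \sum_(n <= k < m) exp_coeff w k)).
  rewrite mulr_sumr big_nat_cond [leRHS]big_nat_cond; apply: ler_sum => k /andP[/andP[nk _] _].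
  rewrite /exp_coeff/= exprMn -mulrA ler_wpM2r ?mulr_ge0 ?invr_ge0 ?exprn_ge0//.
  by rewrite ler_wiXn2l.
rewrite ler_wpM2l ?exprn_ge0//.
have p (k : nat) : 0 <= exp_coeff w k by apply: exp_coeff_ge0.
have <- : series (exp_coeff w) m - series (exp_coeff w) n = \sum_(n <= k < m) exp_coeff w k.
  by rewrite sub_series_geq.
have q := series_exp_le m w0.
have : 0 <= series (exp_coeff w) n by apply: sumr_ge0.
lra.
Qed.

(** The radius of convergence is the width of the decay, at every point. *)
Lemma strip_real_analytic f : strip f -> real_analytic f.
Proof.
case=> s s0 hf x0; exists s => //.
have hf0 := wiener_mono (ltW s0) hf.
have sf := wiener_summable (lexx 0) hf0.
pose d n k : R[i] := fcoef f k * gam n * (k%:~R ^+ n : R)%:C%C.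
have [b hb] : exists b, normX_le s f b by exists (fine (normX s f)); exact: wiener_normX.
have gamle n : normc (gam n) <= 2 * (n`!%:R)^-1.
  apply: le_trans (normc_le_ReIm _) _; rewrite mulr_natl mulr2n.
  have := cos_coeff_le 1 n; have := sin_coeff_le 1 n.
  by rewrite /exp_coeff /= normr1 expr1n mul1r => h1 h2; apply: lerD.
have powle n k : `|k%:~R ^+ n| * (n`!%:R)^-1 <= s ^- n * expR (s * `|k|%:~R) :> R.
  rewrite normrX intr_norm; set y : R := `|k%:~R|; have y0 : 0 <= y by exact: normr_ge0.
  have : exp_coeff (s * y) n <= expR (s * y).
    have p j : 0 <= exp_coeff (s * y) j by apply: exp_coeff_ge0; rewrite mulr_ge0// ltW.
    apply: (@le_trans _ _ (series (exp_coeff (s * y)) n.+1)).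
      by rewrite /series /= big_nat_recr//= lerDr sumr_ge0.
    by apply: series_exp_le; rewrite mulr_ge0// ltW.
  rewrite /exp_coeff/= exprMn -mulrA => h.
  by rewrite -(ler_pM2l (exprn_gt0 n s0)) [leRHS]mulrA divff ?mul1r// gt_eqF// exprn_gt0.
have sd n : abs_summable (fun k => normc (d n k)).
  exists (2 * s ^- n * b) => N; move/normX_leP : (hb) => /(_ N) h.
  have c0 : 0 <= 2 * s ^- n by rewrite mulr_ge0// invr_ge0 exprn_ge0// ltW.
  apply: le_trans (ler_wpM2l c0 h); rewrite mulr_sumr; apply: ler_sum => k _.
  rewrite !normcM normcR /wcoef -mulrA mulrC -[leRHS]mulrA.
  rewrite 2![in leRHS]mulrA -[2 * _ * _]mulrA; apply: ler_wpM2r; first exact: normc_ge0.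
  apply: le_trans (ler_wpM2r (normr_ge0 _) (gamle n)) _.
  by rewrite -mulrA ler_wpM2l// mulrC.
exists (fun n => synth (d n) x0) => x xs.
pose y := x - x0; pose th := `|y| / s.
have th0 : 0 <= th by rewrite divr_ge0// ltW.
have th1 : th < 1 by rewrite ltr_pdivrMr// mul1r.
have main n : `|f x - series (fun n => synth (d n) x0 * y ^+ n) n| <= 2 * b * th ^+ n.
  have h1 : (psum (fcoef f) N x - \sum_(0 <= j < n) psum (d j) N x0 * y ^+ j) @[N --> \oo] -->
     f x - series (fun n => synth (d n) x0 * y ^+ n) n.
    apply: cvgB.
      rewrite [in X in _ --> X](fourier_inversion (lexx 0) hf0); exact: psum_cvg.
    rewrite /series /=; apply: cvg_sum_nat => j; apply: cvgM; [exact: psum_cvg|exact: cvg_cst].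
  apply: (norm_lim_le h1); near=> N; rewrite /psum.
  under [X in _ - X]eq_bigr do rewrite mulr_suml.
  rewrite exchange_big/= -sumrB; apply: le_trans (ler_norm_sum _ _ _) _.
  move/normX_leP : (hb) => /(_ N) h.
  have c0 : 0 <= 2 * th ^+ n by rewrite mulr_ge0// exprn_ge0.
  rewrite mulrAC; apply: le_trans (ler_wpM2l c0 h); rewrite mulr_sumr; apply: ler_sum => k _.
  pose c := fcoef f k * cis (k%:~R * x0).
  have -> : Re (fcoef f k * cis (k%:~R * x)) -
      \sum_(0 <= j < n) Re (d j k * cis (k%:~R * x0)) * y ^+ j =
      Re (c * (cis (k%:~R * y) - \sum_(0 <= j < n) gam j * ((k%:~R * y) ^+ j)%:C%C)).
    rewrite mulrBr ReB; congr (_ - _).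
      by rewrite /c -mulrA -cisD -mulrDr /y addrC subrK.
    rewrite mulr_sumr Re_sum; apply: eq_bigr => j _.
    rewrite /c /d exprMn rmorphM/=.
    case: (fcoef f k) => a1 a2; case: (gam j) => b1 b2; rewrite /cis /=; ring.
  apply: le_trans (normc_Re _) _; rewrite !normcM normc_cis mulr1 /wcoef.
  apply: le_trans (ler_wpM2l (normc_ge0 _) (cis_tail _ _)) _.
  rewrite normrM [`|k%:~R| * _]mulrC -intr_norm.
  have -> : `|y| * `|k|%:~R = th * (s * `|k|%:~R) by rewrite /th mulrA divfK// gt_eqF.
  have := tail_scale n th0 (ltW th1) (mulr_ge0 (ltW s0) (absz_ge0R R k)).
  move=> h3; have := ler_wpM2l (normc_ge0 (fcoef f k)) h3; lra.
have g0 : (fun n => 2 * b * th ^+ n) @ \oo --> (0 : R).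
  rewrite -(mulr0 (2 * b)); apply: cvgM; first exact: cvg_cst.
  by apply: cvg_expr; rewrite ger0_norm.
apply/cvgrPdist_le => e e0; have /cvgrPdist_le/(_ _ e0) := g0.
apply: filterS => n; rewrite sub0r normrN => h; apply: le_trans (main n) _.
exact: le_trans (ler_norm _) h.
Unshelve. all: by end_near.
Qed.
End Analytic.
End Strip.

(** * Normally convergent series of functions *)

Lemma sum_ord_diff (V : zmodType) (F : nat -> V) n m : (n <= m)%N ->
  \sum_(k < m) F k - \sum_(k < n) F k = \sum_(k < m - n) F (n + k)%N.
Proof.
move=> nm; have -> : \sum_(k < m) F k = \sum_(k < n + (m - n)) F k by rewrite subnKC.
by rewrite big_split_ord/= addrAC subrr add0r.
Qed.

Section WienerSeries.
Variable R : realType.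
Implicit Types (f g : R -> R) (x b : R) (k : int) (N n : nat) (sym : int -> R[i]).

(** Only used when the norms of the terms are summable, so that the pointwise
    limit is also the limit in norm. *)
Definition ssum (u : nat -> R -> R) : R -> R := fun x => limn (series (fun n => u n x)).

Lemma normX_sum t n (u : nat -> R -> R) (M : nat -> R) : (forall i, wiener t (u i)) ->
  (forall i, normX_le t (u i) (M i)) ->
  wiener t (fun x => \sum_(i < n) u i x) /\
  normX_le t (fun x => \sum_(i < n) u i x) (\sum_(i < n) M i).
Proof.
move=> hu uM; elim: n => [|n [ih1 ih2]].
  rewrite big_ord0 (_ : (fun x => _) = (fun=> 0)); last by apply/funext => x; rewrite big_ord0.
  by split; [exact: wiener_cst|rewrite -[X in normX_le _ _ X](@normr0 _ R); exact: normX_cst].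
rewrite big_ord_recr /= (_ : (fun x => _) = (fun x => \sum_(i < n) u i x + u n x)).
  by split; [exact: wienerD|apply: normXD => //; apply: wiener_cont; [exact: ih1|exact: hu]].
by apply/funext => x; rewrite big_ord_recr.
Qed.

Section Sum.
Variables (t : R) (u : nat -> R -> R) (M : nat -> R).
Hypothesis t0 : 0 <= t.
Hypothesis wu : forall n, wiener t (u n).
Hypothesis uM : forall n, normX_le t (u n) (M n).
Hypothesis cM : cvgn (series M).

Lemma wseries_le x n : `|u n x| <= M n.
Proof.
apply: sup_le_normX; first exact: wiener_mono t0 (wu n).
apply/normX_leE; apply: le_trans (normX_mono _ t0) _; apply/normX_leE; exact: uM.
Qed.

Lemma ssum_cvg x : \sum_(k < n) u k x @[n --> \oo] --> ssum u x.
Proof.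
have h := mtest_cvg (wseries_le x) cM.
have -> : (fun n => \sum_(k < n) u k x) = series (fun n => u n x); last exact: h.
by apply/funext => n; rewrite /series /= big_mkord.
Qed.

Lemma ssum_tail x n : `|ssum u x - \sum_(k < n) u k x| <= tail M n.
Proof.
have -> : \sum_(k < n) u k x = series (fun n => u n x) n by rewrite /series /= big_mkord.
exact: mtest_tail (wseries_le x) cM n.
Qed.

Let wpart n := (normX_sum n wu uM).1.

Lemma continuous_ssum : continuous (ssum u).
Proof.
apply: (unif_lim_continuous _ (fun n x => ssum_tail x n) (tail_cvg cM)).
by move=> n; exact: wiener_cont (wpart n).
Qed.

Lemma ssum_per x : ssum u (x + 2 * pi) = ssum u x.
Proof. by congr (limn (series _)); apply/funext => n; rewrite (wiener_per (wu n)). Qed.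

Lemma normX_ssum_tail n : normX_le t (fun x => ssum u x - \sum_(k < n) u k x) (tail M n).
Proof.
have cn m := wiener_cont (wpart m).
apply: (@normX_unif_lim _ (fun m x => \sum_(k < m) u k x - \sum_(k < n) u k x) _ (tail M)).
- by move=> m; exact: continuousB2.
- by apply: continuousB2 => //; exact: continuous_ssum.
- move=> m x; have -> : ssum u x - \sum_(k < n) u k x - (\sum_(k < m) u k x - \sum_(k < n) u k x) =
    ssum u x - \sum_(k < m) u k x by ring.
  exact: ssum_tail.
- exact: tail_cvg.
exists n => // m /= nm.
have -> : (fun x => \sum_(k < m) u k x - \sum_(k < n) u k x) = (fun x => \sum_(k < m - n) u (n + k)%N x).
  by apply/funext => x; rewrite (sum_ord_diff (fun k : nat => u k x)).
apply/normX_leE; apply: (@le_trans _ _ (\sum_(k < m - n) M (n + k)%N)%:E).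
  by apply/normX_leE; apply: (normX_sum _ (fun i => wu (n + i)%N) (fun i => uM (n + i)%N)).2.
rewrite lee_fin; have -> : \sum_(k < m - n) M (n + k)%N = series M m - series M n.
  by rewrite -sum_ord_diff// /series /= !big_mkord.
exact: mtest_partial (wseries_le 0) cM _ _ nm.
Qed.

Lemma normX_ssum : normX_le t (ssum u) (limn (series M)).
Proof.
have := normX_ssum_tail 0; rewrite /tail {2}/series /= big_geq// subr0.
by congr normX_le; apply/funext => x; rewrite big_ord0 subr0.
Qed.

Lemma wiener_ssum : wiener t (ssum u).
Proof. by apply: wienerI normX_ssum; [exact: ssum_per|exact: continuous_ssum]. Qed.
End Sum.

Lemma multiplier_sum sym n (u : nat -> R -> R) : symbol sym -> (forall i, strip (u i)) ->
  multiplier sym (fun x => \sum_(i < n) u i x) = (fun x => \sum_(i < n) multiplier sym (u i) x).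
Proof.
move=> hs hu; elim: n => [|n ih].
  have E : (fun x : R => \sum_(i < 0) u i x) = (fun x => 0 * (fun=> 0) x).
    by apply/funext => x; rewrite big_ord0 mul0r.
  rewrite E multiplierZ//; last exact: strip_cst.
  by apply/funext => x; rewrite big_ord0 mul0r.
have E : (fun x => \sum_(i < n.+1) u i x) = (fun x => (fun x => \sum_(i < n) u i x) x + u n x).
  by apply/funext => x; rewrite big_ord_recr.
rewrite E multiplierD//; last by apply: strip_sum.
by rewrite ih; apply/funext => x; rewrite big_ord_recr.
Qed.

Lemma multiplierB sym f g : symbol sym -> strip f -> strip g ->
  multiplier sym (fun x => f x - g x) = (fun x => multiplier sym f x - multiplier sym g x).
Proof.
move=> hs hf hg.
have E : (fun x => f x - g x) = (fun x => f x + -1 * g x) by apply/funext => x; ring.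
rewrite E multiplierD//; last exact: stripZ.
by rewrite multiplierZ//; apply/funext => x; ring.
Qed.

Lemma wiener_strip t f : 0 < t -> wiener t f -> strip f.
Proof. by exists t. Qed.

(** A multiplier is continuous from X_t to X_0 and therefore passes under the
    sum. *)
Lemma multiplier_ssum sym t (u : nat -> R -> R) (M : nat -> R) x : symbol sym -> 0 < t ->
  (forall n, wiener t (u n)) -> (forall n, normX_le t (u n) (M n)) -> cvgn (series M) ->
  \sum_(k < n) multiplier sym (u k) x @[n --> \oo] --> multiplier sym (ssum u) x.
Proof.
move=> hs t0 wu uM cM; have st f := @wiener_strip t f t0.
have sn n : strip (fun x => \sum_(k < n) u k x).
  by apply: st; exact: (normX_sum n wu uM).1.
have ss : strip (ssum u) by apply: st; exact: (wiener_ssum (ltW t0) wu uM cM).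
apply/cvgrPdist_le => e e0.
pose c := 1 + (t - 0)^-1.
have c0 : 0 < c by rewrite ltr_wpDr// invr_ge0 subr0 ltW.
have ec : 0 < e / c by rewrite divr_gt0.
have := tail_near cM ec; apply: filterS => n hn.
have -> : \sum_(k < n) multiplier sym (u k) x = multiplier sym (fun x => \sum_(k < n) u k x) x.
  by rewrite multiplier_sum// => i; exact: st.
have <- : multiplier sym (fun x => ssum u x - \sum_(k < n) u k x) x =
  multiplier sym (ssum u) x - multiplier sym (fun x => \sum_(k < n) u k x) x.
  by rewrite multiplierB.
have wd : wiener t (fun x => ssum u x - \sum_(k < n) u k x).
  by apply: wienerB; [exact: (wiener_ssum (ltW t0) wu uM cM)|exact: (normX_sum n wu uM).1].
apply: (@le_trans _ _ (c * tail M n)).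
  apply: (@sup_le_normX _ (multiplier sym (fun x => ssum u x - \sum_(k < n) u k x))).
    exact: multiplier_wiener hs (lexx 0) t0 wd.
  exact: multiplier_normX hs (lexx 0) t0 wd (normX_ssum_tail (ltW t0) wu uM cM n).
by rewrite mulrC -ler_pdivlMr// ltW.
Qed.

End WienerSeries.

(** * The nonlinearity and its loss of one derivative *)

Section Nonlinearity.
Variable R : realType.
Variable g : R.
Hypothesis g0 : 0 <= g.
Implicit Types (p r q s f : R -> R) (x b : R) (k : int).

Definition lam f := multiplier (@lambda_sym R) f.
Definition hil f := multiplier (@hilbert_sym R) f.

(** The bilinear form of the model: its value at (h, h', h, h') is the
    right-hand side of the equation without the linear term. *)
Definition nlin p r q s : R -> R := fun x =>
  lam (fun y => g * p y * lam q y - hil r y * hil s y) x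
  + g * dx (fun y => p y * dx q y) x.

Definition demean f : R -> R := fun x => f x - Re (fcoef f 0).

Lemma strip_lam f : strip f -> strip (lam f).
Proof. by apply: strip_multiplier; exact: symbol_lambda. Qed.
Lemma strip_hil f : strip f -> strip (hil f).
Proof. by apply: strip_multiplier; exact: symbol_hilbert. Qed.
Lemma strip_dx f : strip f -> strip (dx f).
Proof. by apply: strip_multiplier; exact: symbol_dx. Qed.
Lemma strip_demean f : strip f -> strip (demean f).
Proof. by move=> hf; apply: stripB => //; exact: strip_cst. Qed.

Let hin p r q s : strip p -> strip r -> strip q -> strip s ->
  strip (fun y => g * p y * lam q y - hil r y * hil s y).
Proof.
move=> hp hr hq hs; apply: stripB; apply: stripM.
- exact: stripZ.
- exact: strip_lam.
- exact: strip_hil.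
- exact: strip_hil.
Qed.

Let hdd p q : strip p -> strip q -> strip (fun y => p y * dx q y).
Proof. by move=> hp hq; apply: stripM => //; exact: strip_dx. Qed.

Lemma strip_nlin p r q s : strip p -> strip r -> strip q -> strip s -> strip (nlin p r q s).
Proof.
move=> hp hr hq hs; apply: stripD; first by apply: strip_lam; exact: hin.
by apply: stripZ; apply: strip_dx; exact: hdd.
Qed.

Let sl : symbol (@lambda_sym R) := @symbol_lambda R.
Let sh : symbol (@hilbert_sym R) := @symbol_hilbert R.
Let sd : symbol (@dx_sym R) := @symbol_dx R.

Lemma nlinDl p p' r r' q s : strip p -> strip p' -> strip r -> strip r' -> strip q -> strip s ->
  nlin (fun x => p x + p' x) (fun x => r x + r' x) q s = (fun x => nlin p r q s x + nlin p' r' q s x).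
Proof.
move=> hp hp' hr hr' hq hs; apply/funext => x; rewrite /nlin.
have -> : (fun y => g * (p y + p' y) * lam q y - hil (fun x => r x + r' x) y * hil s y) =
  (fun y => (g * p y * lam q y - hil r y * hil s y) + (g * p' y * lam q y - hil r' y * hil s y)).
  by apply/funext => y; rewrite /hil multiplierD//; ring.
have -> : (fun y => (p y + p' y) * dx q y) = (fun y => p y * dx q y + p' y * dx q y).
  by apply/funext => y; ring.
rewrite {1}/lam (multiplierD sl (hin hp hr hq hs) (hin hp' hr' hq hs)).
by rewrite {1}/dx (multiplierD sd (hdd hp hq) (hdd hp' hq)) -/(lam _) -/(lam _) -/(dx _) -/(dx _); ring.
Qed.

Lemma nlinDr p r q q' s s' : strip p -> strip r -> strip q -> strip q' -> strip s -> strip s' ->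
  nlin p r (fun x => q x + q' x) (fun x => s x + s' x) = (fun x => nlin p r q s x + nlin p r q' s' x).
Proof.
move=> hp hr hq hq' hs hs'; apply/funext => x; rewrite /nlin.
have -> : (fun y => g * p y * lam (fun x => q x + q' x) y - hil r y * hil (fun x => s x + s' x) y) =
  (fun y => (g * p y * lam q y - hil r y * hil s y) + (g * p y * lam q' y - hil r y * hil s' y)).
  by apply/funext => y; rewrite /hil /lam !multiplierD//; ring.
have -> : (fun y => p y * dx (fun x => q x + q' x) y) = (fun y => p y * dx q y + p y * dx q' y).
  by apply/funext => y; rewrite /dx multiplierD//; ring.
rewrite {1}/lam (multiplierD sl (hin hp hr hq hs) (hin hp hr hq' hs')).
by rewrite {1}/dx (multiplierD sd (hdd hp hq) (hdd hp hq')) -/(lam _) -/(lam _) -/(dx _) -/(dx _); ring.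
Qed.

Lemma nlinZ a b p r q s : strip p -> strip r -> strip q -> strip s ->
  nlin (fun x => a * p x) (fun x => a * r x) (fun x => b * q x) (fun x => b * s x) =
  (fun x => a * b * nlin p r q s x).
Proof.
move=> hp hr hq hs; apply/funext => x; rewrite /nlin.
have -> : (fun y => g * (a * p y) * lam (fun x => b * q x) y -
                    hil (fun x => a * r x) y * hil (fun x => b * s x) y) =
  (fun y => (a * b) * (g * p y * lam q y - hil r y * hil s y)).
  by apply/funext => y; rewrite /hil /lam !multiplierZ//; ring.
have -> : (fun y => a * p y * dx (fun x => b * q x) y) = (fun y => (a * b) * (p y * dx q y)).
  by apply/funext => y; rewrite /dx multiplierZ//; ring.
rewrite {1}/lam (multiplierZ _ sl (hin hp hr hq hs)).
by rewrite {1}/dx (multiplierZ _ sd (hdd hp hq)) -/(lam _) -/(dx _); ring.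
Qed.

Lemma fcoef_lam f k : strip f -> fcoef (lam f) k = `|k|%:~R * fcoef f k.
Proof. by move=> hf; rewrite /lam fcoef_multiplier. Qed.

(** The two quadratic terms of the potential energy cancel against constants:
    Lambda ^ 2 + d ^ 2 / dx ^ 2 = 0.  Hence only the oscillating part of p
    matters. *)
Lemma nlin_cst c q s : strip q -> strip s -> nlin (fun=> c) (fun=> 0) q s = (fun=> 0).
Proof.
move=> hq hs; have h0 : hil (fun=> 0) = (fun=> 0).
  have E : (fun _ : R => 0 : R) = (fun x => 0 * (fun=> 0) x) by apply/funext => x; rewrite mul0r.
  rewrite /hil {1}E multiplierZ//; last exact: strip_cst.
  by apply/funext => x; rewrite mul0r.
have E1 : lam (fun y => g * c * lam q y - hil (fun=> 0) y * hil s y) = (fun x => g * c * lam (lam q) x).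
  rewrite h0; have -> : (fun y => g * c * lam q y - 0 * hil s y) = (fun y => g * c * lam q y).
    by apply/funext => y; rewrite mul0r subr0.
  by rewrite {1}/lam multiplierZ//; exact: strip_lam.
have E2 : dx (fun y => c * dx q y) = (fun x => c * dx (dx q) x).
  by rewrite {1}/dx multiplierZ//; exact: strip_dx.
have E3 : lam (lam q) = (fun x => -1 * dx (dx q) x).
  apply: strip_ext.
  - by apply: strip_lam; exact: strip_lam.
  - by apply: stripZ; apply: strip_dx; exact: strip_dx.
  move=> k; rewrite fcoefZ; last by apply: strip_cont; apply: strip_dx; exact: strip_dx.
  rewrite fcoef_lam; last exact: strip_lam.
  rewrite fcoef_lam// /dx !fcoef_multiplier//; last exact: strip_dx.
  rewrite /dx_sym !intC intr_norm.
  have : `|k%:~R : R| * `|k%:~R : R| = k%:~R * k%:~R by rewrite -expr2 real_normK ?num_real// expr2.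
  set a : R := `|_|; set b : R := k%:~R => ab.
  case: (fcoef q k) => c1 c2; apply: complex_ext => /=; rewrite !mul0r ?subr0 ?addr0 !add0r ?mul0r ?subr0 ?addr0.
    transitivity (a * a * c1); first by ring.
    by rewrite ab; ring.
  transitivity (a * a * c2); first by ring.
  by rewrite ab; ring.
by apply/funext => x; rewrite /nlin E1 E2 E3; ring.
Qed.

(** Removing the mean of the first argument makes its norm controllable by that
    of Lambda p, which vanishes on constants. *)
Lemma nlin_demean p r q s : strip p -> strip r -> strip q -> strip s ->
  nlin p r q s = nlin (demean p) r q s.
Proof.
move=> hp hr hq hs; have hc := strip_cst (Re (fcoef p 0)); have h0 := @strip_cst R 0.
have Ep : p = (fun x => demean p x + (fun=> Re (fcoef p 0)) x).
  by apply/funext => x; rewrite subrK.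
have Er : r = (fun x => r x + (fun=> 0) x) by apply/funext => x; rewrite addr0.
rewrite {1}Ep {1}Er nlinDl// ?nlin_cst//; last exact: strip_demean.
by apply/funext => x; rewrite addr0.
Qed.

End Nonlinearity.

Section NlinBounds.
Variable R : realType.
Variable g : R.
Hypothesis g0 : 0 <= g.
Implicit Types (p r q s f : R -> R) (x a b e rho sigma d : R) (k : int) (N : nat).

Let sl : symbol (@lambda_sym R) := @symbol_lambda R.
Let sh : symbol (@hilbert_sym R) := @symbol_hilbert R.
Let sd : symbol (@dx_sym R) := @symbol_dx R.

Lemma normX_le_coef t f f' b : (forall k, normc (fcoef f k) <= normc (fcoef f' k)) ->
  normX_le t f' b -> normX_le t f b.
Proof.
move=> ff' /normX_leP h; apply/normX_leP => N; apply: le_trans (h N); apply: ler_sum => k _.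
by rewrite /wcoef ler_wpM2l ?expR_ge0.
Qed.

Lemma normX_le_mono t f b c : b <= c -> normX_le t f b -> normX_le t f c.
Proof. by move=> bc /normX_leP h; apply/normX_leP => N; exact: le_trans (h N) bc. Qed.

Lemma strip_wiener t f b : strip f -> normX_le t f b -> wiener t f.
Proof. by move=> hf; apply: wienerI; [exact: strip_per|exact: strip_cont]. Qed.

Lemma normc_fcoef_lam f k : strip f -> normc (fcoef (lam f) k) = `|k|%:~R * normc (fcoef f k).
Proof. by move=> hf; rewrite fcoef_lam// normcM normc_int -intr_norm normr_id. Qed.

Lemma normc_fcoef_dx f k : strip f -> normc (fcoef (dx f) k) = `|k|%:~R * normc (fcoef f k).
Proof. by move=> hf; rewrite /dx fcoef_multiplier// normcM /dx_sym normcM normc_i mul1r normc_int -intr_norm. Qed.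

Lemma normc_fcoef_hil f k : strip f -> normc (fcoef (hil f) k) <= normc (fcoef f k).
Proof.
move=> hf; rewrite /hil fcoef_multiplier// normcM /hilbert_sym normcM normcN normc_i mul1r normc_int.
by rewrite ler_piMl ?normc_ge0// -intr_norm lerz1; case: sgzP.
Qed.

Lemma normc_fcoef_demean f k : strip f ->
  normc (fcoef (demean f) k) <= `|k|%:~R * normc (fcoef f k).
Proof.
move=> hf; have cf := strip_cont hf.
have cc (c : R) : continuous (fun _ : R => c) by move=> x; exact: cvg_cst.
rewrite /demean fcoefB// fcoef_cst.
have [->|k0] := eqVneq k 0.
  rewrite normr0 mul0r mulr1; have h : Im (fcoef f 0) = 0.
    have := fcoef_oppz 0 cf; rewrite oppr0 => /(congr1 (@complex.Im R)).
    by case: (fcoef f 0) => a b /= h; lra.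
  rewrite (_ : _ - _ = 0) ?normc0//.
  by apply: complex_ext; rewrite ?ReB ?ImB ?h /= subrr.
rewrite mulr0 (_ : _ - _ = fcoef f k); last by apply: complex_ext; rewrite ?ReB ?ImB /= subr0.
rewrite ler_peMl ?normc_ge0// (_ : 1 = 1%:~R :> R)// ler_int.
by rewrite -gtz0_ge1 normr_gt0.
Qed.

(** What is left of the k-th coefficient of [nlin] when the factor |k| of the
    outer derivative has been taken out. *)
Definition bracket p r q s k : R :=
  g * normc (fcoef (fun y => demean p y * lam q y) k) +
  normc (fcoef (fun y => hil r y * hil s y) k) +
  g * normc (fcoef (fun y => demean p y * dx q y) k).

Lemma fcoef_nlin_le p r q s k : strip p -> strip r -> strip q -> strip s ->
  normc (fcoef (nlin g p r q s) k) <= `|k|%:~R * bracket p r q s k.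
Proof.
move=> hp hr hq hs; rewrite nlin_demean//.
have hdp := strip_demean hp; have hlq := strip_lam hq; have hdq := strip_dx hq.
have hhr := strip_hil hr; have hhs := strip_hil hs.
have h1 := stripM hdp hlq; have h2 := stripM hhr hhs; have h3 := stripM hdp hdq.
have h4 := stripB (stripZ g h1) h2.
have E : nlin g (demean p) r q s =
    (fun x => lam (fun y => g * (demean p y * lam q y) - hil r y * hil s y) x +
              g * dx (fun y => demean p y * dx q y) x).
  apply/funext => x; rewrite /nlin; congr (lam _ _ + _); apply/funext => y.
  by rewrite mulrA.
rewrite E fcoefD; last 2 first.
- by apply: strip_cont; exact: strip_lam.
- by apply: strip_cont; apply: stripZ; exact: strip_dx.
rewrite fcoefZ; last by apply: strip_cont; exact: strip_dx.
apply: le_trans (normcD _ _) _; rewrite normcM normcR ger0_norm// normc_fcoef_dx// normc_fcoef_lam//.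
rewrite /bracket mulrDr mulrCA; apply: lerD => //; apply: ler_wpM2l; first exact: absz_ge0R.
rewrite fcoefB; last 2 first.
- by apply: strip_cont; exact: stripZ.
- exact: strip_cont.
rewrite fcoefZ; last exact: strip_cont.
by apply: le_trans (normcB _ _) _; rewrite normcM normcR ger0_norm.
Qed.

Section Bounded.
Variables (rho a b : R) (p r q s : R -> R).
Hypothesis rho0 : 0 <= rho.
Hypotheses (hp : strip p) (hr : strip r) (hq : strip q) (hs : strip s).
Hypotheses (pa : normX_le rho (lam p) a) (ra : normX_le rho r a).
Hypotheses (qb : normX_le rho (lam q) b) (sb : normX_le rho s b).

Let hdp := strip_demean hp.
Let hlq := strip_lam hq.
Let hdq := strip_dx hq.
Let hhr := strip_hil hr.
Let hhs := strip_hil hs.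

Let dpa : normX_le rho (demean p) a.
Proof.
apply: normX_le_coef pa => k; rewrite normc_fcoef_lam//; exact: normc_fcoef_demean.
Qed.
Let dqb : normX_le rho (dx q) b.
Proof. by apply: normX_le_coef qb => k; rewrite normc_fcoef_lam// normc_fcoef_dx. Qed.
Let hra : normX_le rho (hil r) a.
Proof. by apply: normX_le_coef ra => k; exact: normc_fcoef_hil. Qed.
Let hsb : normX_le rho (hil s) b.
Proof. by apply: normX_le_coef sb => k; exact: normc_fcoef_hil. Qed.

Lemma bracket_sum N : \sum_(k <- ints N) expR (rho * `|k|%:~R) * bracket p r q s k <=
  (2 * g + 1) * (a * b).
Proof.
have w1 := strip_wiener hdp dpa; have w2 := strip_wiener hlq qb; have w3 := strip_wiener hdq dqb.
have w4 := strip_wiener hhr hra; have w5 := strip_wiener hhs hsb.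
have /normX_leP/(_ N) h1 := normXM rho0 w1 w2 dpa qb.
have /normX_leP/(_ N) h2 := normXM rho0 w4 w5 hra hsb.
have /normX_leP/(_ N) h3 := normXM rho0 w1 w3 dpa dqb.
have -> : \sum_(k <- ints N) expR (rho * `|k|%:~R) * bracket p r q s k =
   g * (\sum_(k <- ints N) wcoef rho (fun y => demean p y * lam q y) k) +
   \sum_(k <- ints N) wcoef rho (fun y => hil r y * hil s y) k +
   g * (\sum_(k <- ints N) wcoef rho (fun y => demean p y * dx q y) k).
  rewrite !mulr_sumr -!big_split; apply: eq_bigr => k _; rewrite /wcoef /bracket /=; ring.
have := ler_wpM2l g0 h1; have := ler_wpM2l g0 h3; lra.
Qed.

Lemma bracket_ge0 k : 0 <= bracket p r q s k.
Proof. by rewrite !addr_ge0// ?mulr_ge0// normc_ge0. Qed.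

(** The outer factor |k| is absorbed by the difference of the widths. *)
Lemma normX_nlin rho' : 0 <= rho' -> rho' < rho ->
  normX_le rho' (nlin g p r q s) ((rho - rho')^-1 * ((2 * g + 1) * (a * b))).
Proof.
move=> r'0 r'r; apply/normX_leP => N.
have d0 : 0 < rho - rho' by rewrite subr_gt0.
have di0 : 0 <= (rho - rho')^-1 by rewrite invr_ge0 ltW.
apply: le_trans (ler_wpM2l di0 (bracket_sum N)); rewrite mulr_sumr; apply: ler_sum => k _.
rewrite /wcoef; apply: le_trans (ler_wpM2l (expR_ge0 _) (fcoef_nlin_le k hp hr hq hs)) _.
rewrite mulrA [leRHS]mulrA; apply: ler_wpM2r; first exact: bracket_ge0.
have -> : rho * `|k|%:~R = (rho - rho') * `|k|%:~R + rho' * `|k|%:~R :> R by ring.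
by rewrite expRD mulrA mulrC; apply: ler_wpM2r; [exact: expR_ge0|exact: expR_absorb].
Qed.

(** The factor |k| is at most d on all the frequencies that occur. *)
Lemma normX_nlin_banded d : banded d (nlin g p r q s) ->
  normX_le rho (nlin g p r q s) (d * ((2 * g + 1) * (a * b))) \/ d < 0.
Proof.
move=> bd; have [d0|] := leP 0 d; last by right.
left; apply/normX_leP => N.
apply: le_trans (ler_wpM2l d0 (bracket_sum N)); rewrite mulr_sumr; apply: ler_sum => k _.
rewrite /wcoef; have [dk|kd] := ltP d (`|k|%:~R).
  by rewrite bd// normc0 mulr0 mulr_ge0// mulr_ge0 ?expR_ge0// bracket_ge0.
apply: le_trans (ler_wpM2l (expR_ge0 _) (fcoef_nlin_le k hp hr hq hs)) _.
by rewrite mulrCA; apply: ler_wpM2r => //; rewrite mulr_ge0 ?expR_ge0 ?bracket_ge0.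
Qed.
End Bounded.

Lemma banded_nlin d d' p r q s : 0 <= d -> 0 <= d' -> strip p -> strip r -> strip q -> strip s ->
  banded d p -> banded d r -> banded d' q -> banded d' s -> banded (d + d') (nlin g p r q s).
Proof.
move=> d0 d'0 hp hr hq hs bp br bq bs k dk; apply: normc_eq0; apply: le_anti.
rewrite normc_ge0 andbT; apply: le_trans (fcoef_nlin_le k hp hr hq hs) _.
have b1 : banded d (demean p).
  move=> j dj; apply: normc_eq0; apply: le_anti; rewrite normc_ge0 andbT.
  by apply: le_trans (normc_fcoef_demean j hp) _; rewrite bp// normc0 mulr0.
have b2 : banded d (hil r) by move=> j dj; rewrite /hil fcoef_multiplier// br// mulr0.
have b3 : banded d' (hil s) by move=> j dj; rewrite /hil fcoef_multiplier// bs// mulr0.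
have b4 : banded d' (lam q) by move=> j dj; rewrite /lam fcoef_multiplier// bq// mulr0.
have b5 : banded d' (dx q) by move=> j dj; rewrite /dx fcoef_multiplier// bq// mulr0.
have w f : strip f -> wiener 0 f by exact: strip_wiener0.
have hdp := w _ (strip_demean hp); have hlq := w _ (strip_lam hq); have hdq := w _ (strip_dx hq).
have hhr := w _ (strip_hil hr); have hhs := w _ (strip_hil hs).
rewrite /bracket (bandedM hdp hlq b1 b4 dk) (bandedM hhr hhs b2 b3 dk) (bandedM hdp hdq b1 b5 dk).
by rewrite normc0 !mulr0 !addr0 mulr0.
Qed.

(** The estimates behind uniqueness: with one argument bounded in norm, decay of
    the coefficients of the other passes to the result, up to one factor of the
    frequency. *)
Lemma nlin_decayr rho a e p r q s k : 0 <= rho -> strip p -> strip r -> strip q -> strip s ->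
  normX_le rho (lam p) a -> normX_le rho r a ->
  (forall k, `|k|%:~R * normc (fcoef q k) + normc (fcoef s k) <= e * expR (- (rho * `|k|%:~R))) ->
  normc (fcoef (nlin g p r q s) k) <= `|k|%:~R * ((2 * g + 1) * (a * e) * expR (- (rho * `|k|%:~R))).
Proof.
move=> r0 hp hr hq hs pa ra qs; apply: le_trans (fcoef_nlin_le k hp hr hq hs) _.
apply: ler_wpM2l; first exact: absz_ge0R.
have w f : strip f -> wiener 0 f by exact: strip_wiener0.
have q1 j : `|j|%:~R * normc (fcoef q j) <= e * expR (- (rho * `|j|%:~R)).
  by apply: le_trans (qs j); rewrite lerDl normc_ge0.
have s1 j : normc (fcoef s j) <= e * expR (- (rho * `|j|%:~R)).
  by apply: le_trans (qs j); rewrite lerDr mulr_ge0 ?absz_ge0R ?normc_ge0.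
have dpa : normX_le rho (demean p) a.
  apply: normX_le_coef pa => j; rewrite normc_fcoef_lam//; exact: normc_fcoef_demean.
have hra : normX_le rho (hil r) a by apply: normX_le_coef ra => j; exact: normc_fcoef_hil.
have w1 := strip_wiener (strip_demean hp) dpa; have w2 := strip_wiener (strip_hil hr) hra.
have h1 : normc (fcoef (fun y => demean p y * lam q y) k) <= a * e * expR (- (rho * `|k|%:~R)).
  apply: fcoefM_decay => //; first by apply: w; exact: strip_lam.
  by move=> j; rewrite normc_fcoef_lam.
have h2 : normc (fcoef (fun y => hil r y * hil s y) k) <= a * e * expR (- (rho * `|k|%:~R)).
  apply: fcoefM_decay => //; first by apply: w; exact: strip_hil.
  by move=> j; apply: le_trans (normc_fcoef_hil j hs) _.
have h3 : normc (fcoef (fun y => demean p y * dx q y) k) <= a * e * expR (- (rho * `|k|%:~R)).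
  apply: fcoefM_decay => //; first by apply: w; exact: strip_dx.
  by move=> j; rewrite normc_fcoef_dx.
have := ler_wpM2l g0 h1; have := ler_wpM2l g0 h3; rewrite /bracket; lra.
Qed.

Lemma nlin_decayl rho b e p r q s k : 0 <= rho -> strip p -> strip r -> strip q -> strip s ->
  normX_le rho (lam q) b -> normX_le rho s b ->
  (forall k, `|k|%:~R * normc (fcoef p k) + normc (fcoef r k) <= e * expR (- (rho * `|k|%:~R))) ->
  normc (fcoef (nlin g p r q s) k) <= `|k|%:~R * ((2 * g + 1) * (b * e) * expR (- (rho * `|k|%:~R))).
Proof.
move=> r0 hp hr hq hs qb sb pr; apply: le_trans (fcoef_nlin_le k hp hr hq hs) _.
apply: ler_wpM2l; first exact: absz_ge0R.
have w f : strip f -> wiener 0 f by exact: strip_wiener0.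
have p1 j : normc (fcoef (demean p) j) <= e * expR (- (rho * `|j|%:~R)).
  apply: le_trans (normc_fcoef_demean j hp) _.
  by apply: le_trans (pr j); rewrite lerDl normc_ge0.
have r1 j : normc (fcoef (hil r) j) <= e * expR (- (rho * `|j|%:~R)).
  apply: le_trans (normc_fcoef_hil j hr) _.
  by apply: le_trans (pr j); rewrite lerDr mulr_ge0 ?absz_ge0R ?normc_ge0.
have dqb : normX_le rho (dx q) b.
  by apply: normX_le_coef qb => j; rewrite normc_fcoef_lam// normc_fcoef_dx.
have hsb : normX_le rho (hil s) b by apply: normX_le_coef sb => j; exact: normc_fcoef_hil.
have w1 := strip_wiener (strip_lam hq) qb; have w2 := strip_wiener (strip_hil hs) hsb.
have w3 := strip_wiener (strip_dx hq) dqb.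
have C f f' : fcoef (fun y => f y * f' y) k = fcoef (fun y => f' y * f y) k.
  by apply: eq_fcoef => y; rewrite mulrC.
have h1 : normc (fcoef (fun y => demean p y * lam q y) k) <= b * e * expR (- (rho * `|k|%:~R)).
  by rewrite C; apply: fcoefM_decay => //; apply: w; exact: strip_demean.
have h2 : normc (fcoef (fun y => hil r y * hil s y) k) <= b * e * expR (- (rho * `|k|%:~R)).
  by rewrite C; apply: fcoefM_decay => //; apply: w; exact: strip_hil.
have h3 : normc (fcoef (fun y => demean p y * dx q y) k) <= b * e * expR (- (rho * `|k|%:~R)).
  by rewrite C; apply: fcoefM_decay => //; apply: w; exact: strip_demean.
have := ler_wpM2l g0 h1; have := ler_wpM2l g0 h3; rewrite /bracket; lra.
Qed.
End NlinBounds.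

(** * Curves in the Wiener algebras *)

Section TimeDependence.
Variable R : realType.
Implicit Types (I : set R) (u v p r z : R -> R -> R) (s t x b e tau : R) (k : int).

(** Continuity in time with values in a Wiener algebra, in epsilon-delta form. *)
Definition cont_in I tau u : Prop :=
  (forall t, I t -> wiener tau (u t)) /\
  forall t, I t -> forall e : R, 0 < e -> exists2 d : R, 0 < d &
    forall s, I s -> `|s - t| < d -> normX_le tau (fun x => u s x - u t x) e.

Lemma cont_inP I tau u : continuous_in_X I tau u <-> cont_in I tau u.
Proof.
split=> -[h1 h2]; split.
- by move=> t It; apply/wiener_inX; exact: h1.
- move=> t It e e0; have /fine_cvgP[hf hc] := h2 t It.
  have /cvgrPdist_le/(_ _ e0) := hc; move: hf; rewrite !near_withinE.
  move=> /nbhs_ballP[d1 /= d10 hd1] /nbhs_ballP[d2 /= d20 hd2].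
  exists (Num.min d1 d2); first by rewrite lt_min d10.
  move=> s Is; rewrite lt_min => /andP[s1 s2]; apply/normX_leE.
  have /= f1 := hd1 s; have /= f2 := hd2 s.
  rewrite -ball_normE /= distrC in f1; rewrite -ball_normE /= distrC in f2.
  rewrite -(fineK (f1 s1 Is)) lee_fin; have := f2 s2 Is; rewrite sub0r normrN.
  exact: le_trans (ler_norm _).
- by move=> t It; apply/wiener_inX; exact: h1.
- move=> t It; apply/fine_cvgP; split.
    rewrite near_withinE; have [d d0 hd] := h2 t It 1 ltr01.
    apply/nbhs_ballP; exists d => //= s; rewrite -ball_normE /= distrC => sd Is.
    rewrite ge0_fin_numE ?normX_ge0//; have /normX_leE h := hd s Is sd.
    exact: le_lt_trans h (ltry _).
  apply/cvgrPdist_le => e e0; rewrite near_withinE; have [d d0 hd] := h2 t It e e0.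
  apply/nbhs_ballP; exists d => //= s; rewrite -ball_normE /= distrC => sd Is.
  rewrite sub0r normrN ger0_norm; last by apply: fine_ge0; exact: normX_ge0.
  rewrite -lee_fin fineK; first by apply/normX_leE; exact: hd.
  rewrite ge0_fin_numE ?normX_ge0//; have /normX_leE h := hd s Is sd.
  exact: le_lt_trans h (ltry _).
Qed.

Lemma time_derivativeP I u v :
  is_time_derivative I u v <-> forall x, deriv_on I (u ^~ x) (v ^~ x).
Proof.
split=> [h x|h t x It]; last by have /deriv_onP := h x; exact.
by apply/deriv_onP => t It; exact: h.
Qed.

Lemma cont_in_subset I J tau u : I `<=` J -> cont_in J tau u -> cont_in I tau u.
Proof.
move=> IJ [h1 h2]; split=> t It; first by apply: h1; exact: IJ.
move=> e e0; have [d d0 hd] := h2 t (IJ _ It) e e0.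
by exists d => // s Is; apply: hd; exact: IJ.
Qed.

Lemma normX_le_mono_width a b f c : a <= b -> normX_le b f c -> normX_le a f c.
Proof.
by move=> ab /normX_leE h; apply/normX_leE; exact: le_trans (normX_mono _ ab) h.
Qed.

Lemma cont_in_mono I a b u : a <= b -> cont_in I b u -> cont_in I a u.
Proof.
move=> ab [h1 h2]; split=> t It; first exact: wiener_mono ab (h1 t It).
move=> e e0; have [d d0 hd] := h2 t It e e0.
by exists d => // s Is sd; apply: normX_le_mono_width ab _; exact: hd.
Qed.

Lemma cont_inB I tau u v : cont_in I tau u -> cont_in I tau v ->
  cont_in I tau (fun t x => u t x - v t x).
Proof.
move=> [u1 u2] [v1 v2]; split=> t It; first by apply: wienerB; [exact: u1|exact: v1].
move=> e e0; have e2 : 0 < e / 2 by rewrite divr_gt0.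
have [d d0 hd] := u2 t It _ e2; have [d' d'0 hd'] := v2 t It _ e2.
exists (Num.min d d'); first by rewrite lt_min d0.
move=> s Is; rewrite lt_min => /andP[sd sd'].
have -> : (fun x => u s x - v s x - (u t x - v t x)) =
  (fun x => (u s x - u t x) - (v s x - v t x)) by apply/funext => x; ring.
rewrite (splitr e); apply: normXB.
- by apply: wiener_cont; exact: wienerB (u1 s Is) (u1 t It).
- by apply: wiener_cont; exact: wienerB (v1 s Is) (v1 t It).
- exact: hd.
- exact: hd'.
Qed.

(** The norm is a continuous real function of time on a compact interval. *)
Lemma cont_in_bounded T tau u : 0 <= T -> cont_in `[0, T] tau u ->
  exists M : R, forall t, `[0, T]%classic t -> normX_le tau (u t) M.
Proof.
move=> T0 [h1 h2]; pose phi t := fine (normX tau (u t)).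
have phiE t : `[0, T]%classic t -> normX_le tau (u t) (phi t).
  by move=> It; exact: wiener_normX (h1 t It).
have phi_le t b : `[0, T]%classic t -> normX_le tau (u t) b -> phi t <= b.
  move=> It /normX_leE; rewrite -lee_fin /phi fineK//.
  by rewrite ge0_fin_numE ?normX_ge0//; exact: wiener_fin (h1 t It).
have cphi : {within `[0, T], continuous phi}.
  apply/subspace_continuousP => t It; apply/cvgrPdist_le => e e0.
  rewrite near_withinE; have [d d0 hd] := h2 t It e e0.
  apply/nbhs_ballP; exists d => //= s; rewrite -ball_normE /= distrC => sd Is.
  have st := hd s Is sd; have ct := wiener_cont (h1 t It); have cs := wiener_cont (h1 s Is).
  have a1 : phi s <= phi t + e.
    apply: phi_le => //; have -> : u s = (fun x => u t x + (u s x - u t x)).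
      by apply/funext => x; ring.
    by apply: normXD => //; [exact: continuousB2|exact: phiE].
  have a2 : phi t <= phi s + e.
    apply: phi_le => //; have -> : u t = (fun x => u s x - (u s x - u t x)).
      by apply/funext => x; ring.
    by apply: normXB => //; [exact: continuousB2|exact: phiE].
  have : `|phi t - phi s| <= e by rewrite ler_distl lerBlDr a1 a2.
  exact.
have [c cI hc] := EVT_max T0 cphi; exists (phi c) => t It.
by apply: normX_le_mono (phiE t It); apply: hc.
Qed.

(** Differentiation under the integral: continuity of the velocity in norm
    bounds the difference quotients uniformly in x, by the mean value
    inequality. *)
Lemma fcoef_deriv I u v k : is_interval I -> (forall x, deriv_on I (u ^~ x) (v ^~ x)) ->
  (forall t, I t -> wiener 0 (u t)) -> cont_in I 0 v ->
  deriv_on I (fun t => Re (fcoef (u t) k)) (fun t => Re (fcoef (v t) k)) /\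
  deriv_on I (fun t => Im (fcoef (u t) k)) (fun t => Im (fcoef (v t) k)).
Proof.
move=> iI duv wu [wv cv].
have key t : I t -> forall e : R, 0 < e -> exists2 d : R, 0 < d & forall s, I s -> `|s - t| < d ->
    normc (fcoef (u s) k - fcoef (u t) k - (s - t)%:C%C * fcoef (v t) k) <= e * `|s - t|.
  move=> It e e0; have e2 : 0 < e / 2 by rewrite divr_gt0.
  have [d d0 hd] := cv t It _ e2; exists d => // s Is sd.
  have cus := wiener_cont (wu s Is); have cut := wiener_cont (wu t It).
  have cvt := wiener_cont (wv t It).
  rewrite -fcoefB// -fcoefZ// -fcoefB//; last 2 first.
  - exact: continuousB2.
  - exact: continuousZ2.
  have -> : e * `|s - t| = 2 * (e / 2 * `|s - t|) by field.
  apply: fcoef_le.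
    by apply: continuousB2; [exact: continuousB2|exact: continuousZ2].
  move=> x; pose J := [set w | I w /\ `|w - t| < d].
  have iJ : is_interval J.
    move=> a b [Ia ad] [Ib bd] c /andP[ac cb]; split; first by apply: (iI a b Ia Ib); rewrite ac.
    by move: ad bd; rewrite !ltr_norml => /andP[? ?] /andP[? ?]; apply/andP; split; lra.
  have dJ : deriv_on J (fun w => u w x - v t x * w) (fun w => v w x - v t x * 1).
    apply: deriv_onB; last by apply: deriv_onZ; exact: deriv_on_id.
    by apply: deriv_on_subset (duv x) => w [].
  have bJ w : J w -> `|v w x - v t x * 1| <= e / 2.
    move=> [Iw wd]; rewrite mulr1.
    apply: (@sup_le_normX _ (fun x => v w x - v t x)); last exact: hd.
    exact: wienerB (wv w Iw) (wv t It).
  have Jt : J t by split => //; rewrite subrr normr0.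
  have := deriv_on_lip iJ dJ bJ (conj Is sd : J s) Jt.
  by congr (`|_| <= _); ring.
split=> t It e e0; have [d d0 hd] := key t It e e0; exists d => // s Is sd.
  apply: le_trans (hd s Is sd); apply: le_trans (normc_Re _).
  by rewrite !ReB ReM /= mul0r subr0 mulrC.
apply: le_trans (hd s Is sd); apply: le_trans (normc_Im _).
by rewrite !ImB ImM /= mul0r addr0 mulrC.
Qed.

End TimeDependence.

(** * A Cauchy-Kovalevskaya uniqueness argument *)

Section CauchyKovalevskaya.
Variable R : realType.
Implicit Types (s t e tau : R) (k : int).

(* al, be and ze are the Fourier coefficients of a curve, its velocity and its
   acceleration.  W is the energy of one frequency; Wze says that the
   acceleration loses one derivative against any decay of the energies. *)
Variables (T r B M : R) (al be ze : int -> R -> R[i]).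
Let I : set R := `[0, T]%classic.
Hypothesis r0 : 0 < r.
Hypothesis M1 : 1 <= M.
Hypothesis dal : forall k, deriv_on I (fun t => Re (al k t)) (fun t => Re (be k t)) /\
                           deriv_on I (fun t => Im (al k t)) (fun t => Im (be k t)).
Hypothesis dbe : forall k, deriv_on I (fun t => Re (be k t)) (fun t => Re (ze k t)) /\
                           deriv_on I (fun t => Im (be k t)) (fun t => Im (ze k t)).
Let W k t := `|k|%:~R * normc (al k t) + normc (be k t).
Hypothesis W0 : forall k, W k 0 = 0.
Hypothesis WB : forall k t, I t -> W k t <= B * expR (- (r * `|k|%:~R)).
Hypothesis Wze : forall t rho e, I t -> 0 <= rho -> rho <= r ->
  (forall k, W k t <= e * expR (- (rho * `|k|%:~R))) ->
  forall k, normc (ze k t) <= `|k|%:~R * (M * e * expR (- (rho * `|k|%:~R))).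

(* The width decreases at speed K.  The factor 8 leaves, after the four real and
   imaginary parts have been added up, half of the bound one started from. *)
Let K := 8 * M.
Let step := r / K.

Let M0 : 0 < M. Proof. exact: lt_le_trans M1. Qed.
Let K0 : 0 < K. Proof. by rewrite mulr_gt0. Qed.
Let step0 : 0 < step. Proof. by rewrite divr_gt0. Qed.
Let W_ge0 k t : 0 <= W k t.
Proof. by rewrite addr_ge0 ?mulr_ge0 ?absz_ge0R ?normc_ge0. Qed.

(* On a time interval of length r / K the weights exp ((r - K t) |k|) shrink
   fast enough for the lost derivative to be integrated into a factor 1 / 2. *)
Let halving t0 E : I t0 -> (forall k, W k t0 = 0) ->
  (forall k t, I t -> t0 <= t -> t <= t0 + step -> W k t <= E * expR (- ((r - K * (t - t0)) * `|k|%:~R))) ->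
  (forall k t, I t -> t0 <= t -> t <= t0 + step -> W k t <= E / 2 * expR (- ((r - K * (t - t0)) * `|k|%:~R))).
Proof.
move=> It0 Wt0 hE k t It t0t tst.
have E0 : 0 <= E.
  have := le_trans (W_ge0 0 t) (hE 0 t It t0t tst).
  by rewrite normr0 mulr0 oppr0 expR0 mulr1.
pose a : R := `|k|%:~R; have a0 : 0 <= a by exact: absz_ge0R.
have sub : `[t0, t] `<=` I.
  move=> s /=; rewrite !in_itv/= => /andP[s1 s2].
  move: It0 It; rewrite /I /= !in_itv/= => /andP[? _] /andP[_ ?].
  by apply/andP; split; lra.
pose phi s := M * E / K * expR (- ((r - K * (s - t0)) * a)).
pose phi' s := M * E * a * expR (- ((r - K * (s - t0)) * a)).
have dphi : deriv_on `[t0, t] phi phi'.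
  apply: is_derive_deriv_on => s _; rewrite /phi.
  have h1 : is_derive s (1 : R) (fun s => - ((r - K * (s - t0)) * a)) (- ((0 - K *: (1 - 0)) * a)).
    by apply: is_derive_eq; rewrite /GRing.scale/=; ring.
  have h2 := @is_derive1_comp _ expR _ s _ _ (is_derive_expR _) h1.
  have h3 := @is_deriveZ _ _ _ _ (M * E / K) _ _ _ h2.
  by apply: is_derive_eq h3 _; rewrite /phi' /GRing.scale/=; field; rewrite gt_eqF.
have phi0 : 0 <= phi t0.
  apply: mulr_ge0; last exact: expR_ge0.
  by apply: divr_ge0; [apply: mulr_ge0 => //; exact: ltW|exact: ltW].
have bb s : `[t0, t]%classic s -> W k s <= E * expR (- ((r - K * (s - t0)) * a)).
  move=> st; have := st; rewrite /= in_itv/= => /andP[s1 s2].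
  by apply: hE => //; [exact: sub|lra].
have bz s : `[t0, t]%classic s -> normc (ze k s) <= phi' s.
  move=> st; have := st; rewrite /= in_itv/= => /andP[s1 s2].
  have Ks : K * (s - t0) <= r.
    rewrite mulrC -ler_pdivlMr//; rewrite /step in tst *; lra.
  have rho0 : 0 <= r - K * (s - t0) by lra.
  have rhor : r - K * (s - t0) <= r.
    by rewrite gerBl; apply: mulr_ge0; [exact: ltW|rewrite subr_ge0].
  have := Wze (sub s st) rho0 rhor (fun j => hE j s (sub s st) s1 _) k.
  have sst : s <= t0 + step by exact: le_trans s2 tst.
  rewrite -/a /phi' => h; apply: le_trans (h sst) _.
  by rewrite le_eqVlt; apply/orP; left; apply/eqP; ring.
have bb' s : `[t0, t]%classic s -> a * normc (be k s) <= phi' s.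
  move=> st; have h : normc (be k s) <= E * expR (- ((r - K * (s - t0)) * a)).
    by apply: le_trans (bb s st); rewrite lerDr mulr_ge0 ?absz_ge0R ?normc_ge0.
  apply: le_trans (ler_wpM2l a0 h) _; rewrite /phi'.
  have : 0 <= E * a * expR (- ((r - K * (s - t0)) * a)) by rewrite !mulr_ge0 ?expR_ge0.
  move=> h0; have := ler_wpM2r h0 M1; lra.
have [z1 z2] : a * normc (al k t0) = 0 /\ normc (be k t0) = 0.
  have := Wt0 k; rewrite /W -/a => h.
  have h1 : 0 <= a * normc (al k t0) by rewrite mulr_ge0 ?normc_ge0.
  have h2 := normc_ge0 (be k t0); lra.
have [rb ib] := dbe k; have [ra ia] := dal k.
have fin (f f' : R -> R) : deriv_on I f f' -> f t0 = 0 ->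
    (forall s, `[t0, t]%classic s -> `|f' s| <= phi' s) -> `|f t| <= phi t.
  move=> df f0 hf; have := deriv_on_bound t0t (deriv_on_subset sub df) dphi hf.
  by rewrite f0 subr0; lra.
have c1 : `|Re (be k t)| <= phi t.
  apply: (fin _ _ rb) => [|s st]; first by rewrite (normc_eq0 z2).
  exact: le_trans (normc_Re _) (bz s st).
have c2 : `|Im (be k t)| <= phi t.
  apply: (fin _ _ ib) => [|s st]; first by rewrite (normc_eq0 z2).
  exact: le_trans (normc_Im _) (bz s st).
have c3 : `|a * Re (al k t)| <= phi t.
  apply: (fin _ _ (deriv_onZ a ra)) => [|s st].
    apply/eqP; rewrite -normr_eq0 -normr_le0 normr_id normrM ger0_norm// -z1.
    by rewrite ler_wpM2l// normc_Re.
  rewrite normrM ger0_norm//; apply: le_trans (bb' s st); rewrite ler_wpM2l// normc_Re//.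
have c4 : `|a * Im (al k t)| <= phi t.
  apply: (fin _ _ (deriv_onZ a ia)) => [|s st].
    apply/eqP; rewrite -normr_eq0 -normr_le0 normr_id normrM ger0_norm// -z1.
    by rewrite ler_wpM2l// normc_Im.
  rewrite normrM ger0_norm//; apply: le_trans (bb' s st); rewrite ler_wpM2l// normc_Im//.
have -> : E / 2 * expR (- ((r - K * (t - t0)) * a)) = 4 * phi t.
  by rewrite /phi /K; field; rewrite gt_eqF.
rewrite /W -/a; have h1 := normc_le_ReIm (be k t).
have h2 := ler_wpM2l a0 (normc_le_ReIm (al k t)); move: c3 c4; rewrite !normrM (ger0_norm a0).
by lra.
Qed.

(* Halving the bound over and over makes it vanish on the short interval. *)
Let local t0 t k : I t0 -> (forall k, W k t0 = 0) -> I t -> t0 <= t -> t <= t0 + step -> W k t = 0.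
Proof.
move=> It0 Wt0 It t0t tst; apply: le_anti; rewrite W_ge0 andbT.
have B0 : 0 <= B.
  by have := le_trans (W_ge0 0 t) (WB 0 It); rewrite normr0 mulr0 oppr0 expR0 mulr1.
have main n : forall k t, I t -> t0 <= t -> t <= t0 + step ->
    W k t <= B * 2^-1 ^+ n * expR (- ((r - K * (t - t0)) * `|k|%:~R)).
  elim: n => [|n ih].
    move=> j s Is s1 s2; rewrite expr0 mulr1; apply: le_trans (WB j Is) _.
    rewrite ler_wpM2l// ler_expR lerN2 ler_wpM2r ?absz_ge0R// gerBl.
    by apply: mulr_ge0; [exact: ltW|rewrite subr_ge0].
  by rewrite exprSr mulrA; exact: halving.
have Kt : 0 <= r - K * (t - t0).
  by rewrite subr_ge0 mulrC -ler_pdivlMr//; rewrite /step in tst *; lra.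
apply: (@le_cvg0 _ _ (fun n => B * 2^-1 ^+ n)).
  near=> n; apply: le_trans (main n k t It t0t tst) _.
  rewrite ler_piMr ?mulr_ge0 ?exprn_ge0 ?invr_ge0// -(expR0 R) ler_expR oppr_le0 mulr_ge0 ?absz_ge0R//.
rewrite -(mulr0 B); apply: cvgM; first exact: cvg_cst.
by apply: cvg_expr; rewrite ger0_norm ?invr_ge0// invf_lt1// ltr1n.
Unshelve. all: by end_near.
Qed.

(** The length of the interval on which the energies vanish does not depend on
    its starting point, so finitely many such intervals cover [0, T].  The
    frequency zero of al has no weight in the energy and is recovered by
    integrating be. *)
Lemma ck_unique t k : I t -> al k 0 = 0 -> al k t = 0 /\ be k t = 0.
Proof.
have Wz (j : nat) s : I s -> s <= j%:R * step -> forall k, W k s = 0.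
  elim: j s => [|j ih] s Is; first rewrite mul0r => s0 i.
    have -> : s = 0 by apply: le_anti; rewrite s0; move: Is; rewrite /I /= in_itv/= => /andP[].
    exact: W0.
  move=> sj i; have [sj'|js] := leP s (j%:R * step); first exact: ih.
  have Ij : I (j%:R * step).
    move: Is; rewrite /I /= !in_itv/= => /andP[_ sT]; apply/andP; split.
      by rewrite mulr_ge0// ltW.
    by rewrite (le_trans (ltW js)).
  apply: (local (t0 := j%:R * step)) => //.
  - by apply: ih.
  - exact: ltW.
  - by rewrite -natr1 mulrDl mul1r in sj.
have WI s j : I s -> W j s = 0.
  move=> Is; apply: (Wz (Num.truncn (s / step)).+1 s Is).
  by rewrite -ler_pdivrMr// ltW// truncnS_gt.
have beI s j : I s -> be j s = 0.
  move=> /(WI s j); rewrite /W => h; apply: normc_eq0.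
  have h1 : 0 <= `|j|%:~R * normc (al j s) by rewrite mulr_ge0 ?absz_ge0R ?normc_ge0.
  have := normc_ge0 (be j s); lra.
move=> It al0; split; last exact: beI.
have [ra ia] := dal k.
have I0 : I 0 by move: It; rewrite /I /= !in_itv/= => /andP[? ?]; apply/andP; split; lra.
have iI : is_interval I by exact: interval_is_interval.
apply: complex_ext.
  have := deriv_on_lip (k := 0) iI ra _ It I0; rewrite al0 mul0r normr_le0 subr_eq0 => h.
  by apply/eqP; apply: h => s Is; rewrite beI//= normr0.
have := deriv_on_lip (k := 0) iI ia _ It I0; rewrite al0 mul0r normr_le0 subr_eq0 => h.
by apply/eqP; apply: h => s Is; rewrite beI//= normr0.
Qed.
End CauchyKovalevskaya.

(** * Uniqueness for the linearised and the nonlinear equation *)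

Section Uniqueness.
Variable R : realType.
Variable g : R.
Hypothesis g0 : 0 <= g.
Implicit Types (I : set R) (p r q s u v z : R -> R -> R) (t x b e tau T : R) (k : int).

Lemma deriv_on_eq I (f f' f'' : R -> R) : (forall t, I t -> f' t = f'' t) ->
  deriv_on I f f' -> deriv_on I f f''.
Proof.
move=> ff h t It e e0; have [d d0 hd] := h t It e e0; exists d => // y Iy yd.
by rewrite -ff//; exact: hd.
Qed.

Lemma cont_inD I tau u v : cont_in I tau u -> cont_in I tau v ->
  cont_in I tau (fun t x => u t x + v t x).
Proof.
move=> [u1 u2] [v1 v2]; split=> t It; first by apply: wienerD; [exact: u1|exact: v1].
move=> e e0; have e2 : 0 < e / 2 by rewrite divr_gt0.
have [d d0 hd] := u2 t It _ e2; have [d' d'0 hd'] := v2 t It _ e2.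
exists (Num.min d d'); first by rewrite lt_min d0.
move=> s Is; rewrite lt_min => /andP[sd sd'].
have -> : (fun x => u s x + v s x - (u t x + v t x)) =
  (fun x => (u s x - u t x) + (v s x - v t x)) by apply/funext => x; ring.
rewrite (splitr e); apply: normXD.
- by apply: wiener_cont; exact: wienerB (u1 s Is) (u1 t It).
- by apply: wiener_cont; exact: wienerB (v1 s Is) (v1 t It).
- exact: hd.
- exact: hd'.
Qed.

Lemma cont_inZ I tau a u : cont_in I tau u -> cont_in I tau (fun t x => a * u t x).
Proof.
move=> [u1 u2]; split=> t It; first by apply: wienerZ; exact: u1.
move=> e e0; have e2 : 0 < e / (`|a| + 1) by rewrite divr_gt0// ltr_wpDl.
have [d d0 hd] := u2 t It _ e2; exists d => // s Is sd.
have -> : (fun x => a * u s x - a * u t x) = (fun x => a * (u s x - u t x)).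
  by apply/funext => x; ring.
have cu : continuous (fun x => u s x - u t x).
  by apply: wiener_cont; exact: wienerB (u1 s Is) (u1 t It).
apply: normX_le_mono (normXZ a cu (hd s Is sd)).
by rewrite mulrCA ger_pMr// ler_pdivrMr ?ltr_wpDl// mul1r lerDl.
Qed.

Lemma cont_in_multiplier I sym rho tau u : symbol sym -> 0 <= rho -> rho < tau -> cont_in I tau u ->
  cont_in I rho (fun t => multiplier sym (u t)).
Proof.
move=> hs r0 rt [u1 u2]; have t0 : 0 < tau by exact: le_lt_trans rt.
split=> t It; first by apply: multiplier_wiener rt _ => //; exact: u1.
move=> e e0; pose c := 1 + (tau - rho)^-1.
have c0 : 0 < c by rewrite ltr_wpDr// invr_ge0 subr_ge0 ltW.
have ec : 0 < e / c by rewrite divr_gt0.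
have [d d0 hd] := u2 t It _ ec; exists d => // s Is sd.
have -> : (fun x => multiplier sym (u s) x - multiplier sym (u t) x) =
  multiplier sym (fun x => u s x - u t x).
  by rewrite multiplierB//; apply: wiener_strip t0 _; exact: u1.
have -> : e = c * (e / c) by rewrite mulrC divfK// gt_eqF.
by apply: (multiplier_normX hs r0 rt _ (hd s Is sd)); apply: wienerB; exact: u1.
Qed.

(** Half of the width pays for the derivatives inside the bracket, the other
    half for the one outside. *)
Lemma nlin_bound tau : 0 < tau -> exists2 C : R, 0 <= C & forall (p r q s : R -> R) (a b : R),
  wiener tau p -> wiener tau r -> wiener tau q -> wiener tau s ->
  normX_le tau p a -> normX_le tau r a -> normX_le tau q b -> normX_le tau s b ->
  normX_le 0 (nlin g p r q s) (C * (a * b)).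
Proof.
move=> t0; pose c := 1 + (tau - tau / 2)^-1.
have h2 : 0 < tau / 2 by rewrite divr_gt0.
have ht : tau / 2 < tau by rewrite ltr_pdivrMr// mulr_natr mulr2n ltrDl.
have c1 : 1 <= c by rewrite lerDl invr_ge0 subr_ge0 ltW.
have c0 : 0 <= c by exact: le_trans c1.
exists ((tau / 2 - 0)^-1 * ((2 * g + 1) * (c * c))).
  have : 0 <= 2 * g + 1 by rewrite addr_ge0// mulr_ge0.
  by move=> ?; rewrite mulr_ge0 ?invr_ge0 ?subr0 ?(ltW h2)// mulr_ge0// mulr_ge0.
move=> p r q s a b wp wr wq ws pa ra qb sb.
have sp w : wiener tau w -> strip w by exact: wiener_strip.
have lc f d : wiener tau f -> normX_le tau f d -> normX_le (tau / 2) (lam f) (c * d).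
  by move=> wf fd; exact: multiplier_normX (symbol_lambda R) (ltW h2) ht wf fd.
have rc f d : normX_le tau f d -> normX_le (tau / 2) f (c * d).
  move=> fd; apply: normX_le_mono (normX_le_mono_width (ltW ht) fd).
  by rewrite ler_peMl// (normX_bound_ge0 fd).
have := normX_nlin g0 (ltW h2) (sp _ wp) (sp _ wr) (sp _ wq) (sp _ ws) (lc _ _ wp pa) (rc _ _ ra)
  (lc _ _ wq qb) (rc _ _ sb) (lexx 0) h2.
by apply: normX_le_mono; rewrite le_eqVlt; apply/orP; left; apply/eqP; ring.
Qed.

Lemma wiener0_nlin tau (p r q s : R -> R) : 0 < tau ->
  wiener tau p -> wiener tau r -> wiener tau q -> wiener tau s -> wiener 0 (nlin g p r q s).
Proof.
move=> t0 wp wr wq ws; apply: strip_wiener0; apply: strip_nlin; exact: wiener_strip t0 _.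
Qed.

Lemma cont_in_nlin T tau p r q s : 0 <= T -> 0 < tau ->
  cont_in `[0, T] tau p -> cont_in `[0, T] tau r -> cont_in `[0, T] tau q -> cont_in `[0, T] tau s ->
  cont_in `[0, T] 0 (fun t => nlin g (p t) (r t) (q t) (s t)).
Proof.
move=> T0 t0 cp cr cq cs; have [C C0 hC] := nlin_bound t0.
have [Mp hMp] := cont_in_bounded T0 cp; have [Mr hMr] := cont_in_bounded T0 cr.
have [Mq hMq] := cont_in_bounded T0 cq; have [Ms hMs] := cont_in_bounded T0 cs.
have [wp dp] := cp; have [wr dr] := cr; have [wq dq] := cq; have [ws ds] := cs.
have Iz : `[0, T]%classic 0 by rewrite /= in_itv/= lexx T0.
have p0 := normX_bound_ge0 (hMp 0 Iz); have r0 := normX_bound_ge0 (hMr 0 Iz).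
have q0 := normX_bound_ge0 (hMq 0 Iz); have s0 := normX_bound_ge0 (hMs 0 Iz).
pose M := Mp + Mr + Mq + Ms.
have M0 : 0 <= M by rewrite !addr_ge0.
split=> t It; first exact: (wiener0_nlin t0 (wp t It) (wr t It) (wq t It) (ws t It)).
move=> e e0; have k0 : 0 < C * M * 2 + 1 by rewrite ltr_wpDl// !mulr_ge0.
have ek : 0 < e / (C * M * 2 + 1) by rewrite divr_gt0.
have [d1 d10 h1] := dp t It _ ek; have [d2 d20 h2] := dr t It _ ek.
have [d3 d30 h3] := dq t It _ ek; have [d4 d40 h4] := ds t It _ ek.
exists (Num.min (Num.min d1 d2) (Num.min d3 d4)); first by rewrite !lt_min d10 d20 d30.
move=> w Iw; rewrite !lt_min => /andP[/andP[w1 w2] /andP[w3 w4]].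
set e' := e / _ in ek h1 h2 h3 h4.
have st f : wiener tau f -> strip f by exact: wiener_strip.
pose P x := p w x - p t x; pose Q x := r w x - r t x.
pose U x := q w x - q t x; pose V x := s w x - s t x.
have wP : wiener tau P by exact: wienerB (wp w Iw) (wp t It).
have wQ : wiener tau Q by exact: wienerB (wr w Iw) (wr t It).
have wU : wiener tau U by exact: wienerB (wq w Iw) (wq t It).
have wV : wiener tau V by exact: wienerB (ws w Iw) (ws t It).
have E : (fun x => nlin g (p w) (r w) (q w) (s w) x - nlin g (p t) (r t) (q t) (s t) x) =
  (fun x => nlin g P Q (q w) (s w) x + nlin g (p t) (r t) U V x).
  have -> : nlin g (p w) (r w) (q w) (s w) =
     (fun x => nlin g (p t) (r t) (q w) (s w) x + nlin g P Q (q w) (s w) x).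
    rewrite -nlinDl; try by apply: st; first [exact: wp|exact: wr|exact: wq|exact: ws].
      by congr (nlin g _ _ _ _); apply/funext => x; rewrite /P /Q; ring.
    exact: st. exact: st.
  have -> : nlin g (p t) (r t) (q w) (s w) =
     (fun x => nlin g (p t) (r t) (q t) (s t) x + nlin g (p t) (r t) U V x).
    rewrite -nlinDr; try by apply: st; first [exact: wp|exact: wr|exact: wq|exact: ws].
      by congr (nlin g _ _ _ _); apply/funext => x; rewrite /U /V; ring.
    exact: st. exact: st.
  by apply/funext => x; ring.
have up f a b : a <= b -> normX_le tau f a -> normX_le tau f b by exact: normX_le_mono.
have n1 : normX_le 0 (nlin g P Q (q w) (s w)) (C * (e' * M)).
  apply: hC => //; [exact: wq|exact: ws|exact: h1|exact: h2| |].
    by apply: up (hMq w Iw); rewrite /M; lra.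
  by apply: up (hMs w Iw); rewrite /M; lra.
have n2 : normX_le 0 (nlin g (p t) (r t) U V) (C * (M * e')).
  apply: hC => //; [exact: wp|exact: wr| | |exact: h3|exact: h4].
    by apply: up (hMp t It); rewrite /M; lra.
  by apply: up (hMr t It); rewrite /M; lra.
rewrite E; apply: (@normX_le_mono _ _ _ (C * (e' * M) + C * (M * e'))).
  have -> : C * (e' * M) + C * (M * e') = (C * M * 2) * e' by ring.
  have -> : e = (C * M * 2 + 1) * e' by rewrite /e' mulrC divfK// gt_eqF.
  by rewrite ler_wpM2r ?(ltW ek)// lerDl.
apply: normXD => //; apply: wiener_cont.
  exact: (wiener0_nlin t0 wP wQ (wq w Iw) (ws w Iw)).
exact: (wiener0_nlin t0 (wp t It) (wr t It) wU wV).
Qed.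

(** Membership in X_tau gives the exponential decay of the energies that the
    Cauchy-Kovalevskaya argument starts from; half of the width is given up for
    the factor |k| in front of the displacement. *)
Lemma loss_unique T tau p r z M : 0 <= T -> 0 < tau -> 1 <= M ->
  cont_in `[0, T] tau p -> cont_in `[0, T] tau r -> cont_in `[0, T] 0 z ->
  (forall x, deriv_on `[0, T] (p ^~ x) (r ^~ x)) ->
  (forall x, deriv_on `[0, T] (r ^~ x) (z ^~ x)) ->
  (forall x, p 0 x = 0) -> (forall x, r 0 x = 0) ->
  (forall t rho e, `[0, T]%classic t -> 0 <= rho -> rho <= tau / 2 ->
    (forall k, `|k|%:~R * normc (fcoef (p t) k) + normc (fcoef (r t) k) <=
       e * expR (- (rho * `|k|%:~R))) ->
    forall k, normc (fcoef (z t) k) <= `|k|%:~R * (M * e * expR (- (rho * `|k|%:~R)))) ->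
  forall t x, `[0, T]%classic t -> p t x = 0 /\ r t x = 0.
Proof.
move=> T0 t0 M1 cp cr cz dpr drz p0 r0 H.
have h2 : 0 < tau / 2 by rewrite divr_gt0.
have iI : is_interval `[0, T]%classic by exact: interval_is_interval.
have [wp _] := cp; have [wr _] := cr.
have w0p t : `[0, T]%classic t -> wiener 0 (p t) by move=> It; exact: wiener_mono (ltW t0) (wp t It).
have w0r t : `[0, T]%classic t -> wiener 0 (r t) by move=> It; exact: wiener_mono (ltW t0) (wr t It).
have dal k := fcoef_deriv k iI dpr w0p (cont_in_mono (ltW t0) cr).
have dbe k := fcoef_deriv k iI drz w0r cz.
have [Mp hMp] := cont_in_bounded T0 cp; have [Mr hMr] := cont_in_bounded T0 cr.
have z0 (f : R -> R) k : (forall x, f x = 0) -> fcoef f k = 0.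
  by move=> f0; rewrite -(fcoef0 R k); apply: eq_fcoef.
pose B := (tau / 2)^-1 * Mp + Mr.
have WB k t : `[0, T]%classic t ->
    `|k|%:~R * normc (fcoef (p t) k) + normc (fcoef (r t) k) <= B * expR (- (tau / 2 * `|k|%:~R)).
  move=> It; have := normX_wcoef_le k (hMp t It); have := normX_wcoef_le k (hMr t It).
  rewrite /wcoef; set a : R := `|k|%:~R; have a0 : 0 <= a by exact: absz_ge0R.
  set P := normc (fcoef (p t) k); set Q := normc (fcoef (r t) k) => hQ hP.
  have E2 : expR (tau * a) = expR (tau / 2 * a) * expR (tau / 2 * a).
    by rewrite -expRD; congr expR; field.
  have ee : expR (tau / 2 * a) * expR (- (tau / 2 * a)) = 1 by exact: expRxMexpNx_1.
  set E := expR (tau / 2 * a) in E2 ee; set F := expR (- _) in ee *.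
  have E1 : 1 <= E by rewrite -(expR0 R) ler_expR mulr_ge0// ltW.
  have F0 : 0 <= F by exact: expR_ge0.
  have P0 : 0 <= P by exact: normc_ge0.
  have Q0 : 0 <= Q by exact: normc_ge0.
  rewrite E2 in hP hQ; rewrite /B mulrDl; apply: lerD.
    have h : a <= (tau / 2)^-1 * E by exact: expR_absorb.
    apply: le_trans (ler_wpM2r P0 h) _.
    have -> : (tau / 2)^-1 * E * P = (tau / 2)^-1 * (E * E * P) * F.
      transitivity ((tau / 2)^-1 * E * P * (E * F)); last by ring.
      by rewrite ee mulr1.
    by apply: ler_wpM2r => //; apply: ler_wpM2l => //; rewrite invr_ge0 ltW.
  have -> : Q = (E * Q) * F by rewrite mulrAC ee mul1r.
  apply: ler_wpM2r => //; apply: le_trans hQ; rewrite -mulrA ler_peMl//.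
  by rewrite mulr_ge0// (le_trans _ E1).
move=> t x It.
have main k : fcoef (p t) k = 0 /\ fcoef (r t) k = 0.
  apply: (@ck_unique R T (tau / 2) B M (fun k t => fcoef (p t) k) (fun k t => fcoef (r t) k)
    (fun k t => fcoef (z t) k)) => //.
  - by move=> j; rewrite !z0// normc0 mulr0 addr0.
  - by rewrite z0.
have st := wiener_strip t0; have h0 := @strip_cst R 0.
have E f : wiener tau f -> (forall k, fcoef f k = 0) -> f = (fun=> 0).
  by move=> wf f0; apply: strip_ext => //; [exact: st|move=> k; rewrite f0 fcoef0].
have Ep := E _ (wp t It) (fun k => (main k).1); have Er := E _ (wr t It) (fun k => (main k).2).
by rewrite Ep Er.
Qed.

Lemma normc_fcoef_linear f k (c e rho : R) : strip f -> 0 <= c ->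
  `|k|%:~R * normc (fcoef f k) <= e * expR (- (rho * `|k|%:~R)) ->
  normc (fcoef (fun x => (- c) * lam f x) k) <= `|k|%:~R * (c * e * expR (- (rho * `|k|%:~R))).
Proof.
move=> hf c0 h; rewrite fcoefZ; last by apply: strip_cont; exact: strip_lam.
rewrite normcM normcR normrN ger0_norm// normc_fcoef_lam//.
have [->|k0] := eqVneq k 0; first by rewrite normr0 !mul0r mulr0.
have k1 : 1 <= `|k|%:~R :> R by rewrite (_ : 1 = 1%:~R :> R)// ler_int -gtz0_ge1 normr_gt0.
rewrite mulrCA ler_wpM2l ?absz_ge0R// -mulrA ler_wpM2l//; apply: le_trans h.
by rewrite ler_peMl ?normc_ge0.
Qed.

(** The difference of two candidates for the k-th Stokes coefficient solves
    this homogeneous problem when the lower coefficients agree. *)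
Lemma linear_unique T tau p r : 0 <= T -> 0 < tau ->
  cont_in `[0, T] tau p -> cont_in `[0, T] tau r ->
  (forall x, deriv_on `[0, T] (p ^~ x) (r ^~ x)) ->
  (forall x, deriv_on `[0, T] (r ^~ x) (fun t => (- g) * lam (p t) x)) ->
  (forall x, p 0 x = 0) -> (forall x, r 0 x = 0) ->
  forall t x, `[0, T]%classic t -> p t x = 0 /\ r t x = 0.
Proof.
move=> T0 t0 cp cr dpr drz p0 r0.
apply: (@loss_unique T tau p r (fun t x => (- g) * lam (p t) x) (1 + g)) => //.
- by rewrite lerDl.
- by apply: cont_inZ; exact: cont_in_multiplier (symbol_lambda R) (lexx 0) t0 cp.
move=> t rho e It rho0 _ h k.
have e0 : 0 <= e * expR (- (rho * `|k|%:~R)).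
  by apply: le_trans (h k); rewrite addr_ge0 ?mulr_ge0 ?absz_ge0R ?normc_ge0.
have hp : strip (p t) by apply: (wiener_strip t0); exact: cp.1.
apply: le_trans (normc_fcoef_linear hp g0 (le_trans _ (h k))) _.
  by rewrite lerDl normc_ge0.
rewrite ler_wpM2l ?absz_ge0R// -!mulrA ler_wpM2r// lerDr//.
Qed.

(** By bilinearity the difference of the two quadratic terms is
    N(p, h) + N(h', p), with p the difference of the solutions: a linear
    equation for p whose coefficients are bounded on [0, T]. *)
Lemma model_unique T tau h ht htt h' ht' htt' : 0 <= T -> 0 < tau ->
  cont_in `[0, T] tau h -> cont_in `[0, T] tau ht ->
  cont_in `[0, T] tau h' -> cont_in `[0, T] tau ht' ->
  (forall x, deriv_on `[0, T] (h ^~ x) (ht ^~ x)) ->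
  (forall x, deriv_on `[0, T] (ht ^~ x) (htt ^~ x)) ->
  (forall x, deriv_on `[0, T] (h' ^~ x) (ht' ^~ x)) ->
  (forall x, deriv_on `[0, T] (ht' ^~ x) (htt' ^~ x)) ->
  (forall t x, `[0, T]%classic t ->
     htt t x = - g * lam (h t) x + nlin g (h t) (ht t) (h t) (ht t) x) ->
  (forall t x, `[0, T]%classic t ->
     htt' t x = - g * lam (h' t) x + nlin g (h' t) (ht' t) (h' t) (ht' t) x) ->
  (forall x, h 0 x = h' 0 x) -> (forall x, ht 0 x = ht' 0 x) ->
  forall t x, `[0, T]%classic t -> h t x = h' t x.
Proof.
move=> T0 t0 ch cht ch' cht' dh dht dh' dht' Eh Eh' i0 i1 t x It.
pose p t x := h t x - h' t x; pose r t x := ht t x - ht' t x.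
pose z t x := - g * lam (p t) x + (nlin g (p t) (r t) (h t) (ht t) x + nlin g (h' t) (ht' t) (p t) (r t) x).
have cp : cont_in `[0, T] tau p by exact: cont_inB.
have cr : cont_in `[0, T] tau r by exact: cont_inB.
have st f : wiener tau f -> strip f by exact: wiener_strip.
have h2 : 0 < tau / 2 by rewrite divr_gt0.
have htau : tau / 2 < tau by rewrite ltr_pdivrMr// mulr_natr mulr2n ltrDl.
have sl := symbol_lambda R.
have [A hA] := cont_in_bounded T0 (cont_in_multiplier sl (ltW h2) htau ch).
have [B hB] := cont_in_bounded T0 (cont_in_mono (ltW htau) cht).
have [A' hA'] := cont_in_bounded T0 (cont_in_multiplier sl (ltW h2) htau ch').
have [B' hB'] := cont_in_bounded T0 (cont_in_mono (ltW htau) cht').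
have A0 := normX_bound_ge0 (hA t It); have B0 := normX_bound_ge0 (hB t It).
have A0' := normX_bound_ge0 (hA' t It); have B0' := normX_bound_ge0 (hB' t It).
pose M := A + B + A' + B'.
have zE y : deriv_on `[0, T] (r ^~ y) (z ^~ y).
  apply: deriv_on_eq (deriv_onB (dht y) (dht' y)) => s Is.
  rewrite Eh// Eh'//.
  have sh := st _ (ch.1 s Is); have sht := st _ (cht.1 s Is).
  have sh' := st _ (ch'.1 s Is); have sht' := st _ (cht'.1 s Is).
  have sp := st _ (cp.1 s Is); have sr := st _ (cr.1 s Is).
  have E1 : h s = (fun x => p s x + h' s x) by apply/funext => w; rewrite /p subrK.
  have E2 : ht s = (fun x => r s x + ht' s x) by apply/funext => w; rewrite /r subrK.
  have e1 : nlin g (h s) (ht s) (h s) (ht s) =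
    (fun x => nlin g (p s) (r s) (h s) (ht s) x + nlin g (h' s) (ht' s) (h s) (ht s) x).
    by rewrite -nlinDl// -E1 -E2.
  have e2 : nlin g (h' s) (ht' s) (h s) (ht s) =
    (fun x => nlin g (h' s) (ht' s) (p s) (r s) x + nlin g (h' s) (ht' s) (h' s) (ht' s) x).
    by rewrite -nlinDr// -E1 -E2.
  have e3 : lam (h s) = (fun x => lam (p s) x + lam (h' s) x).
    by rewrite /lam -multiplierD// -E1.
  by rewrite /z e1 e2 e3; ring.
have [||||||+ _] := @loss_unique T tau p r z (1 + g + 2 * ((2 * g + 1) * M)) T0 t0 _ cp cr _ _ zE _ _ _ t x It.
- have : 0 <= (2 * g + 1) * M by rewrite mulr_ge0 ?addr_ge0// mulr_ge0.
  by move=> hm; rewrite -addrA lerDl; apply: addr_ge0 => //; apply: mulr_ge0.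
- apply: cont_inD.
    by apply: cont_inZ; exact: cont_in_multiplier sl (lexx 0) t0 cp.
  by apply: cont_inD; [exact: (cont_in_nlin T0 t0 cp cr ch cht)|exact: (cont_in_nlin T0 t0 ch' cht' cp cr)].
- by move=> y; exact: deriv_onB.
- by move=> y; rewrite /p i0 subrr.
- by move=> y; rewrite /r i1 subrr.
- move=> s rho e Is rho0 rhot hW k.
  have e0 : 0 <= e * expR (- (rho * `|k|%:~R)).
    by apply: le_trans (hW k); rewrite addr_ge0 ?mulr_ge0 ?absz_ge0R ?normc_ge0.
  have sh := st _ (ch.1 s Is); have sht := st _ (cht.1 s Is).
  have sh' := st _ (ch'.1 s Is); have sht' := st _ (cht'.1 s Is).
  have sp := st _ (cp.1 s Is); have sr := st _ (cr.1 s Is).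
  have up f a b : a <= b -> normX_le (tau / 2) f a -> normX_le rho f b.
    by move=> ab /(normX_le_mono_width rhot); exact: normX_le_mono.
  have n1 := nlin_decayl g0 k rho0 sp sr sh sht
    (up _ _ M _ (hA s Is)) (up _ _ M _ (hB s Is)) hW.
  have n2 := nlin_decayr g0 k rho0 sh' sht' sp sr
    (up _ _ M _ (hA' s Is)) (up _ _ M _ (hB' s Is)) hW.
  have n3 := normc_fcoef_linear sp g0 (le_trans _ (hW k)).
  have w1 := strip_cont (strip_nlin g sp sr sh sht).
  have w2 := strip_cont (strip_nlin g sh' sht' sp sr).
  have w3 := strip_cont (strip_lam sp).
  rewrite /z fcoefD; [|exact: continuousZ2|exact: continuousD2].
  apply: le_trans (normcD _ _) _; rewrite fcoefD//.
  apply: le_trans (lerD (lexx _) (normcD _ _)) _.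
  have M1 : A <= M /\ B <= M by rewrite /M; split; lra.
  have M2 : A' <= M /\ B' <= M by rewrite /M; split; lra.
  have {}n1 := n1 M1.1 M1.2; have {}n2 := n2 M2.1 M2.2.
  have {}n3 : normc (fcoef (fun x => - g * lam (p s) x) k) <=
     `|k|%:~R * (g * e * expR (- (rho * `|k|%:~R))).
    by apply: n3; rewrite lerDl normc_ge0.
  apply: le_trans (lerD n3 (lerD n1 n2)) _.
  rewrite -!mulrDr ler_wpM2l ?absz_ge0R//.
  set X := expR _ in e0 *.
  have -> : (1 + g + 2 * ((2 * g + 1) * M)) * e * X =
    (1 + g + 2 * ((2 * g + 1) * M)) * (e * X) by ring.
  apply: (@le_trans _ _ ((g + 2 * ((2 * g + 1) * M)) * (e * X))).
    by rewrite le_eqVlt; apply/orP; left; apply/eqP; ring.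
  by rewrite ler_wpM2r// lerD2r lerDr.
- by move=> /eqP; rewrite subr_eq0 => /eqP.
Qed.
End Uniqueness.

(** * Cauchy products *)

Lemma sum_triangle (V : nmodType) (F : nat -> nat -> V) N :
  \sum_(n < N) \sum_(i < n.+1) F i (n - i)%N = \sum_(i < N) \sum_(j < N - i) F i j.
Proof.
elim: N => [|N ih]; first by rewrite !big_ord0.
rewrite big_ord_recr [RHS]big_ord_recr /= ih subSnn big_ord1 big_ord_recr /= subnn addrA.
congr (_ + _); rewrite -big_split /=; apply: eq_bigr => i _.
by rewrite subSn 1?ltnW// big_ord_recr.
Qed.

Section Cauchy.
Variable R : realType.
Implicit Types (M : nat -> R) (x : R) (N n : nat).

Lemma sum_split_ord (F : nat -> R) n m : (n <= m)%N ->
  \sum_(k < m) F k = \sum_(k < n) F k + \sum_(k < m - n) F (n + k)%N.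
Proof. by move=> nm; rewrite -(sum_ord_diff F nm) addrC subrK. Qed.

Lemma sum_ge0_mono (F : nat -> R) n m : (forall i, 0 <= F i) -> (n <= m)%N ->
  \sum_(k < n) F k <= \sum_(k < m) F k.
Proof. by move=> F0 nm; rewrite (sum_split_ord F nm) lerDl sumr_ge0. Qed.

Lemma triangle_le_square (F : nat -> nat -> R) N : (forall i j, 0 <= F i j) ->
  \sum_(n < N) \sum_(i < n.+1) F i (n - i)%N <= \sum_(i < N) \sum_(j < N) F i j.
Proof.
move=> F0; rewrite sum_triangle; apply: ler_sum => i _.
by apply: sum_ge0_mono => //; exact: leq_subr.
Qed.

(** The triangle i + j < 2 N contains the square i, j < N, so partial sums over
    triangles and over squares have the same limit. *)
Lemma triangle_cvg M M' : (forall n, 0 <= M n) -> (forall n, 0 <= M' n) ->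
  cvgn (series M) -> cvgn (series M') ->
  cvgn (series (fun n => \sum_(i < n.+1) M i * M' (n - i)%N)) /\
  (\sum_(i < N) \sum_(j < N) M i * M' j -
    \sum_(n < N) \sum_(i < n.+1) M i * M' (n - i)%N) @[N --> \oo] --> (0 : R).
Proof.
move=> M0 M0' cM cM'; pose F i j := M i * M' j.
have F0 i j : 0 <= F i j by exact: mulr_ge0.
pose K n := \sum_(i < n.+1) M i * M' (n - i)%N.
have K0 n : 0 <= K n by apply: sumr_ge0 => i _; exact: mulr_ge0.
have sE (G : nat -> R) N : series G N = \sum_(i < N) G i by rewrite /series /= big_mkord.
have sq N : \sum_(i < N) \sum_(j < N) F i j = series M N * series M' N.
  by rewrite !sE big_distrlr.
have up N : series K N <= series M N * series M' N.
  by rewrite -sq sE; exact: triangle_le_square F0.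
have lo N : series M N * series M' N <= series K (N + N)%N.
  rewrite -sq sE /K (sum_triangle F) (@sum_split_ord (fun i => \sum_(j < N + N - i) F i j) N) ?leq_addr//.
  apply: ler_wpDr; first by apply: sumr_ge0 => i _; apply: sumr_ge0 => j _.
  apply: ler_sum => i _; apply: sum_ge0_mono => //.
  by rewrite -addnBA ?leq_addr// ltnW.
have cMM : series M N * series M' N @[N --> \oo] --> limn (series M) * limn (series M').
  exact: cvgM.
have le N : series M N * series M' N <= limn (series M) * limn (series M').
  have m (G : nat -> R) : (forall n, 0 <= G n) -> cvgn (series G) -> 0 <= series G N <= limn (series G).
    move=> G0 cG; rewrite sE sumr_ge0//= -sE; apply: nondecreasing_cvgn_le => //.
    by apply: nondecreasing_series => k _ _.
  have /andP[a b] := m _ M0 cM; have /andP[c d] := m _ M0' cM'.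
  exact: ler_pM.
have cK : cvgn (series K).
  apply: nondecreasing_is_cvgn; first by apply: nondecreasing_series => k _ _.
  exists (limn (series M) * limn (series M')) => _ [n _ <-].
  exact: le_trans (up n) (le n).
split=> //.
have E : limn (series K) = limn (series M) * limn (series M').
  apply: le_anti; apply/andP; split.
    by apply: limr_le => //; apply: nearW => N; exact: le_trans (up N) (le N).
  have -> : limn (series M) * limn (series M') = lim (series M N * series M' N @[N --> \oo]).
    by apply/esym; apply: cvg_lim.
  apply: limr_le; first by apply/cvg_ex; eexists; exact: cMM.
  apply: nearW => N; apply: le_trans (lo N) _.
  by apply: nondecreasing_cvgn_le => //; apply: nondecreasing_series => k _ _.
have -> : (fun N => \sum_(i < N) \sum_(j < N) M i * M' j - \sum_(n < N) \sum_(i < n.+1) M i * M' (n - i)%N)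
   = (fun N => series M N * series M' N - series K N).
  by apply/funext => N; rewrite -sq sE.
rewrite -(subrr (limn (series K))) {1}E; apply: cvgB => //.
Qed.
End Cauchy.

Section NlinSeries.
Variable R : realType.
Variable g : R.
Hypothesis g0 : 0 <= g.
Variables (tau : R) (p r q s : nat -> R -> R) (M M' : nat -> R).
Hypothesis t0 : 0 < tau.
Hypotheses (wp : forall n, wiener tau (p n)) (wr : forall n, wiener tau (r n)).
Hypotheses (wq : forall n, wiener tau (q n)) (ws : forall n, wiener tau (s n)).
Hypotheses (pM : forall n, normX_le tau (p n) (M n)) (rM : forall n, normX_le tau (r n) (M n)).
Hypotheses (qM : forall n, normX_le tau (q n) (M' n)) (sM : forall n, normX_le tau (s n) (M' n)).
Hypotheses (cM : cvgn (series M)) (cM' : cvgn (series M')).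

Let st f : wiener tau f -> strip f := @wiener_strip R tau f t0.
Let M0 n : 0 <= M n := normX_bound_ge0 (pM n).
Let M0' n : 0 <= M' n := normX_bound_ge0 (qM n).
Let F i j x := nlin g (p i) (r i) (q j) (s j) x.

Lemma nlin_suml N f h : strip f -> strip h ->
  nlin g (fun x => \sum_(i < N) p i x) (fun x => \sum_(i < N) r i x) f h =
  (fun x => \sum_(i < N) nlin g (p i) (r i) f h x).
Proof.
move=> sf sh; elim: N => [|N ih].
  rewrite (_ : (fun x => \sum_(i < 0) p i x) = (fun=> 0)); last by apply/funext => x; rewrite big_ord0.
  rewrite (_ : (fun x => \sum_(i < 0) r i x) = (fun=> 0)); last by apply/funext => x; rewrite big_ord0.
  by rewrite nlin_cst//; apply/funext => x; rewrite big_ord0.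
rewrite (_ : (fun x => \sum_(i < N.+1) p i x) = (fun x => \sum_(i < N) p i x + p N x)); last first.
  by apply/funext => x; rewrite big_ord_recr.
rewrite (_ : (fun x => \sum_(i < N.+1) r i x) = (fun x => \sum_(i < N) r i x + r N x)); last first.
  by apply/funext => x; rewrite big_ord_recr.
rewrite nlinDl//; [|exact: st (normX_sum N wp pM).1|exact: st (wp N)|
  exact: st (normX_sum N wr rM).1|exact: st (wr N)].
by rewrite ih; apply/funext => x; rewrite big_ord_recr.
Qed.

Lemma nlin_sumr N f h : strip f -> strip h ->
  nlin g f h (fun x => \sum_(i < N) q i x) (fun x => \sum_(i < N) s i x) =
  (fun x => \sum_(i < N) nlin g f h (q i) (s i) x).
Proof.
move=> sf sh; elim: N => [|N ih].
  have E (u : nat -> R -> R) : (fun x => \sum_(i < 0) u i x) = (fun x => 0 * (fun=> 0) x).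
    by apply/funext => x; rewrite big_ord0 mul0r.
  have Ef (u : R -> R) : u = (fun x => 1 * u x) by apply/funext => x; rewrite mul1r.
  rewrite !E (Ef f) (Ef h) nlinZ//; try exact: strip_cst.
  by apply/funext => x; rewrite mulr0 mul0r big_ord0.
rewrite (_ : (fun x => \sum_(i < N.+1) q i x) = (fun x => \sum_(i < N) q i x + q N x)); last first.
  by apply/funext => x; rewrite big_ord_recr.
rewrite (_ : (fun x => \sum_(i < N.+1) s i x) = (fun x => \sum_(i < N) s i x + s N x)); last first.
  by apply/funext => x; rewrite big_ord_recr.
rewrite nlinDr//; [|exact: st (normX_sum N wq qM).1|exact: st (wq N)|
  exact: st (normX_sum N ws sM).1|exact: st (ws N)].
by rewrite ih; apply/funext => x; rewrite big_ord_recr.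
Qed.

Lemma nlin_le (f h u v : R -> R) C a b x :
  (forall (p r q s : R -> R) (a b : R),
  wiener tau p -> wiener tau r -> wiener tau q -> wiener tau s ->
  normX_le tau p a -> normX_le tau r a -> normX_le tau q b -> normX_le tau s b ->
  normX_le 0 (nlin g p r q s) (C * (a * b))) ->
  wiener tau f -> wiener tau h -> wiener tau u -> wiener tau v ->
  normX_le tau f a -> normX_le tau h a -> normX_le tau u b -> normX_le tau v b ->
  `|nlin g f h u v x| <= C * (a * b).
Proof.
move=> hC wf wh wu wv fa ha ub vb.
apply: (@sup_le_normX _ (nlin g f h u v)); first exact: wiener0_nlin t0 wf wh wu wv.
exact: hC.
Qed.

(** Expanding both arguments gives a sum over squares, by bilinearity and
    boundedness; it differs from the sum over triangles by what the norms lose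
    there, which tends to zero. *)
Lemma nlin_ssum x :
  \sum_(n < N) \sum_(i < n.+1) nlin g (p i) (r i) (q (n - i)%N) (s (n - i)%N) x @[N --> \oo] -->
  nlin g (ssum p) (ssum r) (ssum q) (ssum s) x.
Proof.
have [C C0 hC] := nlin_bound g0 t0.
have t0' := ltW t0.
have w1 N : wiener tau (fun x => \sum_(i < N) p i x) := (normX_sum N wp pM).1.
have w2 N : wiener tau (fun x => \sum_(i < N) r i x) := (normX_sum N wr rM).1.
have w3 N : wiener tau (fun x => \sum_(i < N) q i x) := (normX_sum N wq qM).1.
have w4 N : wiener tau (fun x => \sum_(i < N) s i x) := (normX_sum N ws sM).1.
have m1 N : normX_le tau (fun x => \sum_(i < N) p i x) (limn (series M)).
  apply: normX_le_mono (normX_sum N wp pM).2.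
  have -> : \sum_(i < N) M i = series M N by rewrite /series /= big_mkord.
  by apply: nondecreasing_cvgn_le => //; apply: nondecreasing_series => k _ _.
have m2 N : normX_le tau (fun x => \sum_(i < N) r i x) (limn (series M)).
  apply: normX_le_mono (normX_sum N wr rM).2.
  have -> : \sum_(i < N) M i = series M N by rewrite /series /= big_mkord.
  by apply: nondecreasing_cvgn_le => //; apply: nondecreasing_series => k _ _.
have s1 := wiener_ssum t0' wp pM cM; have s2 := wiener_ssum t0' wr rM cM.
have s3 := wiener_ssum t0' wq qM cM'; have s4 := wiener_ssum t0' ws sM cM'.
have n3 := normX_ssum t0' wq qM cM'; have n4 := normX_ssum t0' ws sM cM'.
pose L := limn (series M); pose L' := limn (series M').
pose d N := \sum_(i < N) \sum_(j < N) M i * M' j - \sum_(n < N) \sum_(i < n.+1) M i * M' (n - i)%N.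
have [_ dN] := triangle_cvg M0 M0' cM cM'.
have sq N : nlin g (fun x => \sum_(i < N) p i x) (fun x => \sum_(i < N) r i x)
    (fun x => \sum_(i < N) q i x) (fun x => \sum_(i < N) s i x) x = \sum_(i < N) \sum_(j < N) F i j x.
  rewrite nlin_suml; [|exact: st (w3 N)|exact: st (w4 N)]; apply: eq_bigr => i _.
  by rewrite nlin_sumr; [|exact: st (wp i)|exact: st (wr i)].
have e1 N : `|\sum_(i < N) \sum_(j < N) F i j x -
   \sum_(n < N) \sum_(i < n.+1) F i (n - i)%N x| <= C * d N.
  rewrite /d !(sum_triangle (fun i j => F i j x)) (sum_triangle (fun i j => M i * M' j)).
  rewrite -!sumrB mulr_sumr; apply: le_trans (ler_norm_sum _ _ _) _; apply: ler_sum => i _.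
  rewrite (sum_ord_diff (fun j => F i j x)) ?leq_subr// (sum_ord_diff (fun j => M i * M' j)) ?leq_subr//.
  rewrite mulr_sumr; apply: le_trans (ler_norm_sum _ _ _) _; apply: ler_sum => j _.
  exact: nlin_le hC (wp i) (wr i) (wq _) (ws _) (pM i) (rM i) (qM _) (sM _).
have e2 N : `|nlin g (ssum p) (ssum r) (ssum q) (ssum s) x - \sum_(i < N) \sum_(j < N) F i j x| <=
   C * (tail M N * L') + C * (L * tail M' N).
  rewrite -sq.
  have b1 : wiener tau (fun x => ssum p x - \sum_(i < N) p i x) by exact: wienerB.
  have b2 : wiener tau (fun x => ssum r x - \sum_(i < N) r i x) by exact: wienerB.
  have b3 : wiener tau (fun x => ssum q x - \sum_(i < N) q i x) by exact: wienerB.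
  have b4 : wiener tau (fun x => ssum s x - \sum_(i < N) s i x) by exact: wienerB.
  have E (u : nat -> R -> R) : ssum u = (fun x => \sum_(i < N) u i x + (ssum u x - \sum_(i < N) u i x)).
    by apply/funext => y; rewrite addrC subrK.
  have -> : nlin g (ssum p) (ssum r) (ssum q) (ssum s) x -
    nlin g (fun x => \sum_(i < N) p i x) (fun x => \sum_(i < N) r i x)
    (fun x => \sum_(i < N) q i x) (fun x => \sum_(i < N) s i x) x =
    nlin g (fun x => ssum p x - \sum_(i < N) p i x) (fun x => ssum r x - \sum_(i < N) r i x) (ssum q) (ssum s) x
    + nlin g (fun x => \sum_(i < N) p i x) (fun x => \sum_(i < N) r i x)
    (fun x => ssum q x - \sum_(i < N) q i x) (fun x => ssum s x - \sum_(i < N) s i x) x.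
    have h1 := nlinDl g (st (w1 N)) (st b1) (st (w2 N)) (st b2) (st s3) (st s4).
    have h2 := nlinDr g (st (w1 N)) (st (w2 N)) (st (w3 N)) (st b3) (st (w4 N)) (st b4).
    rewrite -(E p) -(E r) in h1; rewrite -(E q) -(E s) in h2.
    by rewrite h1 h2; ring.
  apply: le_trans (ler_normD _ _) _; apply: lerD.
    exact: nlin_le hC b1 b2 s3 s4 (normX_ssum_tail t0' wp pM cM N)
      (normX_ssum_tail t0' wr rM cM N) n3 n4.
  exact: nlin_le hC (w1 N) (w2 N) b3 b4 (m1 N) (m2 N) (normX_ssum_tail t0' wq qM cM' N)
     (normX_ssum_tail t0' ws sM cM' N).
apply/cvgrPdist_le => e e0.
have lim : (C * (tail M N * L') + C * (L * tail M' N) + C * d N) @[N --> \oo] --> (0 : R).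
  have z : C * (0 * L') + C * (L * 0) + C * 0 = 0 :> R by ring.
  rewrite -[X in _ --> X]z; apply: cvgD; last by apply: cvgM => //; exact: cvg_cst.
  apply: cvgD; apply: cvgM; try exact: cvg_cst.
    by apply: cvgM; [exact: tail_cvg|exact: cvg_cst].
  by apply: cvgM; [exact: cvg_cst|exact: tail_cvg].
have /cvgrPdist_le/(_ _ e0) := lim; apply: filterS => N.
rewrite sub0r normrN => /(le_trans (ler_norm _)); apply: le_trans.
have -> : nlin g (ssum p) (ssum r) (ssum q) (ssum s) x - \sum_(n < N) \sum_(i < n.+1) F i (n - i)%N x =
  (nlin g (ssum p) (ssum r) (ssum q) (ssum s) x - \sum_(i < N) \sum_(j < N) F i j x) +
  (\sum_(i < N) \sum_(j < N) F i j x - \sum_(n < N) \sum_(i < n.+1) F i (n - i)%N x) by ring.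
by apply: le_trans (ler_normD _ _) _; apply: lerD; [exact: e2|exact: e1].
Qed.
End NlinSeries.

(** * Series of curves and power series in time *)

Section ContinuousSeries.
Variable R : realType.
Implicit Types (I : set R) (u v : R -> R -> R) (t x b e tau T : R).

(** The tails are small uniformly in time and the partial sums are continuous. *)
Lemma cont_in_ssum I tau (u : nat -> R -> R -> R) (M : nat -> R) : 0 <= tau ->
  (forall n, cont_in I tau (u n)) -> (forall n t, I t -> normX_le tau (u n t) (M n)) ->
  cvgn (series M) -> cont_in I tau (fun t => ssum (fun n => u n t)).
Proof.
move=> t0 cu uM cM.
have wu t (It : I t) n : wiener tau (u n t) := (cu n).1 t It.
have bu t (It : I t) n : normX_le tau (u n t) (M n) := uM n t It.
have ws t (It : I t) := wiener_ssum t0 (wu t It) (bu t It) cM.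
split=> [t It|t It e e0]; first exact: ws.
have e3 : 0 < e / 3 by rewrite divr_gt0.
have [N _ /(_ N (leqnn N)) hN] := tail_near cM e3.
have cs : cont_in I tau (fun t x => \sum_(k < N) u k t x).
  elim: (N) => [|n ih].
    split=> s Is; first by rewrite (_ : (fun _ => _) = (fun=> 0));
      [exact: wiener_cst|apply/funext => x; rewrite big_ord0].
    move=> e' e0'; exists 1 => // s' _ _.
    rewrite (_ : (fun _ => _) = (fun=> 0)); last by apply/funext => x; rewrite !big_ord0 subrr.
    by apply: normX_le_mono (ltW e0') _; rewrite -[X in normX_le _ _ X](@normr0 _ R); exact: normX_cst.
  rewrite (_ : (fun _ _ => _) = (fun t x => \sum_(k < n) u k t x + u n t x)); first exact: cont_inD.
  by apply/funext => s; apply/funext => x; rewrite big_ord_recr.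
have [d d0 hd] := cs.2 t It _ e3; exists d => // s Is sd.
have wN r (Ir : I r) : wiener tau (fun x => \sum_(k < N) u k r x) := (normX_sum N (wu r Ir) (bu r Ir)).1.
have n1 r (Ir : I r) := normX_le_mono (ltW hN) (normX_ssum_tail t0 (wu r Ir) (bu r Ir) cM N).
have -> : (fun x => ssum (fun n => u n s) x - ssum (fun n => u n t) x) =
  (fun x => ((ssum (fun n => u n s) x - \sum_(k < N) u k s x) -
             (ssum (fun n => u n t) x - \sum_(k < N) u k t x)) +
            (\sum_(k < N) u k s x - \sum_(k < N) u k t x)).
  by apply/funext => x; ring.
have -> : e = e / 3 + e / 3 + e / 3 by field.
have c1 r (Ir : I r) := wiener_cont (wienerB (ws r Ir) (wN r Ir)).
apply: normXD.
- by apply: continuousB2; exact: c1.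
- by apply: wiener_cont; exact: wienerB (wN s Is) (wN t It).
- by apply: normXB; [exact: c1|exact: c1|exact: n1|exact: n1].
- exact: hd.
Qed.

Lemma cont_in_local tau u : (forall T, 0 <= T -> cont_in `[0, T] tau u) ->
  cont_in `[0, +oo[ tau u.
Proof.
move=> h; split=> t /=; rewrite in_itv/= andbT => t0.
  by apply: (h t t0).1; rewrite /= in_itv/= t0 lexx.
move=> e e0; have t1 : 0 <= t + 1 by rewrite addr_ge0.
have It : `[0, t + 1]%classic t by rewrite /= in_itv/= t0 lerDl ler01.
have [d d0 hd] := (h _ t1).2 t It e e0.
exists (Num.min d 1); first by rewrite lt_min d0 ltr01.
move=> s; rewrite lt_min in_itv/= andbT => s0 /andP[sd s1].
apply: hd => //; rewrite /= in_itv/= s0 /=.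
by move: s1; rewrite ltr_norml => /andP[_]; rewrite ltrBlDr addrC => /ltW.
Qed.

Lemma cont_in_scale I tau (f : R -> R) (P : R -> R) :
  (forall t, {for t, continuous f}) -> wiener tau P -> cont_in I tau (fun t x => f t * P x).
Proof.
move=> cf wP; split=> t It; first exact: wienerZ.
move=> e e0; have [b hb] : exists b, normX_le tau P b by exists (fine (normX tau P)); exact: wiener_normX.
have b0 := normX_bound_ge0 hb.
have eb : 0 < e / (b + 1) by rewrite divr_gt0// ltr_wpDl.
have /cvgrPdist_lt/(_ _ eb)[d /= d0 hd] := cf t.
exists d => // s Is sd.
have -> : (fun x => f s * P x - f t * P x) = (fun x => (f s - f t) * P x).
  by apply/funext => x; ring.
apply: normX_le_mono (normXZ (f s - f t) (wiener_cont wP) hb).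
have h : `|f s - f t| <= e / (b + 1) by rewrite distrC; apply: ltW; apply: hd; rewrite /= distrC.
apply: le_trans (ler_wpM2r b0 h) _.
by rewrite mulrAC ler_pdivrMr ?ltr_wpDl// ler_wpM2l ?(ltW e0)// lerDl.
Qed.
End ContinuousSeries.

Section TimeSeries.
Variable R : realType.
Implicit Types (I : set R) (P : nat -> R -> R) (t x c beta rho T : R).

Definition tser P t : R -> R := ssum (fun n x => t ^+ n * P n x).

(** A power series with such coefficients is entire in time, with values in
    X_rho; the factor of t ^ n / n! in its coefficients grows at most like beta ^ n. *)
Definition exp_bounded rho c beta P := forall n,
  wiener rho (P n) /\ normX_le rho (P n) (c * exp_coeff beta n).

Lemma tser_term rho c beta P T t n : exp_bounded rho c beta P -> `|t| <= T ->
  wiener rho (fun x => t ^+ n * P n x) /\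
  normX_le rho (fun x => t ^+ n * P n x) (c * exp_coeff (T * beta) n).
Proof.
move=> hP tT; have [wP bP] := hP n; split; first exact: wienerZ.
apply: normX_le_mono (normXZ (t ^+ n) (wiener_cont wP) bP).
rewrite /exp_coeff/= exprMn !mulrA -[leRHS]mulrA [c * _]mulrC -!mulrA normrX.
by rewrite ler_wpM2r ?lerXn2r ?qualifE//= ?(le_trans _ tT)// (normX_bound_ge0 bP).
Qed.

Lemma exp_coeff_cvg c y : cvgn (series (fun n => c * exp_coeff y n)) /\
  limn (series (fun n => c * exp_coeff y n)) = c * expR y :> R.
Proof.
have h := @is_cvg_series_exp_coeff R y.
have E : series (fun n => c * exp_coeff y n) = (fun n => c * series (exp_coeff y) n).
  by apply/funext => n; rewrite /series /= mulr_sumr.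
have k : c * series (exp_coeff y) n @[n --> \oo] --> c * expR y by apply: cvgM => //; exact: cvg_cst.
by rewrite E; split; [apply/cvg_ex; exists (c * expR y)|exact: cvg_lim k].
Qed.

Section Bounds.
Variables (rho c beta T : R) (P : nat -> R -> R).
Hypothesis rho0 : 0 <= rho.
Hypothesis hP : exp_bounded rho c beta P.

Lemma normX_tser t : `|t| <= T -> normX_le rho (tser P t) (c * expR (T * beta)).
Proof.
move=> tT; have h n := tser_term n hP tT.
rewrite -(exp_coeff_cvg _ _).2.
exact: (normX_ssum rho0 (fun n => (h n).1) (fun n => (h n).2) (exp_coeff_cvg _ _).1).
Qed.

Lemma tser_cvg t x : \sum_(n < N) t ^+ n * P n x @[N --> \oo] --> tser P t x.
Proof.
have h n := tser_term n hP (lexx `|t|).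
have := ssum_cvg rho0 (fun n => (h n).1) (fun n => (h n).2) (exp_coeff_cvg _ _).1.
exact.
Qed.

Lemma cont_in_tser : cont_in `[0, +oo[ rho (tser P).
Proof.
apply: cont_in_local => S S0.
have h t (It : `[0, S]%classic t) : `|t| <= S.
  by move: It; rewrite /= in_itv/= => /andP[a b]; rewrite ger0_norm.
apply: (@cont_in_ssum _ _ _ (fun n t x => t ^+ n * P n x) (fun n => c * exp_coeff (S * beta) n)) => //.
- move=> n; apply: cont_in_scale; last exact: (hP n).1.
  by move=> t; exact: exprn_continuous.
- move=> n t It; exact: (tser_term n hP (h t It)).2.
- exact: (exp_coeff_cvg _ _).1.
Qed.

Lemma tser0 : tser P 0 = P 0%N.
Proof.
apply/funext => x; apply: (cvg_unique _ (@tser_cvg 0 x)) => //.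
have -> : [set l | \sum_(n < N) 0 ^+ n * P n x @[N --> \oo] --> l] (P 0%N x) =
  (\sum_(n < N) 0 ^+ n * P n x @[N --> \oo] --> P 0%N x) by [].
rewrite -cvg_shiftS (_ : (fun _ => _) = (fun=> P 0%N x)); first exact: cvg_cst.
apply/funext => n; rewrite big_ord_recl /= expr0 mul1r big1 ?addr0// => i _.
by rewrite /= /bump/= exprS !mul0r.
Qed.
End Bounds.

(** At fixed x this is the differentiation of a numerical power series, whose
    second derived series still converges everywhere. *)
Lemma tser_deriv rho c beta P P' P'' I x : 0 <= rho ->
  exp_bounded rho c beta P -> exp_bounded rho c beta P' -> exp_bounded rho c beta P'' ->
  (forall n, P' n x = n.+1%:R * P n.+1 x) -> (forall n, P'' n x = n.+1%:R * P' n.+1 x) ->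
  deriv_on I (fun t => tser P t x) (fun t => tser P' t x).
Proof.
move=> rho0 hP hP' hP'' E E'; apply: is_derive_deriv_on => t _.
have ps (Q : nat -> R -> R) s : (fun n => \sum_(k < n) s ^+ k * Q k x) = pseries (Q ^~ x) s.
  apply/funext => n; rewrite /pseries /series /= big_mkord; apply: eq_bigr => i _.
  by rewrite mulrC.
have tE (Q : nat -> R -> R) s : exp_bounded rho c beta Q -> tser Q s x = limn (pseries (Q ^~ x) s).
  move=> hQ; rewrite -ps; apply/esym; apply: cvg_lim; first exact: Rhausdorff.
  exact: (tser_cvg rho0 hQ (t := s) (x := x)).
have cv (Q : nat -> R -> R) s : exp_bounded rho c beta Q -> cvgn (pseries (Q ^~ x) s).
  by move=> hQ; rewrite -ps; apply/cvg_ex; exists (tser Q s x); exact: (tser_cvg rho0 hQ).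
have d1 : pseries_diffs (P ^~ x) = P' ^~ x by apply/funext => n; rewrite /pseries_diffs E.
have d2 : pseries_diffs (P' ^~ x) = P'' ^~ x by apply/funext => n; rewrite /pseries_diffs E'.
rewrite (tE P' t hP') (_ : (fun t => tser P t x) = (fun t => limn (pseries (P ^~ x) t))); last first.
  by apply/funext => s; exact: tE.
rewrite -d1; apply: (@pseries_snd_diffs _ _ (`|t| + 1)).
- exact: cv.
- by rewrite d1; exact: cv.
- by rewrite d1 d2; exact: cv.
- by rewrite [ltRHS]ger0_norm// ltrDl ltr01.
Qed.
End TimeSeries.

(** * The majorant *)

Section Majorant.
Variable R : realType.
Implicit Types (mu kappa x : R) (n k : nat).

(** The recursion of the Catalan numbers refers to all earlier values.  A table
    valid up to n makes it structural: only its entries k <= n are meaningful. *)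
Fixpoint catalan_table mu kappa n : nat -> R :=
  if n is m.+1 then fun k => if (k <= m)%N then catalan_table mu kappa m k else
    kappa * \sum_(j < k) catalan_table mu kappa m j * catalan_table mu kappa m (k.-1 - j)%N
  else fun=> mu.

Definition catalan mu kappa k : R := catalan_table mu kappa k k.

Lemma catalan_tableE mu kappa n k : (k <= n)%N -> catalan_table mu kappa n k = catalan mu kappa k.
Proof.
elim: n => [|n ih]; first by rewrite leqn0 => /eqP ->.
rewrite leq_eqVlt => /orP[/eqP -> //|]; rewrite ltnS => kn.
by rewrite /= kn ih.
Qed.

Lemma catalanS mu kappa k : catalan mu kappa k.+1 =
  kappa * \sum_(j < k.+1) catalan mu kappa j * catalan mu kappa (k - j)%N.
Proof.
rewrite {1}/catalan /= ltnn; congr (_ * _); apply: eq_bigr => j _.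
by rewrite !catalan_tableE ?leq_subr// -ltnS.
Qed.

Lemma catalan_ge0 mu kappa k : 0 <= mu -> 0 <= kappa -> 0 <= catalan mu kappa k.
Proof.
move=> mu0 ka0; elim/ltn_ind: k => -[|k] ih; first exact: mu0.
rewrite catalanS mulr_ge0// sumr_ge0// => j _; rewrite mulr_ge0// ih// ltnS.
exact: leq_subr.
Qed.

(** The generating function of the majorant: S <= mu + kappa x S ^ 2 keeps the
    partial sums below 2 mu as long as 4 kappa mu x <= 1. *)
Lemma catalan_series_le mu kappa x n : 0 <= mu -> 0 <= kappa -> 0 <= x -> 4 * kappa * mu * x <= 1 ->
  \sum_(k < n) x ^+ k * catalan mu kappa k <= 2 * mu.
Proof.
move=> mu0 ka0 x0 h; elim: n => [|n ih]; first by rewrite big_ord0 mulr_ge0.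
pose c k := x ^+ k * catalan mu kappa k.
have c0 k : 0 <= c k by rewrite mulr_ge0 ?exprn_ge0 ?catalan_ge0.
rewrite big_ord_recl /= expr0 mul1r.
have -> : \sum_(i < n) x ^+ bump 0 i * catalan mu kappa (bump 0 i) =
  kappa * x * \sum_(i < n) \sum_(j < i.+1) c j * c (i - j)%N.
  rewrite mulr_sumr; apply: eq_bigr => i _; rewrite /bump /= add1n catalanS.
  rewrite mulr_sumr mulr_sumr mulr_sumr; apply: eq_bigr => j _; rewrite /c exprS.
  have -> : x ^+ i = x ^+ j * x ^+ (i - j)%N by rewrite -exprD subnKC// -ltnS.
  ring.
have sq : \sum_(i < n) \sum_(j < i.+1) c j * c (i - j)%N <= (2 * mu) * (2 * mu).
  apply: le_trans (@triangle_le_square R (fun i j => c i * c j) n _) _; first by move=> i j; exact: mulr_ge0.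
  by rewrite -big_distrlr /=; apply: ler_pM => //; apply: sumr_ge0 => i _; exact: c0.
have kx : 0 <= kappa * x by exact: mulr_ge0.
apply: le_trans (lerD (lexx _) (ler_wpM2l kx sq)) _; rewrite /catalan /=.
have -> : kappa * x * (2 * mu * (2 * mu)) = (4 * kappa * mu * x) * mu by ring.
have := ler_wpM2r mu0 h; rewrite mul1r => h'.
by rewrite [leRHS]mulr_natl mulr2n lerD2l.
Qed.

(** The binomial theorem in the form in which it adds up growth rates. *)
Lemma exp_coeffD (a b : R) n :
  \sum_(i < n.+1) exp_coeff a i * exp_coeff b (n - i)%N = exp_coeff (a + b) n.
Proof.
rewrite /exp_coeff /= addrC exprDn mulr_suml; apply: eq_bigr => i _.
have hi : (i <= n)%N by rewrite -ltnS.
have f0 m : (m`!%:R : R) != 0 by rewrite pnatr_eq0 -lt0n fact_gt0.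
have /(congr1 (fun m => m%:R : R)) := bin_fact hi; rewrite !natrM => B.
rewrite -mulr_natr -B; field; rewrite ?f0//.
have : ('C(n, i)%:R : R) != 0 by rewrite pnatr_eq0 -lt0n bin_gt0.
by move=> ->.
Qed.

Lemma exp_coeffS (a : R) n : exp_coeff a n.+1 = (n.+1%:R)^-1 * (a * exp_coeff a n).
Proof.
rewrite /exp_coeff /= exprS factS natrM invfM; ring.
Qed.

End Majorant.

(** * Taylor coefficients of the Stokes expansion *)

Section Recursion.
Variables (R : realType) (g : R) (p0 r0 : R -> R).
Implicit Types (k n : nat).
Let state := ((R -> R) * (R -> R))%type.

(** The n-th Taylor coefficient of the right-hand side of the k-th linear
    problem: products become convolutions in n. *)
Definition force (W : nat -> nat -> state) k n : R -> R := fun x =>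
  - g * lam (W k n).1 x + \sum_(j < k) \sum_(i < n.+1)
    nlin g (W j i).1 (W j i).2 (W (k.-1 - j)%N (n - i)%N).1 (W (k.-1 - j)%N (n - i)%N).2 x.

(** Pairs of the n-th Taylor coefficients of h_k and of its velocity, obtained
    by integrating the equation once; tabulated like the majorant. *)
Fixpoint taylor_table n : nat -> nat -> state :=
  if n is m.+1 then fun k i => if (i <= m)%N then taylor_table m k i else
    (fun x => (m.+1%:R)^-1 * (taylor_table m k m).2 x,
     fun x => (m.+1%:R)^-1 * force (taylor_table m) k m x)
  else fun k _ => if k is 0%N then (p0, r0) else (fun=> 0, fun=> 0).

Definition taylor k n : state := taylor_table n k n.

Lemma taylor_tableE n k i : (i <= n)%N -> taylor_table n k i = taylor k i.
Proof.
elim: n => [|n ih]; first by rewrite leqn0 => /eqP ->.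
rewrite leq_eqVlt => /orP[/eqP -> //|]; rewrite ltnS => kn.
by rewrite /= kn ih.
Qed.

Lemma taylorS k n : taylor k n.+1 = (fun x => (n.+1%:R)^-1 * (taylor k n).2 x,
  fun x => (n.+1%:R)^-1 * force taylor k n x).
Proof.
rewrite {1}/taylor /= ltnn taylor_tableE//; congr pair.
apply/funext => x; rewrite /force taylor_tableE//; congr (_ * (_ + _)).
apply: eq_bigr => j _; apply: eq_bigr => i _.
by rewrite !taylor_tableE ?leq_subr// -ltnS.
Qed.
End Recursion.

(** * Bounds on the Taylor coefficients *)

Section Banded.
Variable R : realType.
Implicit Types (f h : R -> R) (d e b c : R).

Lemma bandedD d f h : continuous f -> continuous h -> banded d f -> banded d h ->
  banded d (fun x => f x + h x).
Proof. by move=> cf ch df dh k dk; rewrite fcoefD// df// dh// addr0. Qed.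

Lemma bandedZ d c f : continuous f -> banded d f -> banded d (fun x => c * f x).
Proof. by move=> cf df k dk; rewrite fcoefZ// df// mulr0. Qed.

Lemma banded0 d : banded d (fun _ : R => 0 : R).
Proof. by move=> k _; rewrite fcoef0. Qed.

Lemma banded_lam d f : strip f -> banded d f -> banded d (lam f).
Proof. by move=> sf df k dk; rewrite fcoef_lam// df// mulr0. Qed.

Lemma banded_sum d n (F : nat -> R -> R) : (forall i, (i < n)%N -> strip (F i)) ->
  (forall i, (i < n)%N -> banded d (F i)) -> banded d (fun x => \sum_(i < n) F i x).
Proof.
elim: n => [|n ih] sF dF.
  rewrite (_ : (fun _ => _) = (fun=> 0)); first exact: banded0.
  by apply/funext => x; rewrite big_ord0.
rewrite (_ : (fun _ => _) = (fun x => \sum_(i < n) F i x + F n x)); last first.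
  by apply/funext => x; rewrite big_ord_recr.
have s' i : (i < n)%N -> strip (F i) by move=> h; apply: sF; exact: ltnW.
apply: bandedD.
- by apply: strip_cont; exact: strip_sum.
- by apply: strip_cont; exact: sF.
- by apply: ih => // i h; apply: dF; exact: ltnW.
- exact: dF.
Qed.

(** On functions with frequencies at most d all the norms are equivalent. *)
Lemma normX_le_banded rho d f b : 0 <= rho -> banded d f -> normX_le 0 f b ->
  normX_le rho f (expR (rho * d) * b).
Proof.
move=> rho0 df /normX_leP hb; apply/normX_leP => N.
apply: le_trans (ler_wpM2l (expR_ge0 _) (hb N)); rewrite mulr_sumr; apply: ler_sum => k _.
rewrite /wcoef mul0r expR0 mul1r.
have [dk|kd] := ltP d (`|k|%:~R); first by rewrite df// normc0 !mulr0.
by rewrite ler_wpM2r ?normc_ge0// ler_expR ler_wpM2l.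
Qed.

Lemma normX_lam_banded d f b : 0 <= d -> strip f -> banded d f -> normX_le 0 f b ->
  normX_le 0 (lam f) (d * b).
Proof.
move=> d0 sf df /normX_leP hb; apply/normX_leP => N.
apply: le_trans (ler_wpM2l d0 (hb N)); rewrite mulr_sumr; apply: ler_sum => k _.
rewrite /wcoef normc_fcoef_lam// mul0r expR0 !mul1r.
have [dk|kd] := ltP d (`|k|%:~R); first by rewrite df// normc0 !mulr0.
by rewrite ler_wpM2r ?normc_ge0.
Qed.

Lemma normX_le0 rho : normX_le rho (fun _ : R => 0 : R) 0.
Proof. by rewrite -[X in normX_le _ _ X](@normr0 _ R); exact: normX_cst. Qed.

Lemma normX_sum_lt t n (u : nat -> R -> R) (M : nat -> R) : (forall i, (i < n)%N -> wiener t (u i)) ->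
  (forall i, (i < n)%N -> normX_le t (u i) (M i)) ->
  normX_le t (fun x => \sum_(i < n) u i x) (\sum_(i < n) M i).
Proof.
move=> hu uM; pose u' i := if (i < n)%N then u i else fun=> 0.
pose M' i := if (i < n)%N then M i else 0.
have := normX_sum n (t := t) (u := u') (M := M').
have -> : (fun x => \sum_(i < n) u' i x) = (fun x => \sum_(i < n) u i x).
  by apply/funext => x; apply: eq_bigr => i _; rewrite /u' ltn_ord.
have -> : \sum_(i < n) M' i = \sum_(i < n) M i by apply: eq_bigr => i _; rewrite /M' ltn_ord.
case=> // i; rewrite /u' /M'; case: ifP => h; [exact: hu|exact: wiener_cst|exact: uM|exact: normX_le0].
Qed.

End Banded.

Section Estimates.
Variables (R : realType) (g D mu M0 alpha : R) (p0 r0 : R -> R).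
Hypotheses (g0 : 0 <= g) (D0 : 0 <= D) (mu0 : 0 <= mu) (M00 : 0 <= M0).
Hypotheses (a1 : 1 <= alpha) (Da : D <= alpha) (ga : g < alpha).
Hypotheses (sp0 : strip p0) (sr0 : strip r0) (dp0 : banded D p0) (dr0 : banded D r0).
Hypotheses (lp0 : normX_le 0 (lam p0) mu) (nr0 : normX_le 0 r0 mu) (np0 : normX_le 0 p0 M0).
Implicit Types (k n : nat).

Let kappa : R := D * (2 * g + 1) / (alpha - g).
Definition growth k : R := catalan mu kappa k.
(** The norm of h_0 itself, unlike that of Lambda h_0, sees the mean of the
    initial datum; M0 accounts for it in the zeroth coefficient only. *)
Definition growth0 k : R := growth k + M0 * (k == 0%N)%:R.
Let P k n := (taylor g p0 r0 k n).1.
Let V k n := (taylor g p0 r0 k n).2.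
Let F k n := force g (taylor g p0 r0) k n.
Let E k n : R := exp_coeff (alpha * k.+1%:R) n.
Let band k : R := k.+1%:R * D.

Definition controlled k n := [/\ strip (P k n), strip (V k n), banded (band k) (P k n),
  banded (band k) (V k n) & [/\ normX_le 0 (lam (P k n)) (growth k * E k n),
  normX_le 0 (V k n) (growth k * E k n) & normX_le 0 (P k n) (growth0 k * E k n)]].

Let alpha0 : 0 <= alpha. Proof. exact: le_trans a1. Qed.
Let kappa0 : 0 <= kappa.
Proof. by rewrite mulr_ge0 ?invr_ge0 ?subr_ge0 ?(ltW ga)// mulr_ge0// addr_ge0// mulr_ge0. Qed.
Lemma growth_ge0 k : 0 <= growth k. Proof. exact: catalan_ge0. Qed.
Lemma growth_le k : growth k <= growth0 k. Proof. by rewrite lerDl mulr_ge0. Qed.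
Let E_ge0 k n : 0 <= E k n. Proof. by apply: exp_coeff_ge0; rewrite mulr_ge0. Qed.
Let band_ge0 k : 0 <= band k. Proof. by rewrite mulr_ge0. Qed.

(** All pairs (j, k - 1 - j) contribute the same exponential rate, so the bound
    is (k + 1) E_(k,n) times g q_k + (alpha - g) kappa times a convolution of q,
    and kappa is chosen so that this is at most alpha (k + 1) q_k E_(k,n). *)
Lemma force_controlled k n : (forall j i, (i <= n)%N -> controlled j i) ->
  [/\ strip (F k n), banded (band k) (F k n) &
      normX_le 0 (F k n) (alpha * k.+1%:R * (growth k * E k n))].
Proof.
move=> H; have [sP sV bP bV [lP nV _]] := H k n (leqnn n).
pose N j i := nlin g (P j i) (V j i) (P (k.-1 - j)%N (n - i)%N) (V (k.-1 - j)%N (n - i)%N).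
have hN j i : (j < k)%N -> (i < n.+1)%N -> [/\ strip (N j i), banded (band k) (N j i) &
    normX_le 0 (N j i) (band k * ((2 * g + 1) * ((growth j * E j i) *
       (growth (k.-1 - j)%N * E (k.-1 - j)%N (n - i)%N))))].
  move=> jk hi; have [s1 s2 b1 b2 [l1 n1 _]] := H j i hi.
  have [s3 s4 b3 b4 [l3 n3 _]] := H (k.-1 - j)%N (n - i)%N (leq_subr _ _).
  have bd : banded (band k) (N j i).
    have -> : band k = band j + band (k.-1 - j)%N.
      by rewrite /band -mulrDl -natrD; congr (_%:R * _); lia.
    exact: banded_nlin (band_ge0 _) (band_ge0 _) s1 s2 s3 s4 b1 b2 b3 b4.
  split=> //; first exact: strip_nlin.
  have [//|] := normX_nlin_banded g0 (lexx 0) s1 s2 s3 s4 l1 n1 l3 n3 bd.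
  by rewrite ltNge band_ge0.
have sN j : (j < k)%N -> strip (fun x => \sum_(i < n.+1) N j i x).
  by move=> jk; apply: strip_sum => i hi; have [] := hN j i jk hi.
have sS : strip (fun x => \sum_(j < k) \sum_(i < n.+1) N j i x).
  exact: (@strip_sum _ k (fun j x => \sum_(i < n.+1) N j i x)).
have sl := strip_lam sP; have cl := strip_cont sl.
split.
- by apply: stripD => //; exact: stripZ.
- apply: bandedD; [exact: continuousZ2|exact: strip_cont| |].
    by apply: bandedZ => //; exact: banded_lam.
  apply: (@banded_sum _ _ k (fun j x => \sum_(i < n.+1) N j i x)) => // j jk.
  apply: banded_sum => i hi; by have [] := hN j i jk hi.
pose B j i := band k * ((2 * g + 1) * ((growth j * E j i) *
       (growth (k.-1 - j)%N * E (k.-1 - j)%N (n - i)%N))).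
have hS : normX_le 0 (fun x => \sum_(j < k) \sum_(i < n.+1) N j i x) (\sum_(j < k) \sum_(i < n.+1) B j i).
  apply: (@normX_sum_lt R 0 k (fun j x => \sum_(i < n.+1) N j i x) (fun j => \sum_(i < n.+1) B j i)) => j jk.
    by apply: strip_wiener0; exact: sN.
  apply: (@normX_sum_lt R 0 n.+1 (N j) (B j)) => i hi; have [h1 _ h2] := hN j i jk hi; last exact: h2.
  exact: strip_wiener0.
have hl := normXZ (- g) cl lP.
apply: normX_le_mono (normXD _ (strip_cont sS) hl hS); last exact: continuousZ2.
rewrite normrN ger0_norm//.
have {hS hl} -> : \sum_(j < k) \sum_(i < n.+1) B j i =
  k.+1%:R * (alpha - g) * E k n * (kappa * \sum_(j < k) growth j * growth (k.-1 - j)%N).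
  rewrite !mulr_sumr; apply: eq_bigr => j _.
  have -> : E k n = \sum_(i < n.+1) E j i * E (k.-1 - j)%N (n - i)%N.
    rewrite exp_coeffD -mulrDr -natrD; congr (exp_coeff (_ * _%:R) _).
    by have := ltn_ord j; lia.
  rewrite mulr_sumr mulr_suml; apply: eq_bigr => i _.
  rewrite /B /band /kappa; field; by rewrite subr_eq0 gt_eqF.
have hk : kappa * \sum_(j < k) growth j * growth (k.-1 - j)%N <= growth k.
  by case: k {H sP sV bP bV lP nV N hN sN sS sl cl B} => [|k];
    [rewrite big_ord0 mulr0; exact: growth_ge0|rewrite [leRHS]/growth catalanS].
have c0 : 0 <= k.+1%:R * (alpha - g) * E k n   by apply: mulr_ge0 => //; apply: mulr_ge0 => //; rewrite subr_ge0 ltW.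
apply: le_trans (lerD (lexx _) (ler_wpM2l c0 hk)) _.
have G0 : 0 <= g * (growth k * E k n).
  by apply: mulr_ge0 => //; apply: mulr_ge0 => //; exact: growth_ge0.
have : g * (growth k * E k n) <= k.+1%:R * (g * (growth k * E k n)) by rewrite ler_peMl// ler1n.
move=> h; apply: le_trans (lerD h (lexx _)) _.
by rewrite le_eqVlt; apply/orP; left; apply/eqP; ring.
Qed.

(** Induction on the order in time: one integration divides by n + 1, and
    alpha (k + 1) E_(k,n) / (n + 1) is the next exponential coefficient. *)
Lemma taylor_controlled k n : controlled k n.
Proof.
elim/ltn_ind: n k => -[|n] ih k.
  have E0 : E k 0 = 1 by rewrite /E /exp_coeff /= expr0 fact0 divr1.
  case: k E0 => [|k] E0; rewrite /controlled E0 !mulr1 /P /V /taylor /=.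
    rewrite /band mul1r; split=> //; split=> //.
    by rewrite /growth0 eqxx mulr1; apply: normX_le_mono np0; rewrite lerDr growth_ge0.
  have z d : normX_le 0 (fun=> 0 : R) (growth d) by apply: normX_le_mono (growth_ge0 d) (normX_le0 (0 : R)).
  have z' : normX_le 0 (lam (fun=> 0 : R)) 0.
    rewrite -[X in normX_le _ _ X](mul0r 0); apply: normX_lam_banded => //.
    - exact: strip_cst.
    - exact: banded0.
    - exact: normX_le0.
  split; [exact: strip_cst|exact: strip_cst|exact: banded0|exact: banded0|split].
  - exact: normX_le_mono (growth_ge0 _) z'.
  - exact: z.
  - by rewrite /growth0 /= mulr0 addr0; exact: z.
have H j i : (i <= n)%N -> controlled j i by move=> hi; exact: ih.
have [sF bF nF] := force_controlled k H.
have [sP sV bP bV [lP nV nP]] := H k n (leqnn n).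
have EP : P k n.+1 = fun x => (n.+1%:R)^-1 * V k n x by rewrite /P taylorS.
have EV : V k n.+1 = fun x => (n.+1%:R)^-1 * F k n x by rewrite /V taylorS.
have n0 : 0 <= (n.+1%:R)^-1 :> R by rewrite invr_ge0.
have cV := strip_cont sV.
have G := growth_ge0 k.
have kD : band k <= alpha * k.+1%:R by rewrite /band mulrC ler_wpM2r.
have k1 : 1 <= alpha * k.+1%:R.
  by apply: le_trans (ler_wpM2r (ler0n _ _) a1); rewrite mul1r ler1n.
have gE : 0 <= growth k * E k n by exact: mulr_ge0.
have ES c : 0 <= c -> c <= alpha * k.+1%:R ->
    (n.+1%:R)^-1 * (c * (growth k * E k n)) <= growth k * E k n.+1.
  move=> c0 hc; rewrite {2}/E exp_coeffS -/(E k n) [leRHS]mulrCA ler_wpM2l//.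
  by rewrite [leRHS]mulrCA ler_wpM2r.
rewrite /controlled EP EV; split.
- exact: stripZ.
- exact: stripZ.
- exact: bandedZ.
- by apply: bandedZ => //; exact: strip_cont.
have nP' : normX_le 0 (fun x => (n.+1%:R)^-1 * V k n x) (growth k * E k n.+1).
  apply: normX_le_mono (normXZ _ cV nV); rewrite ger0_norm//.
  by rewrite -[growth k * E k n in leLHS]mul1r; exact: ES.
split.
- rewrite /lam (multiplierZ _ (symbol_lambda R) sV) -/(lam _).
  have cl := strip_cont (strip_lam sV).
  apply: normX_le_mono (normXZ _ cl (normX_lam_banded (band_ge0 k) sV bV nV)).
  by rewrite ger0_norm//; exact: ES.
- apply: normX_le_mono (normXZ _ (strip_cont sF) nF); rewrite ger0_norm//.
  by apply: ES => //; rewrite mulr_ge0.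
- by apply: normX_le_mono nP'; rewrite ler_wpM2r ?growth_le.
Qed.

End Estimates.

(** * The Stokes coefficients and the sum of the expansion *)

Section Construction.
Variables (R : realType) (g D mu M0 alpha eps : R) (p0 r0 : R -> R).
Hypotheses (g0 : 0 <= g) (D0 : 0 <= D) (mu0 : 0 <= mu) (M00 : 0 <= M0) (eps0 : 0 < eps).
Hypotheses (a1 : 1 <= alpha) (Da : D <= alpha) (ga : g < alpha).
Hypotheses (sp0 : strip p0) (sr0 : strip r0) (dp0 : banded D p0) (dr0 : banded D r0).
Hypotheses (lp0 : normX_le 0 (lam p0) mu) (nr0 : normX_le 0 r0 mu) (np0 : normX_le 0 p0 M0).
Implicit Types (k n : nat) (t x : R).

Let q k := growth g D mu alpha k.
Let q0 k := growth0 g D mu M0 alpha k.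
Let P k n := (taylor g p0 r0 k n).1.
Let V k n := (taylor g p0 r0 k n).2.
Let F k n := force g (taylor g p0 r0) k n.
Let rho : R := 2^-1.
(* A common constant for the Taylor coefficients of h_k, its velocity and its
   acceleration in the norm of X_(1/2); the exponential is the price of a
   positive width for frequencies at most (k + 1) D. *)
Let cc k : R := expR (rho * (k.+1%:R * D)) * (alpha * k.+1%:R * q0 k).

Definition stokes k := tser (P k).
Definition stokes_vel k := tser (V k).
Definition stokes_acc k := tser (F k).

Let ctrl k n := taylor_controlled g0 D0 mu0 M00 a1 Da ga sp0 sr0 dp0 dr0 lp0 nr0 np0 k n.
Let rho_gt0 : 0 < rho. Proof. by rewrite invr_gt0. Qed.
Let rho0 : 0 <= rho := ltW rho_gt0.
Let q_ge0 k : 0 <= q k. Proof. exact: growth_ge0. Qed.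
Let q_le k : q k <= q0 k. Proof. exact: growth_le. Qed.
Let q0_ge0 k : 0 <= q0 k. Proof. exact: le_trans (q_ge0 k) (q_le k). Qed.
Let alpha_gt0 : 0 < alpha. Proof. exact: lt_le_trans ltr01 a1. Qed.
Let ak1 k : 1 <= alpha * k.+1%:R.
Proof. by apply: le_trans (ler_wpM2r (ler0n _ _) a1); rewrite mul1r ler1n. Qed.
Let cc_ge0 k : 0 <= cc k.
Proof. by rewrite mulr_ge0 ?expR_ge0// mulr_ge0// (le_trans _ (ak1 k)). Qed.

Let bound k f b n : strip f -> banded (k.+1%:R * D) f ->
  normX_le 0 f (b * exp_coeff (alpha * k.+1%:R) n) -> b <= alpha * k.+1%:R * q0 k ->
  wiener rho f /\ normX_le rho f (cc k * exp_coeff (alpha * k.+1%:R) n).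
Proof.
move=> sf df nf hb.
have h : normX_le rho f (cc k * exp_coeff (alpha * k.+1%:R) n).
  apply: normX_le_mono (normX_le_banded rho0 df nf).
  rewrite /cc -mulrA ler_wpM2l ?expR_ge0// ler_wpM2r//.
  by apply: exp_coeff_ge0; exact: le_trans (ak1 k).
by split=> //; exact: strip_wiener sf h.
Qed.

Let q_small k : q k <= alpha * k.+1%:R * q0 k.
Proof. by apply: le_trans (q_le k) _; rewrite ler_peMl. Qed.

Let expP k : exp_bounded rho (cc k) (alpha * k.+1%:R) (P k).
Proof.
move=> n; have [s _ b _ [_ _ h]] := ctrl k n; apply: bound s b h _.
by rewrite ler_peMl.
Qed.
Let expV k : exp_bounded rho (cc k) (alpha * k.+1%:R) (V k).
Proof. by move=> n; have [_ s _ b [_ h _]] := ctrl k n; exact: bound s b h (q_small k). Qed.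
Let expF k : exp_bounded rho (cc k) (alpha * k.+1%:R) (F k).
Proof.
move=> n; have [s b] := force_controlled g0 D0 mu0 M00 a1 Da ga k (fun j i (_ : (i <= n)%N) => ctrl j i).
rewrite mulrA => h; apply: bound s b h _.
by rewrite ler_wpM2l// (le_trans _ (ak1 k)).
Qed.

Lemma stokes_cont k : cont_in `[0, +oo[ rho (stokes k) /\ cont_in `[0, +oo[ rho (stokes_vel k).
Proof. by split; [exact: cont_in_tser (expP k)|exact: cont_in_tser (expV k)]. Qed.

Let EV k n x : V k n x = n.+1%:R * P k n.+1 x.
Proof. by rewrite /P taylorS /= mulrA divff ?mul1r// pnatr_eq0. Qed.
Let EF k n x : F k n x = n.+1%:R * V k n.+1 x.
Proof. by rewrite /V taylorS /= mulrA divff ?mul1r// pnatr_eq0. Qed.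

Lemma stokes_deriv I k x : deriv_on I (stokes k ^~ x) (stokes_vel k ^~ x).
Proof. by have := tser_deriv rho0 (expP k) (expV k) (expF k) (fun n => EV k n x) (fun n => EF k n x). Qed.

Let expF' k : exists2 c, 0 <= c & exp_bounded rho c (alpha * k.+1%:R) (fun n x => n.+1%:R * F k n.+1 x).
Proof.
have A0 : 0 <= alpha * k.+1%:R by exact: le_trans (ak1 k).
exists (cc k * (alpha * k.+1%:R)); first exact: mulr_ge0.
move=> n; have [w h] := expF k n.+1; split; first exact: wienerZ.
apply: normX_le_mono (normXZ n.+1%:R (wiener_cont w) h); rewrite exp_coeffS ger0_norm//.
have n1 : n.+1%:R != 0 :> R by rewrite pnatr_eq0.
set a := n.+1%:R in n1 *.
by rewrite le_eqVlt; apply/orP; left; apply/eqP; field.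
Qed.

Lemma stokes_vel_deriv I k x : deriv_on I (stokes_vel k ^~ x) (stokes_acc k ^~ x).
Proof.
have [c c0 h] := expF' k; have A0 : 0 <= alpha * k.+1%:R by exact: le_trans (ak1 k).
pose c' := cc k + c.
have up b Q : b <= c' -> exp_bounded rho b (alpha * k.+1%:R) Q ->
    exp_bounded rho c' (alpha * k.+1%:R) Q.
  move=> bc hQ n; have [w m] := hQ n; split=> //; apply: normX_le_mono m.
  by rewrite ler_wpM2r// exp_coeff_ge0.
have l1 : cc k <= c' by rewrite lerDl.
have l2 : c <= c' by rewrite lerDr.
by have := tser_deriv rho0 (up _ _ l1 (expV k)) (up _ _ l1 (expF k)) (up _ _ l2 h) (fun n => EF k n x) (fun=> erefl).
Qed.

Lemma stokes0 k : stokes k 0 = (if k is 0%N then p0 else fun=> 0) /\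
  stokes_vel k 0 = (if k is 0%N then r0 else fun=> 0).
Proof.
rewrite /stokes /stokes_vel (tser0 rho0 (expP k)) (tser0 rho0 (expV k)).
by rewrite /P /V /taylor /=; case: k.
Qed.

Let st f : wiener rho f -> strip f := @wiener_strip R rho f rho_gt0.

(** The Cauchy product in time of the recursion. *)
Lemma stokes_eq k t x : stokes_acc k t x = - g * lam (stokes k t) x +
  \sum_(j < k) nlin g (stokes j t) (stokes_vel j t) (stokes (k.-1 - j)%N t) (stokes_vel (k.-1 - j)%N t) x.
Proof.
pose a j n : R := cc j * exp_coeff (`|t| * (alpha * j.+1%:R)) n.
have tP j n := tser_term n (expP j) (lexx `|t|); have tV j n := tser_term n (expV j) (lexx `|t|).
have ca j : cvgn (series (a j)) := (exp_coeff_cvg _ _).1.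
have l1 : \sum_(n < N) lam (fun x => t ^+ n * P k n x) x @[N --> \oo] --> lam (stokes k t) x.
  exact: (multiplier_ssum (symbol_lambda R) rho_gt0 (fun n => (tP k n).1) (fun n => (tP k n).2) (ca k)).
pose T j n i := nlin g (fun x => t ^+ i * P j i x) (fun x => t ^+ i * V j i x)
  (fun x => t ^+ (n - i) * P (k.-1 - j)%N (n - i)%N x) (fun x => t ^+ (n - i) * V (k.-1 - j)%N (n - i)%N x) x.
have l2 j : \sum_(n < N) \sum_(i < n.+1) T j n i @[N --> \oo] -->
    nlin g (stokes j t) (stokes_vel j t) (stokes (k.-1 - j)%N t) (stokes_vel (k.-1 - j)%N t) x.
  exact: (nlin_ssum g0 rho_gt0 (fun n => (tP j n).1) (fun n => (tV j n).1)
    (fun n => (tP _ n).1) (fun n => (tV _ n).1) (fun n => (tP j n).2) (fun n => (tV j n).2)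
    (fun n => (tP _ n).2) (fun n => (tV _ n).2) (ca j) (ca _)).
have l3 : \sum_(n < N) t ^+ n * F k n x @[N --> \oo] --> stokes_acc k t x.
  exact: (tser_cvg rho0 (expF k) (t := t) (x := x)).
apply: (cvg_unique _ l3) => //.
have -> : (fun N => \sum_(n < N) t ^+ n * F k n x) = (fun N => - g * (\sum_(n < N) lam (fun x => t ^+ n * P k n x) x) +
    \sum_(j < k) (\sum_(n < N) \sum_(i < n.+1) T j n i)).
  apply/funext => N; rewrite exchange_big /= mulr_sumr -big_split /=; apply: eq_bigr => n _.
  have sP j i : strip (P j i) by exact: st (expP j i).1.
  have sV j i : strip (V j i) by exact: st (expV j i).1.
  rewrite /lam (multiplierZ _ (symbol_lambda R) (sP k n)) -/(lam _) /F /force mulrDr; congr (_ + _).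
    by rewrite mulrCA.
  rewrite mulr_sumr; apply: eq_bigr => j _; rewrite mulr_sumr; apply: eq_bigr => i _.
  rewrite /T nlinZ; [|exact: sP|exact: sV|exact: sP|exact: sV].
  by rewrite -exprD subnKC// -ltnS.
have h := cvg_sum_ord (u := fun j N => \sum_(n < N) \sum_(i < n.+1) T j n i) (n := k) (fun j _ => l2 j).
by apply: cvgD; [apply: cvgM => //; exact: cvg_cst|exact: h].
Qed.

Section Expansion.
Hypothesis small : 4 * (D * (2 * g + 1) / (alpha - g)) * mu * (eps * expR (D + 2)) <= 1.
Let T : R := alpha^-1.
Let I : set R := `[0, T]%classic.
Let w k : R := eps ^+ k.+1 * (cc k * expR k.+1%:R).

(** With x = eps e ^ (D + 2), the k-th bound is at most a multiple of x ^ k q_k: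
    one factor e ^ (D (k + 1)) comes from the width, one factor e ^ (k + 1) from
    the time 1 / alpha and one from k + 1 <= e ^ (k + 1). *)
Lemma expansion_summable : cvgn (series w).
Proof.
pose lb : R := eps * expR (D + 2).
have lb0 : 0 <= lb by rewrite mulr_ge0 ?expR_ge0// ltW.
have w0 k : 0 <= w k by rewrite mulr_ge0 ?exprn_ge0 ?(ltW eps0)// mulr_ge0 ?expR_ge0.
have ka0 : 0 <= D * (2 * g + 1) / (alpha - g).
  by rewrite mulr_ge0 ?invr_ge0 ?subr_ge0 ?(ltW ga)// mulr_ge0// addr_ge0// mulr_ge0.
have wle k : w k <= alpha * lb * (lb ^+ k * q0 k).
  have k0 : 0 <= k.+1%:R :> R by [].
  have e1 : expR (rho * (k.+1%:R * D)) * k.+1%:R * expR k.+1%:R <= expR (D + 2) ^+ k.+1.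
    have -> : expR (D + 2) ^+ k.+1 = expR (k.+1%:R * D) * expR k.+1%:R * expR k.+1%:R.
      by rewrite -expRM_natl -!expRD; congr expR; rewrite -mulr_natl; ring.
    rewrite ler_wpM2r ?expR_ge0// ler_pM ?expR_ge0//.
      by rewrite ler_expR ler_piMl ?mulr_ge0// invf_le1// ler1n.
    by apply: le_trans (expR_ge1Dx _); rewrite lerDr.
  have -> : w k = (eps ^+ k.+1 * alpha * q0 k) * (expR (rho * (k.+1%:R * D)) * k.+1%:R * expR k.+1%:R).
    by rewrite /w /cc; ring.
  apply: le_trans (ler_wpM2l _ e1) _.
    by rewrite mulr_ge0// mulr_ge0 ?exprn_ge0 ?(ltW eps0) ?(ltW alpha_gt0).
  by rewrite /lb !exprMn !exprS; rewrite le_eqVlt; apply/orP; left; apply/eqP; ring.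
apply: nondecreasing_is_cvgn; first by apply: nondecreasing_series => k _ _.
exists (alpha * lb * (2 * mu + M0)) => _ [n _ <-]; rewrite /series /= big_mkord.
apply: (@le_trans _ _ (\sum_(k < n) alpha * lb * (lb ^+ k * q0 k))).
  by apply: ler_sum => k _; exact: wle.
rewrite -mulr_sumr.
rewrite ler_wpM2l//; first by rewrite mulr_ge0// ltW.
rewrite /q0 /growth0; under eq_bigr do rewrite mulrDr; rewrite big_split /=; apply: lerD.
  exact: catalan_series_le.
case: n => [|n]; first by rewrite big_ord0.
rewrite big_ord_recl /= big1 ?addr0; first by rewrite expr0 mul1r mulr1.
by move=> i _; rewrite mulr0 mulr0.
Qed.

(** One bound serves the coefficients, their velocities and their accelerations,
    so that the three expansions are dominated by the same summable sequence. *)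
Definition dominated (U : nat -> R -> R -> R) := forall k,
  cont_in `[0, +oo[ rho (U k) /\ forall t, I t -> normX_le rho (U k t) (cc k * expR k.+1%:R).

Definition expansion (U : nat -> R -> R -> R) t : R -> R := ssum (fun k x => eps ^+ k.+1 * U k t x).

Let domE (Q : nat -> nat -> R -> R) : (forall k, exp_bounded rho (cc k) (alpha * k.+1%:R) (Q k)) ->
  dominated (fun k => tser (Q k)).
Proof.
move=> h k; split; first exact: cont_in_tser (h k).
move=> t; rewrite /I /= in_itv /= => /andP[t0 tT].
have tT' : `|t| <= T by rewrite ger0_norm.
have := normX_tser rho0 (h k) tT'; rewrite /T mulrA mulVf ?mul1r// gt_eqF//.
Qed.

Lemma stokes_dominated : dominated stokes. Proof. exact: domE expP. Qed.
Lemma stokes_vel_dominated : dominated stokes_vel. Proof. exact: domE expV. Qed.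
Lemma stokes_acc_dominated : dominated stokes_acc. Proof. exact: domE expF. Qed.

Section Sum.
Variable U : nat -> R -> R -> R.
Hypothesis dU : dominated U.
Let u k t x := eps ^+ k.+1 * U k t x.

Let subI : I `<=` `[0, +oo[.
Proof. by move=> t; rewrite /I /= !in_itv /= => /andP[-> _]. Qed.
Lemma expansion_term k t : I t -> wiener rho (u k t) /\ normX_le rho (u k t) (w k).
Proof.
move=> It; have [c b] := dU k; have wU := c.1 t (subI It).
split; first exact: wienerZ.
have := normXZ (eps ^+ k.+1) (wiener_cont wU) (b t It).
by rewrite ger0_norm// exprn_ge0// ltW.
Qed.
Let wu t (It : I t) k := (expansion_term k It).1.
Let bu t (It : I t) k := (expansion_term k It).2.

Lemma expansion_cont : cont_in I rho (expansion U).
Proof.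
apply: (@cont_in_ssum _ I rho u w rho0 _ _ expansion_summable).
  by move=> k; apply: cont_inZ; apply: cont_in_subset (dU k).1.
by move=> k t It; exact: bu.
Qed.

Lemma expansion_tail t n : I t ->
  normX_le rho (fun x => expansion U t x - \sum_(k < n) eps ^+ k.+1 * U k t x) (tail w n).
Proof. by move=> It; exact: normX_ssum_tail rho0 (wu It) (bu It) expansion_summable n. Qed.

Lemma expansion_dist t x n : I t ->
  `|expansion U t x - \sum_(k < n) eps ^+ k.+1 * U k t x| <= tail w n.
Proof. by move=> It; exact: ssum_tail rho0 (wu It) (bu It) expansion_summable x n. Qed.

Lemma expansion_cvg t x : I t ->
  \sum_(k < n) eps ^+ k.+1 * U k t x @[n --> \oo] --> expansion U t x.
Proof. by move=> It; exact: (ssum_cvg rho0 (wu It) (bu It) expansion_summable (x := x)). Qed.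
End Sum.

Lemma expansion_uniform_cvg U U' : dominated U -> (forall k t x, 0 <= t -> U' k t x = U k t x) ->
  expansion_converges eps I rho U' (expansion U).
Proof.
move=> dU UU' d d0; have := tail_near expansion_summable d0; apply: filterS => n nd t It.
have t0 : 0 <= t by move: It; rewrite /I /= in_itv /= => /andP[].
apply/normX_leE; apply: normX_le_mono (ltW nd) _.
have ht := expansion_tail dU n It.
have -> : (fun x => \sum_(k < n) eps ^+ k.+1 * U' k t x - expansion U t x) =
   (fun x => - (expansion U t x - \sum_(k < n) eps ^+ k.+1 * U k t x)).
  apply/funext => x; rewrite opprB; congr (_ - _); apply: eq_bigr => k _.
  by rewrite UU'.
apply: normXN => //; apply: wiener_cont; apply: wienerB; first exact: (expansion_cont dU).1.
exact: (normX_sum n (fun k => (expansion_term dU k It).1) (fun k => (expansion_term dU k It).2)).1.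
Qed.

Lemma expansion_deriv U U' x : dominated U -> dominated U' ->
  (forall k, deriv_on I (U k ^~ x) (U' k ^~ x)) ->
  deriv_on I (fun t => expansion U t x) (fun t => expansion U' t x).
Proof.
move=> dU dU' h.
apply: (@unif_lim_deriv _ I (fun n t => \sum_(k < n) eps ^+ k.+1 * U k t x)
  (fun n t => \sum_(k < n) eps ^+ k.+1 * U' k t x) _ _ (tail w)).
- exact: interval_is_interval.
- move=> n; apply: (@deriv_on_sum _ I n (fun k t => eps ^+ k.+1 * U k t x) (fun k t => eps ^+ k.+1 * U' k t x)).
  by move=> k _; exact: deriv_onZ (h k).
- by move=> t It; exact: expansion_cvg.
- by move=> n t It; exact: expansion_dist.
- exact: tail_cvg expansion_summable.
Qed.

(** The sum in k of the linear problems: the quadratic term of order k + 1 in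
    eps ^ (k + 2) = eps ^ (j + 1) eps ^ (k - j + 1) is a Cauchy product. *)
Lemma expansion_eq t x : I t -> expansion stokes_acc t x = - g * lam (expansion stokes t) x +
  nlin g (expansion stokes t) (expansion stokes_vel t) (expansion stokes t) (expansion stokes_vel t) x.
Proof.
move=> It; have dP := stokes_dominated; have dV := stokes_vel_dominated.
have tP k := expansion_term dP k It; have tV k := expansion_term dV k It.
have cw := expansion_summable.
pose eP k x := eps ^+ k.+1 * stokes k t x; pose eV k x := eps ^+ k.+1 * stokes_vel k t x.
have l1 : \sum_(n < N) lam (eP n) x @[N --> \oo] --> lam (expansion stokes t) x.
  exact: (multiplier_ssum (symbol_lambda R) rho_gt0 (fun n => (tP n).1) (fun n => (tP n).2) cw).
have l2 : \sum_(n < N) \sum_(i < n.+1) nlin g (eP i) (eV i) (eP (n - i)%N) (eV (n - i)%N) x @[N --> \oo] -->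
  nlin g (expansion stokes t) (expansion stokes_vel t) (expansion stokes t) (expansion stokes_vel t) x.
  exact: (nlin_ssum g0 rho_gt0 (fun n => (tP n).1) (fun n => (tV n).1)
    (fun n => (tP n).1) (fun n => (tV n).1) (fun n => (tP n).2) (fun n => (tV n).2)
    (fun n => (tP n).2) (fun n => (tV n).2) cw cw).
have l3 := expansion_cvg stokes_acc_dominated It (x := x).
rewrite -cvg_shiftS in l1; rewrite -cvg_shiftS in l3.
apply: (cvg_unique _ l3) => //.
have -> : (fun N => \sum_(k < N.+1) eps ^+ k.+1 * stokes_acc k t x) =
  (fun N => - g * (\sum_(n < N.+1) lam (eP n) x) +
    \sum_(n < N) \sum_(i < n.+1) nlin g (eP i) (eV i) (eP (n - i)%N) (eV (n - i)%N) x).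
  have It' : `[0, +oo[%classic t.
    by move: It; rewrite /I /= !in_itv /= => /andP[-> _].
  have sP k : strip (stokes k t) by apply: st; exact: (stokes_cont k).1.1.
  have sV k : strip (stokes_vel k t) by apply: st; exact: (stokes_cont k).2.1.
  apply/funext => N; under eq_bigr do rewrite stokes_eq mulrDr; rewrite big_split /=; congr (_ + _).
    rewrite mulr_sumr; apply: eq_bigr => k _.
    by rewrite /eP /lam (multiplierZ _ (symbol_lambda R) (sP k)) mulrCA.
  rewrite big_ord_recl /= big_ord0 mulr0 add0r; apply: eq_bigr => n _.
  rewrite (_ : bump 0 n = n.+1)// mulr_sumr; apply: eq_bigr => j _ /=.
  rewrite /eP /eV nlinZ; [|exact: sP|exact: sV|exact: sP|exact: sV].
  rewrite -exprD; congr (eps ^+ _ * _); have := ltn_ord j; lia.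
by apply: cvgD; [apply: cvgM => //; exact: cvg_cst|exact: l2].
Qed.

Lemma expansion0 U f : dominated U -> (forall k, U k 0 = if k is 0%N then f else fun=> 0) ->
  expansion U 0 = (fun x => eps * f x).
Proof.
move=> dU h; apply/funext => x.
have I0 : I 0 by rewrite /I /= in_itv /= lexx invr_ge0 ltW.
have l := expansion_cvg dU I0 (x := x); rewrite -cvg_shiftS in l.
apply: (cvg_unique _ l) => //.
rewrite (_ : (fun _ => _) = (fun=> eps * f x)); first exact: cvg_cst.
apply/funext => n; rewrite big_ord_recl /= h expr1 big1 ?addr0// => i _.
by rewrite h /= mulr0.
Qed.
End Expansion.
End Construction.

(** * Trigonometric data *)

Section TrigonometricData.
Variable R : realType.
Implicit Types (f : R -> R) (D x : R) (l k : int) (A : set int).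

(** The representation makes f continuous, hence its coefficients hermitian; the
    finite sum then has exactly these coefficients. *)
Lemma trig_poly D A f : 0 <= D -> A `<=` [set l : int | `|l|%:~R <= D] -> (forall l, A l -> A (- l)) ->
  (forall x, (f x)%:C%C = \sum_(l \in A) fourier_coef f l * cis (l%:~R * x)) ->
  strip f /\ banded D f.
Proof.
move=> D0 AD symA fE; pose c l := if l \in A then fcoef f l else 0.
pose B := Num.bound D.
have AB l : A l -> (`|l| < B)%N.
  move=> /AD /= h; rewrite -(ltr_nat R); apply: le_lt_trans (archi_boundP D0).
  by apply: le_trans h; rewrite -abszE.
have fp M : (B <= M)%N -> f = psum c M.
  move=> BM; apply/funext => x; rewrite -psumE -[LHS]/(Re (f x)%:C%C) fE; congr (Re _).
  have sub : A `<=` [set k : int | `|k| <= M%:Z].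
    by move=> l /AB h; rewrite /= -abszE lez_nat (leq_trans _ BM)// ltnW.
  have -> : \sum_(l \in A) fourier_coef f l * cis (l%:~R * x) = \sum_(l \in A) c l * cis (l%:~R * x).
    by apply: eq_fsbigr => l lA; rewrite /c lA fcoef.unlock.
  apply: fsbig_widen => // l [_ nA]; rewrite /= /c memNset ?mul0r//.
have cf : continuous f by rewrite (fp B)//; exact: continuous_psum.
have hc : hermitian c.
  move=> l; rewrite /c; have -> : (- l \in A) = (l \in A).
    apply/idP/idP; rewrite !inE => h; last exact: symA.
    by rewrite -(opprK l); exact: symA.
  by case: ifP => _; [exact: hermitian_fcoef|rewrite conjc0].
have ck k : fcoef f k = c k.
  by rewrite {1}(fp (maxn B `|k|)) ?leq_maxl// fcoef_psum// leq_maxr.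
have df : banded D f.
  move=> k Dk; rewrite ck /c memNset// => /AD /= h; move: Dk; by rewrite ltNge h.
split=> //; exists 1; first exact: ltr01.
apply: (@wienerI _ _ _ (\sum_(k <- ints B) wcoef 1 f k)) => //.
  move=> x; rewrite (fp B)// /psum; apply: eq_bigr => k _; congr Re; congr (_ * _).
  by rewrite mulrDr cisD cis_int2pi mulr1.
apply/normX_leP => M; rewrite (bigID (fun k => k \in ints B)) /= [X in _ + X]big1 ?addr0; last first.
  move=> k kB; rewrite /wcoef ck /c memNset ?normc0 ?mulr0// => /AB h.
  by move: kB; rewrite mem_ints (ltnW h).
rewrite -big_filter; apply: sum_uniq_le.
- by move=> k; exact: wcoef_ge0.
- by apply: filter_uniq; exact: uniq_ints.
- exact: uniq_ints.
- by move=> k; rewrite mem_filter => /andP[].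
Qed.

(** A frequency at most D loses only the square root of D against the half
    derivative. *)
Lemma normX_lam_sqrt D f b : 0 <= D -> strip f -> banded D f ->
  normX_le 0 (multiplier (@sqrt_sym R) f) b -> normX_le 0 (lam f) (Num.sqrt D * b).
Proof.
move=> D0 sf df /normX_leP h; apply/normX_leP => N.
have s0 : 0 <= Num.sqrt D by exact: sqrtr_ge0.
apply: le_trans (ler_wpM2l s0 (h N)); rewrite mulr_sumr; apply: ler_sum => k _.
rewrite /wcoef mul0r expR0 !mul1r fcoef_multiplier//; last exact: symbol_sqrt.
rewrite normc_fcoef_lam// normcM /sqrt_sym normcR.
have [Dk|kD] := ltP D `|k|%:~R; first by rewrite df// normc0 !mulr0.
rewrite mulrA ler_wpM2r ?normc_ge0//.
have k0 : 0 <= `|k|%:~R :> R by exact: absz_ge0R.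
rewrite [X in _ * X]ger0_norm ?sqrtr_ge0// -{1}(sqr_sqrtr k0) expr2 ler_wpM2r ?sqrtr_ge0//.
by rewrite ler_sqrt.
Qed.
End TrigonometricData.

(** * The model and its Stokes expansion *)

Section Translation.
Variable R : realType.
Implicit Types (p r q s f : R -> R) (g x : R).

Lemma LambdaE f : Lambda f = lam f. Proof. by rewrite /lam multiplier.unlock. Qed.
Lemma hilbertE f : hilbert f = hil f. Proof. by rewrite /hil multiplier.unlock. Qed.
Lemma sqrtLambdaE f : sqrtLambda f = multiplier (@sqrt_sym R) f.
Proof. by rewrite multiplier.unlock. Qed.

Lemma nlin_stokes g p r q s x : strip p -> strip r -> strip q -> strip s ->
  Lambda (fun y => g * p y * Lambda q y - hilbert r y * hilbert s y) x
  + g * derive1 (fun y => p y * derive1 q y) x = nlin g p r q s x.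
Proof.
move=> sp sr sq ss; rewrite !LambdaE !hilbertE derive1_strip// derive1_strip//.
by apply: stripM => //; exact: strip_dx.
Qed.

Lemma nlin_model g p r x : strip p -> strip r ->
  - Lambda (fun y => `|hilbert r y| ^+ 2) x + g * Lambda (fun y => p y * Lambda p y) x
  + g * derive1 (fun y => p y * derive1 p y) x = nlin g p r p r x.
Proof.
move=> sp sr; rewrite -nlin_stokes//; congr (_ + _); rewrite !LambdaE hilbertE.
have -> : (fun y => `|hil r y| ^+ 2) = (fun y => hil r y * hil r y).
  by apply/funext => y; rewrite real_normK ?num_real// expr2.
have s1 := stripM (strip_hil sr) (strip_hil sr); have s2 := stripM sp (strip_lam sp).
have -> : (fun y => g * p y * lam p y - hil r y * hil r y) =
  (fun y => g * (p y * lam p y) - hil r y * hil r y) by apply/funext => y; rewrite mulrA.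
have sl := symbol_lambda R.
rewrite [in RHS]/lam (multiplierB sl (stripZ g s2) s1) (multiplierZ g sl s2) -!/(lam _).
by rewrite addrC.
Qed.
End Translation.

Section StokesUniqueness.
Variable R : realType.
Implicit Types (g t x : R) (k : nat).

(** Induction on k: when the lower coefficients agree, so do the forcing terms,
    and the difference solves the homogeneous problem. *)
Lemma stokes_unique g eps hinit hdinit (hk hkt hk' hkt' : nat -> R -> R -> R) : 0 <= g ->
  stokes_coefficients eps g hinit hdinit hk hkt -> stokes_coefficients eps g hinit hdinit hk' hkt' ->
  forall k t x, 0 <= t -> hk k t x = hk' k t x /\ hkt k t x = hkt' k t x.
Proof.
move=> g0 H H'; elim/ltn_ind => k ih t x t0.
have [[s s0 [/cont_inP c1 /cont_inP c2]] /time_derivativeP d1 /time_derivativeP d2 i1 i2] := H k.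
have [[s' s0' [/cont_inP c1' /cont_inP c2']] /time_derivativeP d1' /time_derivativeP d2' i1' i2'] := H' k.
pose tau := Num.min s s'.
have tau0 : 0 < tau by rewrite lt_min s0.
have sub : `[0, t] `<=` `[0, +oo[ by move=> u; rewrite /= !in_itv /= => /andP[-> _].
have It : `[0, t]%classic t by rewrite /= in_itv /= t0 lexx.
have up u v : cont_in `[0, +oo[ u v -> tau <= u -> cont_in `[0, t] tau v.
  by move=> h hu; apply: cont_in_mono hu _; exact: cont_in_subset sub h.
have ts : tau <= s by rewrite /tau ge_min lexx.
have ts' : tau <= s' by rewrite /tau ge_min lexx orbT.
have {}c1 := up _ _ c1 ts; have {}c2 := up _ _ c2 ts.
have {}c1' := up _ _ c1' ts'; have {}c2' := up _ _ c2' ts'.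
pose p t x := hk k t x - hk' k t x; pose r t x := hkt k t x - hkt' k t x.
have st f : wiener tau f -> strip f by exact: wiener_strip.
have [] : p t x = 0 /\ r t x = 0; last first.
  by move=> /eqP + /eqP; rewrite !subr_eq0 => /eqP -> /eqP ->.
apply: (@linear_unique R g g0 t tau p r t0 tau0) => //.
- exact: cont_inB.
- exact: cont_inB.
- by move=> y; apply: deriv_onB; exact: deriv_on_subset sub _.
- move=> y; apply: deriv_on_eq (deriv_onB (deriv_on_subset sub (d2 y)) (deriv_on_subset sub (d2' y))) => u Iu.
  have u0 : 0 <= u by move: Iu; rewrite /= in_itv /= => /andP[].
  have e1 j : (j < k)%N -> hk j u = hk' j u /\ hkt j u = hkt' j u.
    by move=> jk; split; apply/funext => z; have [] := ih j jk u z u0.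
  have aux (a b S S' : R) : S = S' -> - g * a + S - (- g * b + S') = - g * (a - b) by move=> ->; ring.
  rewrite /p /lam (multiplierB (symbol_lambda R) (st _ (c1.1 u Iu)) (st _ (c1'.1 u Iu))) -/(lam _) -/(lam _).
  rewrite -LambdaE -LambdaE; apply: aux; apply: eq_bigr => j _; have [-> ->] := e1 j (ltn_ord j).
  have kj : (k.-1 - j < k)%N by have := ltn_ord j; lia.
  by have [-> ->] := e1 _ kj.
- by move=> y; rewrite /p i1 i1' subrr.
- by move=> y; rewrite /r i2 i2' subrr.
Qed.
End StokesUniqueness.

Theorem theorem3 (R : realType) (eps g D : R)
    (eps_gt0 : 0 < eps) (g_gt0 : 0 < g) (D_gt1 : 1 < D) :
  exists2 C : R -> R -> R, (forall a b : R, 0 < C a b) &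
  forall hinit hdinit : R -> R,
  (forall x : R, (hinit x)%:C%C =
     \sum_(l \in [set l : int | `|l|%:~R <= D])
        fourier_coef hinit l * cis (l%:~R * x)) ->
  (forall x : R, (hdinit x)%:C%C =
     \sum_(l \in [set l : int | `|l|%:~R <= D /\ l <> 0])
        fourier_coef hdinit l * cis (l%:~R * x)) ->
  let T := 1 / (expR 1 * eps * 4 *
                C (fine (normX 0 (sqrtLambda hinit))) (fine (normX 0 hdinit))) in
  exists h ht : R -> R -> R,
  [/\ analytic_solution g T hinit hdinit h ht,
      forall h' ht' : R -> R -> R,
        analytic_solution g T hinit hdinit h' ht' ->
        forall t x : R, `[0, T]%classic t -> h' t x = h t x,
      exists hk hkt : nat -> R -> R -> R,
        stokes_coefficients eps g hinit hdinit hk hkt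
    & forall hk hkt : nat -> R -> R -> R,
        stokes_coefficients eps g hinit hdinit hk hkt ->
        expansion_converges eps `[0, T]%classic 2^-1 hk h /\
        expansion_converges eps `[0, T]%classic 2^-1 hkt ht].
Proof.
have g0 : 0 <= g by exact: ltW.
have D1 : 1 <= D by exact: ltW.
have D0 : 0 <= D by exact: le_trans D1.
have bD0 : 0 <= 4 * (D * (2 * g + 1)) * expR (D + 2).
  by apply: mulr_ge0; [apply: mulr_ge0 => //; apply: mulr_ge0 => //; apply: addr_ge0 => //; exact: mulr_ge0|exact: expR_ge0].
(* S dominates the size of the data that enters the recursion.  The last summand
   of alpha makes the expansion in eps converge, the others make the recursion
   in time close. *)
pose S (a b : R) := Num.sqrt D * `|a| + `|b|.
have S0 a b : 0 <= S a b by apply: addr_ge0 => //; apply: mulr_ge0 => //; exact: sqrtr_ge0.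
pose alpha a b := g + D + 1 + 4 * (D * (2 * g + 1)) * expR (D + 2) * S a b.
have X0 a b : 0 <= 4 * (D * (2 * g + 1)) * expR (D + 2) * S a b by exact: mulr_ge0.
have a1 a b : 1 <= alpha a b.
  by rewrite /alpha; have := X0 a b; set X := _ * S a b => hX; lra.
have a0 a b : 0 < alpha a b by exact: lt_le_trans ltr01 (a1 a b).
have e1 : 0 < expR 1 :> R by exact: expR_gt0.
have c0 : 0 < 4 * expR 1 * eps by apply: mulr_gt0 => //; exact: mulr_gt0.
(* With this constant the prescribed time is 1 / alpha. *)
exists (fun a b => alpha a b / (4 * expR 1 * eps)); first by move=> a b; exact: divr_gt0.
move=> hinit hdinit hE hdE.
move=> T; pose a := fine (normX 0 (sqrtLambda hinit)); pose b := fine (normX 0 hdinit).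
have TE : T = (alpha a b)^-1.
  rewrite /T -/a -/b /= div1r; congr (_^-1); field.
  by rewrite (gt_eqF e1) (gt_eqF eps_gt0).
rewrite {}TE {T}.
have [sh bh] : strip hinit /\ banded D hinit.
  by apply: (@trig_poly R D [set l : int | `|l|%:~R <= D]) => // l /=; rewrite normrN.
have [sd bd] : strip hdinit /\ banded D hdinit.
  apply: (@trig_poly R D [set l : int | `|l|%:~R <= D /\ l <> 0]) => //; first by move=> l [].
  by move=> l [h1 h2] /=; rewrite normrN; split=> // /eqP; rewrite oppr_eq0 => /eqP.
pose p0 x := eps^-1 * hinit x; pose r0 x := eps^-1 * hdinit x.
have ei : 0 <= eps^-1 by rewrite invr_ge0 ltW.
pose mu := eps^-1 * S a b.
have mu0 : 0 <= mu by exact: mulr_ge0.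
have sp0 : strip p0 by exact: stripZ.
have sr0 : strip r0 by exact: stripZ.
have bp0 : banded D p0 by apply: bandedZ => //; exact: strip_cont.
have br0 : banded D r0 by apply: bandedZ => //; exact: strip_cont.
have lp0 : normX_le 0 (lam p0) mu.
  rewrite /p0 /lam (multiplierZ _ (symbol_lambda R) sh) -/(lam _).
  have w : wiener 0 (multiplier (@sqrt_sym R) hinit).
    by apply: strip_wiener0; apply: strip_multiplier => //; exact: symbol_sqrt.
  have h := normX_lam_sqrt D0 sh bh (wiener_normX w).
  apply: normX_le_mono (normXZ eps^-1 (strip_cont (strip_lam sh)) h).
  rewrite ger0_norm// ler_wpM2l// -sqrtLambdaE -/a /S.
  apply: ler_wpDr; first exact: normr_ge0.
  by rewrite ler_wpM2l ?sqrtr_ge0// ler_norm.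
have nr0 : normX_le 0 r0 mu.
  have h := wiener_normX (strip_wiener0 sd).
  apply: normX_le_mono (normXZ eps^-1 (strip_cont sd) h).
  rewrite ger0_norm// ler_wpM2l// -/b /S.
  apply: ler_wpDl; last exact: ler_norm.
  by rewrite mulr_ge0 ?sqrtr_ge0.
have np0 := wiener_normX (strip_wiener0 sp0).
set M0 := fine _ in np0.
have M00 : 0 <= M0 by exact: normX_bound_ge0 np0.
have Da : D <= alpha a b by rewrite /alpha; have := X0 a b; set X := _ * S a b => hX; lra.
have ga : g < alpha a b by rewrite /alpha; have := X0 a b; set X := _ * S a b => hX; lra.
have small : 4 * (D * (2 * g + 1) / (alpha a b - g)) * mu * (eps * expR (D + 2)) <= 1.
  have d0 : 0 < alpha a b - g by rewrite subr_gt0.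
  have -> : 4 * (D * (2 * g + 1) / (alpha a b - g)) * mu * (eps * expR (D + 2)) =
    4 * (D * (2 * g + 1)) * expR (D + 2) * S a b / (alpha a b - g).
    by rewrite /mu; field; rewrite (gt_eqF d0) (gt_eqF eps_gt0).
  rewrite ler_pdivrMr// mul1r /alpha; have := X0 a b; set X := _ * S a b => hX; lra.
pose T := (alpha a b)^-1.
have T0 : 0 <= T by rewrite invr_ge0 ltW.
pose hk := stokes g p0 r0; pose hkt := stokes_vel g p0 r0; pose hka := stokes_acc g p0 r0.
have sc := stokes_cont g0 D0 mu0 M00 (a1 a b) Da ga sp0 sr0 bp0 br0 lp0 nr0 np0.
have sder := stokes_deriv g0 D0 mu0 M00 (a1 a b) Da ga sp0 sr0 bp0 br0 lp0 nr0 np0.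
have sderv := stokes_vel_deriv g0 D0 mu0 M00 (a1 a b) Da ga sp0 sr0 bp0 br0 lp0 nr0 np0.
have seq := stokes_eq g0 D0 mu0 M00 (a1 a b) Da ga sp0 sr0 bp0 br0 lp0 nr0 np0.
have s0 := stokes0 g0 D0 mu0 M00 (a1 a b) Da ga sp0 sr0 bp0 br0 lp0 nr0 np0.
have h2 : 0 < 2^-1 :> R by rewrite invr_gt0.
have st f : wiener (2^-1 : R) f -> strip f by exact: wiener_strip.
have Hk : stokes_coefficients eps g hinit hdinit hk hkt.
  move=> k; have [ck ckt] := sc k; split.
  - by exists (2^-1) => //; split; apply/cont_inP.
  - by apply/time_derivativeP => x; exact: sder.
  - apply/time_derivativeP => x; apply: deriv_on_eq (sderv _ k x) => t It.
    rewrite seq LambdaE; congr (_ + _); apply: eq_bigr => j _.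
    rewrite nlin_stokes//; apply: st; first [exact: (sc _).1.1|exact: (sc _).2.1].
  - by move=> x; rewrite /hk (s0 k).1; case: k {ck ckt} => [|k] //; rewrite /p0 mulrC.
  - by move=> x; rewrite /hkt (s0 k).2; case: k {ck ckt} => [|k] //; rewrite /r0 mulrC.
have dP := stokes_dominated g0 D0 mu0 M00 (a1 a b) Da ga sp0 sr0 bp0 br0 lp0 nr0 np0.
have dV := stokes_vel_dominated g0 D0 mu0 M00 (a1 a b) Da ga sp0 sr0 bp0 br0 lp0 nr0 np0.
have dA := stokes_acc_dominated g0 D0 mu0 M00 (a1 a b) Da ga sp0 sr0 bp0 br0 lp0 nr0 np0.
pose h := expansion eps hk; pose ht := expansion eps hkt; pose htt := expansion eps hka.
have ch := expansion_cont g0 D0 mu0 M00 eps_gt0 (a1 a b) ga small dP.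
have cht := expansion_cont g0 D0 mu0 M00 eps_gt0 (a1 a b) ga small dV.
have dh x := expansion_deriv g0 D0 mu0 M00 eps_gt0 (a1 a b) ga small dP dV (fun k => sder _ k x).
have dht x := expansion_deriv g0 D0 mu0 M00 eps_gt0 (a1 a b) ga small dV dA (fun k => sderv _ k x).
have eqh t x := expansion_eq g0 D0 mu0 M00 eps_gt0 (a1 a b) Da ga sp0 sr0 bp0 br0 lp0 nr0 np0 small (t := t) x.
have h0 := expansion0 g0 D0 mu0 M00 eps_gt0 (a1 a b) ga small dP (fun k => (s0 k).1).
have ht0 := expansion0 g0 D0 mu0 M00 eps_gt0 (a1 a b) ga small dV (fun k => (s0 k).2).
have ee f x : eps * (eps^-1 * f x) = f x :> R by rewrite mulrA divff ?mul1r// gt_eqF.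
have h0E x : h 0 x = hinit x by rewrite /h h0 /p0 ee.
have ht0E x : ht 0 x = hdinit x by rewrite /ht ht0 /r0 ee.
exists h, ht; split.
- split.
  + by apply/cont_inP.
  + by exists (2^-1) => //; apply/cont_inP.
  + by move=> t It; split; apply: strip_real_analytic; apply: st; [exact: ch.1|exact: cht.1].
  + exact/time_derivativeP.
  split=> //; exists htt; first exact/time_derivativeP.
  move=> t x It; rewrite nlin_model; [|exact: st (ch.1 t It)|exact: st (cht.1 t It)].
  by rewrite /htt eqh// LambdaE; ring.
- move=> h' ht' [/cont_inP c1 [s sp /cont_inP c2] _ /time_derivativeP d1 [[htt' /time_derivativeP d2 eq'] i1 i2]].
  move=> t x It; pose tau := Num.min (2^-1) s.
  have tau0 : 0 < tau by rewrite lt_min h2.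
  have t1 : tau <= 2^-1 by rewrite /tau ge_min lexx.
  have t2 : tau <= s by rewrite /tau ge_min lexx orbT.
  apply: (@model_unique R g g0 T tau h' ht' htt' h ht htt T0 tau0
    (cont_in_mono t1 c1) (cont_in_mono t2 c2) (cont_in_mono t1 ch) (cont_in_mono t1 cht) d1 d2 dh dht) => //.
  + move=> u y Iu; have E := eq' u y Iu; rewrite nlin_model in E; last 2 first.
    * exact: st (c1.1 u Iu).
    * exact: (wiener_strip sp (c2.1 u Iu)).
    by rewrite -E LambdaE; ring.

  + by move=> y; rewrite i1 h0E.
  + by move=> y; rewrite i2 ht0E.
- by exists hk, hkt.
- move=> hk' hkt' Hk'; have U := stokes_unique g0 Hk' Hk.
  split.
    exact: (expansion_uniform_cvg g0 D0 mu0 M00 eps_gt0 (a1 a b) ga small dP (fun k t x t0 => (U k t x t0).1)).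
  exact: (expansion_uniform_cvg g0 D0 mu0 M00 eps_gt0 (a1 a b) ga small dV (fun k t x t0 => (U k t x t0).2)).
Qed.
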